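(* Let $f$ be a $C^2$-smooth SGP with covariance kernel $K$ and with a spectral density. Suppose moreover that $K(x)>0$ for all $x$, that $\sup_x|K'(x)|/K(x)<\infty$, and that for every $c_1>0$ there exists $c_2>0$ such that, for every $r\ge1$, $$\min_{|x|\le r}K(x)\ge c_1\bar K(c_2r).$$ Then for every integer $k\ge2$ there exists $c>0$ such that for every $r\ge c$ and $s\ge cr$, $$\rho^k_{r,s}\le c\,r^2\,\bar K(s)\,\big(\log(1/G(r))\big)^3.$$
   Context: An SGP is a stationary, non-zero, centred, real-valued Gaussian process $f$ on $\mathbb{R}$; $C^2$-smooth means that its sample paths are almost surely $C^2$. Its covariance kernel is $K(x)=\mathbb{E}[f(0)f(x)]$, and its spectral measure is the positive measure $\mu$ whose Fourier transform is $K$; $f$ has a spectral density if $\mu$ has a density with respect to Lebesgue measure. Let $\bar K(s)=\max_{r\ge s}|K(r)|$. For an interval $I$ let $\mathcal{G}_I$ be the event that $f$ has no zero in $I$, and $G(r)=\mathbb{P}[\mathcal{G}_{[0,r]}]$. Let $\mathcal{Q}^k_{r,s}$ be the set of collections of $k$ disjoint compact intervals $(I_i)_{i\le k}$, each of length at most $r$, that are pairwise separated by distance at least $s$. The splitting coefficient is $$\rho^k_{r,s}=\inf\Big\{\varepsilon\in[0,1]:\ \frac{\mathbb{P}[\cap_i\mathcal{G}_{I_i}]}{\prod_i\mathbb{P}[\mathcal{G}_{I_i}]}\in[1-\varepsilon,\,1/(1-\varepsilon)]\ \text{ for all }(I_i)_{i\le k}\in\mathcal{Q}^k_{r,s}\Big\},$$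 with $1/0=\infty$. *)

(* Defs.v *)
From HB Require Import structures.
From mathcomp Require Import all_boot all_order all_algebra.
From mathcomp Require Import all_classical all_reals all_analysis.

Set Implicit Arguments.
Unset Strict Implicit.
Unset Printing Implicit Defensive.

Import Order.TTheory GRing.Theory Num.Theory.
Import numFieldNormedType.Exports.

Local Open Scope classical_set_scope.
Local Open Scope ring_scope.

Section gaussian_processes.
Context {R : realType} {d : measure_display} {T : measurableType d}.
Variable P : probability T R.

(* Point masses count as (degenerate) Gaussian laws; the case split is needed
   because [normal_prob m 0] is the uniform law on [0, 1], not [\d_m]. *)
Definition is_gaussian (X : T -> R) : Prop :=
  exists m s : R, 0 <= s /\
    forall A : set R, measurable A ->
      P (X @^-1` A) = if s == 0 then \d_m A else normal_prob m s A.

Definition gaussian_process (f : R -> {RV P >-> R}) : Prop :=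
  forall (n : nat) (t a : 'I_n -> R),
    is_gaussian (fun w => \sum_(i < n) a i * f (t i) w).

Definition stationary (f : R -> {RV P >-> R}) : Prop :=
  forall (n : nat) (t : 'I_n -> R) (h : R) (B : set (n.-tuple R)),
    measurable B ->
    P ((fun w => [tuple f (t i + h) w | i < n]) @^-1` B) =
    P ((fun w => [tuple f (t i) w | i < n]) @^-1` B).

Record SGP (f : R -> {RV P >-> R}) : Prop := {
  SGP_gaussian : gaussian_process f;
  SGP_stationary : stationary f;
  SGP_centred : forall t, ('E_P[f t] = 0)%E;
  SGP_nonzero : exists t, ~ {ae P, forall w, f t w = 0}
}.

Definition C2 (g : R -> R) : Prop :=
  [/\ forall x, derivable g x 1,
      forall x, derivable (g^`())%classic x 1 &
      continuous (g^`(2))%classic].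

Definition C2_smooth (f : R -> {RV P >-> R}) : Prop :=
  {ae P, forall w, C2 (fun t => f t w)}.

Definition covariance_kernel (f : R -> {RV P >-> R}) (x : R) : R :=
  fine ('E_P[f 0%R \* f x])%E.

(* When the paths of [f] are continuous only almost surely, this set need not
   be measurable: it differs from a measurable set by a null set. *)
Definition no_zero (f : R -> {RV P >-> R}) (I : set R) : set T :=
  [set w | forall t, I t -> f t w != 0].

(* The outer measure of [P]: it extends [P] and agrees with the completion of
   [P] on sets that are measurable up to a null set. *)
Definition prob (A : set T) : R := fine (mu_ext P A).

Definition persistence (f : R -> {RV P >-> R}) (r : R) : R :=
  prob (no_zero f `[0, r]).

(* Here [/] is the division of [\bar R], for which 1 / 0 = +oo. *)
Definition splitting_ratio (f : R -> {RV P >-> R}) (k : nat)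
    (I : 'I_k -> set R) : \bar R :=
  ((prob (\bigcap_(i in [set: 'I_k]) no_zero f (I i)))%:E
    / (\prod_(i < k) prob (no_zero f (I i)))%:E)%E.

End gaussian_processes.

Section kernels.
Context {R : realType}.

(* The Fourier transform of [mu] is [K], i.e. the integral of
   exp(- i x l) d mu(l) is K(x) for all x, split into real and imaginary parts
   as [K] is real-valued. *)
Definition is_spectral_measure
    (mu : {finite_measure set (measurableTypeR R) -> \bar R}) (K : R -> R) :
    Prop :=
  forall x : R,
    (\int[mu]_l (cos (x * l))%:E = (K x)%:E)%E /\
    (\int[mu]_l (- sin (x * l))%:E = 0)%E.

Definition has_density
    (mu : {finite_measure set (measurableTypeR R) -> \bar R}) : Prop :=
  exists g : R -> R,
    [/\ measurable_fun [set: R] g,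
        forall l, 0 <= g l &
        forall A : set (measurableTypeR R), measurable A ->
          (mu A = \int[lebesgue_measure]_(l in A) (g l)%:E)%E].

Definition has_spectral_density (K : R -> R) : Prop :=
  exists mu : {finite_measure set (measurableTypeR R) -> \bar R},
    is_spectral_measure mu K /\ has_density mu.

(* A maximum when [K] is continuous and vanishes at infinity, as is the case for
   the kernel of a smooth process with a spectral density. *)
Definition Kbar (K : R -> R) (s : R) : R :=
  sup [set `|K r| | r in `[s, +oo[].

Definition separated_intervals (k : nat) (r s : R) (I : 'I_k -> set R) : Prop :=
  [/\ forall i, exists a b : R,
        [/\ a <= b, b - a <= r & I i = `[a, b]%classic],
      trivIset [set: 'I_k] I &
      forall i j, i != j ->
        forall x y, I i x -> I j y -> s <= `|x - y|].

End kernels.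

Definition splitting_coefficient (R : realType) (d : measure_display)
    (T : measurableType d) (P : probability T R) (f : R -> {RV P >-> R})
    (k : nat) (r s : R) : R :=
  inf [set e : R | 0 <= e <= 1 /\
    forall I : 'I_k -> set R, separated_intervals r s I ->
      ((1 - e)%:E <= splitting_ratio f I <= 1 / (1 - e)%:E)%E].

(* Main.v *)
(* On a finite grid, Slepian's inequality compares the process on two groups of
   intervals with the Gaussian vector that has the same diagonal blocks and cross
   covariances +t h_i h_j or -t h_i h_j, where h_i is the covariance of the i-th
   coordinate with the normalized sum N of its group over points at unit steps.
   As K > 0 and K >= delta on [-1, 1], h is bounded below, so some t of order
   r^2 Kbar(s) dominates the true cross covariances. In the comparison vector the
   groups interact only through the two standard normal variables N, and giving
   these a correlation t changes the probability of a product of events of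
   probability at least p by a factor exp(O(t log(1/p))).  One splits off the
   intervals one by one, for each choice of the signs of f on the intervals, with
   p of order G(r)^k; refining the grid and summing over the signs bounds the
   splitting ratio by exp(O(r^2 Kbar(s) log(1/G(r)))). Since K tends to 0, f changes
   sign with positive probability, so log(1/G(r)) is bounded below and may be
   replaced by a multiple of its cube. *)
Require Import Defs.
From HB Require Import structures.
From mathcomp Require Import all_boot all_order all_algebra.
From mathcomp Require Import all_classical all_reals all_analysis.
From mathcomp Require Import measurable_realfun ring lra.

Set Implicit Arguments.
Unset Strict Implicit.
Unset Printing Implicit Defensive.

Import Order.TTheory GRing.Theory Num.Theory.
Import numFieldNormedType.Exports.

Local Open Scope classical_set_scope.
Local Open Scope ring_scope.

(** * Integration against normal laws *)

(** The vectors at hand may be degenerate and, once signs are attached, have covariances of either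
    sign, so joint densities and inverse covariances are avoided: a Gaussian vector is known only by
    its characteristic function. Slepian's inequality is therefore tested on trigonometric
    polynomials, for which the derivative along the interpolation is an exact finite sum. The price
    is periodicity: the approximate steps cannot be monotone, and their decreasing stretches are
    pushed so far out that their contribution vanishes in the limit. The comparison vector needs no
    positivity argument, as it is built from two residuals and a correlated pair of normal
    variables. For that pair, the conditional density is bounded by a product of functions of one
    variable with quadratic exponents; an exponential moment controls these, and this is where
    log(1/p) appears. All estimates must be uniform in the grid. Hence only the points at unit
    steps, of order r per interval, enter the projection: its variance is at most of order r^2
    however fine the grid, and normalizing in both groups costs the factor r^2. *)

Section density.
Context {R : realType} {d : measure_display} {T : measurableType d}.
Variables (mu nu : {measure set T -> \bar R}) (g : T -> R).
Hypothesis mg : measurable_fun setT g.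
Hypothesis g0 : forall x, 0 <= g x.
Hypothesis nuE : forall A, measurable A -> nu A = (\int[mu]_(x in A) (g x)%:E)%E.
Import HBNNSimple.

Lemma ge0_integral_density (f : T -> \bar R) :
  measurable_fun setT f -> (forall x, 0 <= f x)%E ->
  (\int[nu]_x f x = \int[mu]_x (f x * (g x)%:E))%E.
Proof.
move=> mf f0.
have mgE : measurable_fun setT (fun x => (g x)%:E) by exact/measurable_EFinP.
pose h := nnsfun_approx measurableT mf.
have hE n : (\int[nu]_x (h n x)%:E = \int[mu]_x ((h n x)%:E * (g x)%:E))%E.
  under [RHS]eq_integral => x _.
    rewrite fimfunE -fsumEFin// ge0_mule_fsuml; last first.
      by move=> r; rewrite EFinM nnfun_muleindic_ge0.
    over.
  rewrite ge0_integral_fsum//; last 2 first.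
    - move=> r; apply: emeasurable_funM => //; apply/measurable_EFinP.
      by apply: measurable_funM => //; exact: measurable_indic.
    - move=> r x _; rewrite mule_ge0 ?lee_fin//.
      by have := @nnfun_muleindic_ge0 _ _ R (h n) r x; rewrite -EFinM lee_fin.
  rewrite integralT_nnsfun sintegralE; apply: eq_fsbigr => r rh.
  have r0 : 0 <= r.
    by move: rh; rewrite inE => -[x _ <-].
  rewrite nuE//; under [RHS]eq_integral do rewrite EFinM -muleA.
  rewrite ge0_integralZl//=; last 2 first.
    - apply: emeasurable_funM => //; apply/measurable_EFinP.
      exact: measurable_indic.
    - by move=> x _; rewrite mule_ge0 ?lee_fin.
  congr (_ * _)%E; rewrite integral_mkcond; apply: eq_integral => x _.
  rewrite patchE/= indicE; case: ifPn => _; by rewrite ?mul1e ?mul0e.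
transitivity (lim (\int[nu]_x (h n x)%:E @[n --> \oo])%E).
  rewrite -monotone_convergence//=.
  - by apply: eq_integral => x _; apply/esym/cvg_lim => //; exact: cvg_nnsfun_approx.
  - by move=> n; exact/measurable_EFinP/measurable_funTS.
  - by move=> n x _; rewrite lee_fin.
  - by move=> x _ a b ab; rewrite lee_fin; exact/lefP/nd_nnsfun_approx.
under eq_fun do rewrite hE.
rewrite -monotone_convergence//=.
- apply: eq_integral => x _; apply/cvg_lim => //.
  under eq_fun do rewrite muleC.
  rewrite muleC; apply: cvgeZl => //; exact: cvg_nnsfun_approx.
- move=> n; apply: emeasurable_funM => //.
  exact/measurable_EFinP/measurable_funTS.
- by move=> n x _; rewrite mule_ge0 ?lee_fin.
- move=> x _ a b ab; rewrite lee_wpmul2r ?lee_fin//.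
  exact/lefP/nd_nnsfun_approx.
Qed.

Lemma integrable_density (f : T -> R) : measurable_fun setT f ->
  mu.-integrable setT (fun x => (f x * g x)%:E) ->
  nu.-integrable setT (EFin \o f).
Proof.
move=> mf /integrableP[mfg ifg]; apply/integrableP; split.
  exact/measurable_EFinP.
rewrite ge0_integral_density//; last first.
  by do 2 apply: measurableT_comp => //.
apply: le_lt_trans ifg; apply: ge0_le_integral => //=.
- by move=> x _; rewrite mule_ge0 ?lee_fin.
- apply: emeasurable_funM => //; last exact/measurable_EFinP.
  by do 2 apply: measurableT_comp => //.
- by do 2 apply: measurableT_comp => //; exact: measurable_funM.
- by move=> x _; rewrite normrM (ger0_norm (g0 x)) EFinM.
Qed.

Lemma Rintegral_density (f : T -> R) : measurable_fun setT f ->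
  mu.-integrable setT (fun x => (f x * g x)%:E) ->
  \int[nu]_x f x = \int[mu]_x (f x * g x).
Proof.
move=> mf ifg; rewrite /Rintegral; congr fine.
rewrite integralE [RHS]integralE; congr (_ - _)%E.
- rewrite ge0_integral_density//; last first.
    by apply: measurable_funepos; exact/measurable_EFinP.
  apply: eq_integral => x _; rewrite /= !funeposE.
  by rewrite EFinM maxe_pMl ?lee_fin// mul0e.
- rewrite ge0_integral_density//; last first.
    by apply: measurable_funeneg; exact/measurable_EFinP.
  apply: eq_integral => x _; rewrite /= !funenegE.
  by rewrite maxe_pMl ?lee_fin// mul0e -EFinN -EFinM mulNr EFinN.
Qed.

End density.

Section bounded_integrals.
Context {R : realType} {d : measure_display} {T : measurableType d}.
Variable P : probability T R.

Lemma bounded_integrable (M : R) (f : T -> R) : measurable_fun setT f ->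
  (forall w, `|f w| <= M) -> P.-integrable setT (EFin \o f).
Proof.
move=> mf fM.
have PT : (P [set: T] < +oo)%E by rewrite probability_setT ltry.
apply: measurable_bounded_integrable => //.
exists M; split; first exact: num_real.
by move=> x Mx w _; rewrite /= (le_trans (fM w))// ltW.
Qed.

Lemma Rintegral_probability_cst (c : R) : \int[P]_w c = c.
Proof.
have PT : fine (P [set: T]) = 1 by rewrite probability_setT.
by rewrite Rintegral_cst// [X in _ * X]PT mulr1.
Qed.

Lemma Rintegral_indic_probability (A : set T) : measurable A ->
  \int[P]_w \1_A w = fine (P A).
Proof. by move=> mA; rewrite /Rintegral integral_indic// setIT. Qed.

Lemma bounded_cvg_Rintegral (M : R) (f_ : nat -> T -> R) (f : T -> R) :
  (forall n, measurable_fun setT (f_ n)) ->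
  (forall n w, `|f_ n w| <= M) ->
  (forall w, f_ n w @[n --> \oo] --> f w) ->
  \int[P]_w f_ n w @[n --> \oo] --> \int[P]_w f w.
Proof.
move=> mf fM cf.
have mf' : measurable_fun setT f.
  by apply: (measurable_fun_cvg mf) => w _; exact: cf.
have [] := @dominated_convergence _ T R P setT measurableT
  (fun n w => (f_ n w)%:E) (EFin \o f) (cst M%:E).
- by move=> n; exact/measurable_EFinP.
- exact/measurable_EFinP.
- by apply: aeW => w _; apply: cvg_EFin; [exact: nearW | exact: cf].
- by apply: (@bounded_integrable `|M|) => // w.
- by apply: aeW => w n _ /=; rewrite lee_fin.
move=> intf _ cvgf; apply: fine_cvg.
by rewrite fineK//; exact: integrable_fin_num.
Qed.

End bounded_integrals.

(** * Moments and decay of the normal density *)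

Section normal_moments.
Context {R : realType}.
Local Notation leb := (@lebesgue_measure R).
Variables (m s : R).
Hypothesis s0 : s != 0.
Local Notation pdf := (normal_pdf m s).

Lemma Rintegral_normal (f : R -> R) : measurable_fun setT f ->
  leb.-integrable setT (fun x => (f x * pdf x)%:E) ->
  \int[normal_prob m s]_x f x = \int[leb]_x (f x * pdf x).
Proof.
move=> mf ifg; apply: (Rintegral_density (mu := leb)) => //.
- exact: measurable_normal_pdf.
- by move=> x; exact: normal_pdf_ge0.
Qed.

Lemma is_derive_normal_pdf (x : R) :
  is_derive x 1 pdf (- (x - m) / s ^+ 2 * pdf x).
Proof.
rewrite (normal_pdfE _ s0) /normal_fun; apply: is_derive_eq.
rewrite /GRing.scale/=; field.
by rewrite s0.
Qed.

(** Half of the exponent is spent on the square, by [1 + u <= expR u] with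
    [u = (x - m)^2 / (4 s^2)]. What remains is proportional to the density of variance [2 s^2], and
    [sqrt 2] corrects the peak. *)
Lemma sqr_normal_pdf_ub (x : R) :
  (x - m) ^+ 2 * pdf x <=
  (4 * s ^+ 2 * Num.sqrt 2) * normal_pdf m (Num.sqrt 2 * s) x.
Proof.
have q0 : Num.sqrt 2 * s != 0 :> R by rewrite mulf_neq0// gt_eqF// sqrtr_gt0.
have s2 : 0 < s ^+ 2 by rewrite exprn_even_gt0.
have q2 : (Num.sqrt 2 : R) ^+ 2 = 2 by rewrite sqr_sqrtr.
rewrite !normal_pdfE// /normal_fun /normal_peak exprMn q2.
set y := (x - m) ^+ 2.
have -> : 2 * s ^+ 2 * pi *+ 2 = 2 * (s ^+ 2 * pi *+ 2) by rewrite mulr_natl; ring.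
rewrite (sqrtrM (s ^+ 2 * pi *+ 2)) ?ler0n// invfM.
set q := (Num.sqrt (s ^+ 2 * pi *+ 2))^-1.
have qge0 : 0 <= q by rewrite invr_ge0.
have -> : 4 * s ^+ 2 * Num.sqrt 2 * ((Num.sqrt 2)^-1 * q * expR (- y / (2 * s ^+ 2 *+ 2))) =
   q * (4 * s ^+ 2 * expR (- y / (2 * s ^+ 2 *+ 2))).
  by field; rewrite gt_eqF// sqrtr_gt0.
rewrite mulrCA; apply: ler_wpM2l => //.
have -> : - y / (s ^+ 2 *+ 2) = - y / (2 * s ^+ 2 *+ 2) + - (y / (2 * s ^+ 2 *+ 2)).
  by field; rewrite s0.
rewrite expRD expRN mulrCA [leRHS]mulrC; apply: ler_wpM2l; first exact: expR_ge0.
rewrite ler_pdivrMr ?expR_gt0//.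
apply: le_trans (_ : 4 * s ^+ 2 * (1 + y / (2 * s ^+ 2 *+ 2)) <= _).
  have -> : 4 * s ^+ 2 * (1 + y / (2 * s ^+ 2 *+ 2)) = 4 * s ^+ 2 + y.
    by field; rewrite s0.
  by rewrite lerDr mulr_ge0// ltW.
by apply: ler_wpM2l (expR_ge1Dx _); rewrite mulr_ge0// ltW.
Qed.

Lemma measurable_centred_sqr : measurable_fun setT (fun x : R => (x - m) ^+ 2).
Proof. by apply: measurable_funX; exact: measurable_funB. Qed.

Lemma integrable_sqr_normal_pdf :
  leb.-integrable setT (fun x => ((x - m) ^+ 2 * pdf x)%:E).
Proof.
apply: (@le_integrable _ _ _ leb setT measurableT _
  (fun x => ((4 * s ^+ 2 * Num.sqrt 2) * normal_pdf m (Num.sqrt 2 * s) x)%:E)) => //=.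
- apply/measurable_EFinP; apply: measurable_funM; first exact: measurable_centred_sqr.
  exact: measurable_normal_pdf.
- move=> x _; rewrite lee_fin ger0_norm; last by rewrite mulr_ge0 ?sqr_ge0 ?normal_pdf_ge0.
  by rewrite (le_trans (sqr_normal_pdf_ub x))// ler_norm.
- under eq_fun do rewrite EFinM.
  by apply: integrableZl => //; exact: integrable_normal_pdf.
Qed.

Lemma integrable_normal_dominated (A B : R) (h : R -> R) : measurable_fun setT h ->
  (forall x, `|h x| <= A + B * (x - m) ^+ 2) ->
  leb.-integrable setT (fun x => (h x * pdf x)%:E).
Proof.
move=> mh hAB.
apply: (@le_integrable _ _ _ leb setT measurableT _
  (fun x => (A * pdf x)%:E + (B * ((x - m) ^+ 2 * pdf x))%:E)%E) => //=.
- apply/measurable_EFinP; apply: measurable_funM => //; exact: measurable_normal_pdf.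
- move=> x _; rewrite lee_fin normrM (ger0_norm (normal_pdf_ge0 _ _ _)).
  rewrite mulrA -mulrDl.
  apply: le_trans (_ : (A + B * (x - m) ^+ 2) * pdf x <= _); last exact: ler_norm.
  by rewrite ler_wpM2r ?normal_pdf_ge0.
- apply: integrableD => //.
    under eq_fun do rewrite EFinM.
    by apply: integrableZl => //; exact: integrable_normal_pdf.
  under eq_fun do rewrite EFinM.
  by apply: integrableZl => //; exact: integrable_sqr_normal_pdf.
Qed.

End normal_moments.

Section normal_tail.
Context {R : realType}.
Local Notation leb := (@lebesgue_measure R).
Variables (m s : R).
Hypothesis s0 : s != 0.
Local Notation pdf := (normal_pdf m s).

Lemma normal_pdf_ub_inv (x : R) :
  pdf x <= normal_peak s * (1 + (x - m) ^+ 2 / (s ^+ 2 *+ 2))^-1.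
Proof.
have y0 : 0 <= (x - m) ^+ 2 / (s ^+ 2 *+ 2).
  by rewrite divr_ge0 ?sqr_ge0// mulrn_wge0// sqr_ge0.
rewrite normal_pdfE// ler_wpM2l ?normal_peak_ge0// /normal_fun mulNr expRN.
rewrite lef_pV2 ?posrE ?expR_gt0 ?ltr_pwDl//.
exact: expR_ge1Dx.
Qed.

(** The hypothesis covers both [m + n] and [m - n], the ends of the intervals used for integration
    by parts in [Rintegral_normal_stein]. *)
Lemma cvg_normal_pdf_tail (x_ : nat -> R) :
  (forall n, (x_ n - m) ^+ 2 = n%:R ^+ 2) -> pdf (x_ n) @[n --> \oo] --> 0.
Proof.
move=> xn.
have a0 : 0 < s ^+ 2 *+ 2 by rewrite mulrn_wgt0// exprn_even_gt0.
set a := s ^+ 2 *+ 2 in a0 *.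
apply: (@squeeze_cvgr _ _ _ _ (cst 0)
   (fun n => (normal_peak s * (2 * (a + 1))) * harmonic n)).
- apply: nearW => n; rewrite normal_pdf_ge0/=.
  apply: le_trans (normal_pdf_ub_inv _) _.
  rewrite -mulrA; apply: ler_wpM2l; first exact: normal_peak_ge0.
  rewrite xn -/a /harmonic/= ler_pdivlMr ?ltr0n// mulrC ler_pdivrMr; last first.
    by apply: ltr_pwDl => //; apply: divr_ge0; [exact: sqr_ge0|exact: ltW].
  rewrite -natr1.
  have key (b x : R) : 0 < b -> 0 <= x -> x + 1 <= 2 * (b + 1) * (1 + x ^+ 2 / b).
    move=> b0 x0; rewrite -(ler_pM2l b0).
    have -> : b * (2 * (b + 1) * (1 + x ^+ 2 / b)) = 2 * (b + 1) * (b + x ^+ 2).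
      by field; rewrite gt_eqF.
    have := mulr_ge0 (ltW b0) (sqr_ge0 (x - 4^-1)); have := sqr_ge0 b.
    by have := sqr_ge0 x; nra.
  exact: key.
- exact: cvg_cst.
- rewrite -[X in _ --> X](mulr0 (normal_peak s * (2 * (a + 1)))).
  by apply: cvgMr; exact: cvg_harmonic.
Qed.

End normal_tail.

(** * Stein's identity and the characteristic function of a normal law *)

Section stein.
Context {R : realType}.
Local Notation leb := (@lebesgue_measure R).
Variables (m s : R).
Hypothesis s0 : s != 0.
Local Notation pdf := (normal_pdf m s).
Variables (g g' : R -> R) (A B : R).
Hypothesis dg : forall x : R, is_derive x 1 g (g' x).
Hypothesis cg' : continuous g'.
Hypothesis gAB : forall x, `|(x - m) * g x| <= A + B * (x - m) ^+ 2.
Hypothesis g'AB : forall x, `|g' x| <= A + B * (x - m) ^+ 2.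

Let F x := g x * pdf x.
Let k x := (g' x - (x - m) * g x / s ^+ 2) * pdf x.

Let dF (x : R) : is_derive x 1 F (k x).
Proof.
have := is_derive_normal_pdf m s0 x => dp.
apply: is_derive_eq; rewrite /GRing.scale/= /k.
by field; rewrite s0.
Qed.

Let continuous_derivable (h h' : R -> R) : (forall x : R, is_derive x 1 h (h' x)) ->
  continuous h.
Proof.
move=> dh x; apply: differentiable_continuous; apply/derivable1_diffP.
by have [] := dh x.
Qed.

Let cg : continuous g. Proof. exact: continuous_derivable. Qed.

Let ck : continuous k.
Proof.
move=> x; apply: cvgM; last exact: continuous_normal_pdf.
apply: cvgB; first exact: cg'.
apply: cvgMl; apply: cvgM; last exact: cg.
by apply: cvgB; [exact: cvg_id|exact: cvg_cst].
Qed.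

Let mg : measurable_fun setT g.
Proof. exact: continuous_measurable_fun. Qed.

Let mg' : measurable_fun setT g'.
Proof. exact: continuous_measurable_fun. Qed.

Let mxg : measurable_fun setT (fun x : R => (x - m) * g x).
Proof. by apply: measurable_funM => //; exact: measurable_funB. Qed.

Let ig' : leb.-integrable setT (fun x : R => (g' x * pdf x)%:E).
Proof. exact: (integrable_normal_dominated s0 mg' g'AB). Qed.

Let ig : leb.-integrable setT (fun x : R => ((x - m) * g x * pdf x)%:E).
Proof. exact: (integrable_normal_dominated s0 mxg gAB). Qed.

Let kE x : k x = g' x * pdf x - (s ^+ 2)^-1 * ((x - m) * g x * pdf x).
Proof. by rewrite /k; field; rewrite s0. Qed.

Let ik : leb.-integrable setT (EFin \o k).
Proof.
rewrite (_ : EFin \o k = ((fun x => (g' x * pdf x)%:E) \-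
   (fun x => (s ^+ 2)^-1%:E * ((x - m) * g x * pdf x)%:E))%E); last first.
  by apply/funext => x /=; rewrite kE EFinB EFinM.
by apply: integrableB => //; exact: integrableZl.
Qed.

Let cvg_F (x_ : nat -> R) :
  (forall n, (x_ n - m) ^+ 2 = n%:R ^+ 2) -> F (x_ n) @[n --> \oo] --> 0.
Proof.
move=> xn.
have q0 : Num.sqrt 2 * s != 0 :> R by rewrite mulf_neq0// gt_eqF// sqrtr_gt0.
apply: norm_cvg0.
pose C := 4 * s ^+ 2 * Num.sqrt 2.
apply: (@squeeze_cvgr _ _ _ _ (cst 0) (fun n => `|A| * pdf (x_ n) +
   `|B| * (C * normal_pdf m (Num.sqrt 2 * s) (x_ n)))); last 2 first.
- exact: cvg_cst.
- rewrite (_ : 0 = `|A| * 0 + `|B| * (C * 0)); last by rewrite !mulr0 addr0.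
  apply: cvgD; apply: cvgMr; first exact: cvg_normal_pdf_tail.
  by apply: cvgMr; exact: cvg_normal_pdf_tail.
- near=> n; rewrite normr_ge0/= /F normrM (ger0_norm (normal_pdf_ge0 _ _ _)).
  have n1 : 1 <= n%:R :> R by rewrite ler1n; near: n; exact: nbhs_infty_gt.
  (* At distance at least 1 from [m], the growth bound on [(x - m) * g x] also bounds [g x]. *)
  have x1 : 1 <= `|x_ n - m|.
    rewrite -(ler_pXn2r (n := 2)) ?nnegrE// expr1n real_normK ?num_real// xn.
    by rewrite expr_ge1.
  have gx : `|g (x_ n)| <= `|A| + `|B| * (x_ n - m) ^+ 2.
    apply: le_trans (_ : `|(x_ n - m) * g (x_ n)| <= _).
      by rewrite normrM ler_peMl.
    apply: le_trans (gAB _) _; rewrite lerD ?ler_norm//.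
    by rewrite ler_wpM2r ?sqr_ge0 ?ler_norm.
  apply: le_trans (ler_wpM2r (normal_pdf_ge0 m s _) gx) _.
  rewrite mulrDl lerD2l -mulrA; apply: ler_wpM2l => //.
  exact: sqr_normal_pdf_ub.
Unshelve. all: end_near. Qed.

(** Integration by parts: [k] is the derivative of [g * pdf], so its integral over [[m - n, m + n]]
    is a boundary term that tends to 0, and by dominated convergence it also tends to the integral
    over the line. *)
Lemma Rintegral_normal_stein :
  \int[normal_prob m s]_x g' x =
  (s ^+ 2)^-1 * \int[normal_prob m s]_x ((x - m) * g x).
Proof.
rewrite (Rintegral_normal mg' ig') (Rintegral_normal mxg ig).
apply/eqP; rewrite -subr_eq0 -RintegralZl// -RintegralB//; last first.
  exact: (integrableZl measurableT _ ig).
under eq_Rintegral do rewrite -kE.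
apply/eqP.
pose D n := `[m - n%:R, m + n%:R]%classic : set R.
have kD0 : \int[leb]_(x in D n) k x @[n --> \oo] --> 0.
  have -> : (fun n => \int[leb]_(x in D n) k x) =
            (fun n => F (m + n%:R) - F (m - n%:R)).
    apply/funext => n; rewrite /D; case: n => [|n].
      by rewrite subr0 addr0 subrr set_itv1 Rintegral_set1.
    rewrite /Rintegral (@continuous_FTC2 _ k F)//.
    - by rewrite ltrD2l gtrN.
    - exact: continuous_subspaceT.
    - have cF : continuous F by exact: continuous_derivable dF.
      split.
      + by move=> x _; have [] := dF x.
      + by apply: cvg_at_right_filter; exact: cF.
      + by apply: cvg_at_left_filter; exact: cF.
    - by move=> x _; rewrite derive1E; have [_ ->] := dF x.
  rewrite -[X in _ --> X](subr0 0); apply: cvgB; apply: cvg_F => n.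
    by rewrite addrC addKr.
  by rewrite addrC addKr sqrrN.
have kD : \int[leb]_(x in D n) k x @[n --> \oo] --> \int[leb]_x k x.
  have [] := @dominated_convergence _ _ R leb setT measurableT
    (fun n x => ((k \_ (D n)) x)%:E) (EFin \o k) (fun x => `|k x|%:E).
  - move=> n; apply/measurable_EFinP; apply/(measurable_restrictT _ _).1 => //.
      exact: measurable_itv.
    by apply: measurable_funTS; exact: continuous_measurable_fun.
  - by apply/measurable_EFinP; exact: continuous_measurable_fun.
  - apply: aeW => x _; apply: cvg_near_cst; near=> n; congr EFin.
    rewrite patchE mem_set// /D/= in_itv/= -ler_distl.
    by near: n; exact: nbhs_infty_ger.
  - by have := integrable_abse ik.
  - apply: aeW => x n _; rewrite lee_fin patchE; case: ifP => // _.
    by rewrite normr0.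
  move=> _ _ /= H; under eq_fun do rewrite Rintegral_mkcond.
  apply: fine_cvg; rewrite fineK//; exact: integrable_fin_num.
exact: (cvg_unique _ kD kD0).
Unshelve. all: end_near. Qed.

End stein.

Section normal_charfun.
Context {R : realType}.
Variables (m s : R).
Hypothesis s0 : s != 0.

Lemma integrable_normal_sqr (c : R) (h : R -> R) : measurable_fun setT h ->
  (forall x, `|h x| <= c + c * (x - m) ^+ 2) ->
  (normal_prob m s).-integrable setT (EFin \o h).
Proof.
move=> mh hAB; apply: (integrable_density (mu := lebesgue_measure)
  (g := normal_pdf m s)) => //.
- exact: measurable_normal_pdf.
- by move=> x; exact: normal_pdf_ge0.
- exact: (integrable_normal_dominated s0 mh hAB).
Qed.

Lemma Rintegral_normal_centred : \int[normal_prob m s]_x (x - m) = 0.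
Proof.
have H : \int[normal_prob m s]_x 0 =
    (s ^+ 2)^-1 * \int[normal_prob m s]_x ((x - m) * 1).
  apply: (@Rintegral_normal_stein R m s s0 (cst 1) (cst 0) 1 1) => //.
  - by move=> x; exact: cvg_cst.
  - move=> x; rewrite /cst mulr1 mul1r; have := sqr_ge0 (`|x - m| - 2^-1).
    by rewrite -(real_normK (num_real (x - m))); nra.
  - by move=> x; rewrite /cst normr0 mul1r addr_ge0 ?sqr_ge0.
move: H; rewrite Rintegral_probability_cst => /esym/eqP.
rewrite mulf_eq0 invr_eq0 expf_eq0/= (negbTE s0)/= => /eqP.
by under eq_Rintegral do rewrite mulr1.
Qed.

Lemma Rintegral_normal_variance : \int[normal_prob m s]_x ((x - m) ^+ 2) = s ^+ 2.
Proof.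
have H : \int[normal_prob m s]_x 1 =
    (s ^+ 2)^-1 * \int[normal_prob m s]_x ((x - m) * (x - m)).
  apply: (@Rintegral_normal_stein R m s s0 (fun x => x - m) (cst 1) 1 1) => //.
  - by move=> x; apply: is_derive_eq; rewrite subr0.
  - by move=> x; exact: cvg_cst.
  - by move=> x; rewrite -expr2 ger0_norm ?sqr_ge0// mul1r lerDr.
  - by move=> x; rewrite /cst normr1 mul1r lerDl sqr_ge0.
move: H; rewrite Rintegral_probability_cst => /esym/(congr1 ( *%R (s ^+ 2))).
by rewrite mulVKf ?sqrf_eq0// mulr1.
Qed.

Lemma measurable_cos_affine (a c : R) : measurable_fun setT (fun x : R => cos (a * (x - m) + c)).
Proof.
apply: measurableT_comp => //; first exact: (continuous_measurable_fun (@continuous_cos R)).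
by apply: measurable_funD => //; apply: measurable_funM => //; exact: measurable_funB.
Qed.

(** As a function [H] of the frequency [b], the integral solves [H' = - b s^2 H]: differentiate
    under the integral and apply Stein's identity to the sine that appears. The integrating factor
    makes [E] constant. *)
Lemma Rintegral_normal_cos (a phi : R) :
  \int[normal_prob m s]_x cos (a * (x - m) + phi) =
  cos phi * expR (- ((a * s) ^+ 2 / 2)).
Proof.
pose H (b : R) := \int[normal_prob m s]_x cos (b * (x - m) + phi).
have abs_ub (x : R) : `|x - m| <= 1 + 1 * (x - m) ^+ 2.
  rewrite mul1r; have := sqr_ge0 (`|x - m| - 2^-1).
  by rewrite -(real_normK (num_real (x - m))); nra.
have iabs : (normal_prob m s).-integrable setT (EFin \o (fun x : R => `|x - m|)).
  apply: (@integrable_normal_sqr 1).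
    by apply: measurableT_comp => //; exact: measurable_funB.
  by move=> x; rewrite normr_id.
have icos (b : R) : (normal_prob m s).-integrable setT
   (EFin \o (fun x : R => cos (b * (x - m) + phi))).
  apply: (@bounded_integrable _ _ _ _ 1); first exact: measurable_cos_affine.
  by move=> x; exact: cos_max.
have dcos (b x : R) : is_derive b 1 (fun b => cos (b * (x - m) + phi))
    (- ((x - m) * sin (b * (x - m) + phi))).
  by apply: is_derive_eq; rewrite /GRing.scale/=; ring.
have dH (b : R) : is_derive b 1 H (- (b * s ^+ 2 * H b)).
  have bI : `]b - 1, b + 1[%classic b by rewrite /= in_itv/= ltrBlDr ltrDl ltr01.
  have ub (c x : R) : `|partial1of2 (fun b x => cos (b * (x - m) + phi)) c x| <= `|x - m|.
    rewrite partial1of2E; have [_ ->] := dcos c x.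
    by rewrite normrN normrM ler_piMr// sin_max.
  have d1 := @derivable_under_integral R _ _ (normal_prob m s)
    (fun b x => cos (b * (x - m) + phi)) setT measurableT b (b - 1) (b + 1) bI
    (fun c _ => icos c) (fun c x _ _ => let: DeriveDef d _ := dcos c x in d)
    (fun x => `|x - m|) (fun x => normr_ge0 _) iabs (fun c x _ _ => ub c x).
  have d2 := @differentiation_under_integral R _ _ (normal_prob m s)
    (fun b x => cos (b * (x - m) + phi)) setT measurableT b (b - 1) (b + 1) bI
    (fun c _ => icos c) (fun c x _ _ => let: DeriveDef d _ := dcos c x in d)
    (fun x => `|x - m|) (fun x => normr_ge0 _) iabs (fun c x _ _ => ub c x).
  apply: DeriveDef; first exact: d1.
  rewrite -derive1E [LHS]d2.
  under eq_Rintegral do rewrite partial1of2E.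
  have -> : \int[normal_prob m s]_x 'D_1 (fun b : R => cos (b * (x - m) + phi)) b =
      \int[normal_prob m s]_x (- 1 * ((x - m) * sin (b * (x - m) + phi))).
    by apply: eq_Rintegral => x _; have [_ ->] := dcos b x; rewrite mulN1r.
  have msin : measurable_fun setT (fun x : R => (x - m) * sin (b * (x - m) + phi)).
    apply: measurable_funM; first exact: measurable_funB.
    apply: measurableT_comp => //; first exact: (continuous_measurable_fun (@continuous_sin R)).
    by apply: measurable_funD => //; apply: measurable_funM => //; exact: measurable_funB.
  have sin_ub (x : R) : `|(x - m) * sin (b * (x - m) + phi)| <= 1 + 1 * (x - m) ^+ 2.
    by apply: le_trans (abs_ub x); rewrite normrM ler_piMr// sin_max.
  rewrite RintegralZl//; last exact: (@integrable_normal_sqr 1).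
  have S : \int[normal_prob m s]_x (b * cos (b * (x - m) + phi)) =
      (s ^+ 2)^-1 * \int[normal_prob m s]_x ((x - m) * sin (b * (x - m) + phi)).
    apply: (@Rintegral_normal_stein R m s s0 (fun x => sin (b * (x - m) + phi))
       (fun x => b * cos (b * (x - m) + phi)) (1 + `|b|) 1) => //.
    - by move=> x; apply: is_derive_eq; rewrite /GRing.scale/=; ring.
    - move=> x; apply: cvgMr; apply: continuous_cvg; first exact: continuous_cos.
      apply: cvgD; last exact: cvg_cst.
      by apply: cvgMr; apply: cvgB; [exact: cvg_id|exact: cvg_cst].
    - move=> x; apply: le_trans (sin_ub x) _; rewrite lerD2r lerDl//.
    - move=> x; rewrite normrM mul1r.
      apply: le_trans (_ : `|b| * 1 <= _); first by rewrite ler_wpM2l// cos_max.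
      by rewrite mulr1 addrAC lerDr addr_ge0// sqr_ge0.
  move: S; rewrite RintegralZl//.
  move=> /(congr1 ( *%R (s ^+ 2))); rewrite mulVKf ?sqrf_eq0// => <-.
  by rewrite /H; ring.
pose E (b : R) := H b * expR (b ^+ 2 * (s ^+ 2 / 2)).
have dE (b : R) : is_derive b 1 E 0.
  have := dH b => dHb.
  by apply: is_derive_eq; rewrite /GRing.scale/=; field.
have : E a = E 0 by exact: is_derive_0_is_cst.
rewrite /E expr0n/= mul0r expR0 mulr1 /H.
under [in X in _ = X -> _]eq_Rintegral do rewrite mul0r add0r.
rewrite Rintegral_probability_cst => <-.
rewrite -mulrA -expRD.
have -> : a ^+ 2 * (s ^+ 2 / 2) + - ((a * s) ^+ 2 / 2) = 0 by field.
by rewrite expR0 mulr1.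
Qed.

End normal_charfun.

(** * Gaussian vectors *)

Section product_probability.
Context {d1 d2 : measure_display} {T1 : measurableType d1} {T2 : measurableType d2}.
Context {R : realType}.
Variables (P1 : probability T1 R) (P2 : probability T2 R).

Definition product_probability : set (T1 * T2) -> \bar R := (P1 \x P2)%E.

HB.instance Definition _ := Measure.on product_probability.

Let product_probability_setT : product_probability [set: T1 * T2] = 1%E.
Proof.
rewrite /product_probability -setXTT product_measure1E//.
by rewrite [X in (X * _)%E](probability_setT P1) [X in (_ * X)%E](probability_setT P2) mule1.
Qed.

HB.instance Definition _ :=
  @Measure_isProbability.Build _ _ R product_probability product_probability_setT.

Variables (M : R) (F : T1 * T2 -> R).
Hypothesis mF : measurable_fun setT F.
Hypothesis FM : forall z, `|F z| <= M.

Lemma Rintegral_product :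
  \int[product_probability]_z F z = \int[P1]_x \int[P2]_y F (x, y).
Proof.
have iF : (P1 \x P2)%E.-integrable setT (EFin \o F).
  exact: (bounded_integrable product_probability mF FM).
rewrite /Rintegral -(integral12_prod_meas1 iF) /fubini_F; congr fine.
apply: eq_integral => x _; rewrite fineK//; apply: integrable_fin_num => //.
apply: (@bounded_integrable _ _ _ P2 M (fun y => F (x, y))) => //.
exact: measurable_fun_pair2.
Qed.

Lemma measurable_Rintegral_section :
  measurable_fun setT (fun x => \int[P2]_y F (x, y)).
Proof.
have iF : (P1 \x P2)%E.-integrable setT (EFin \o F).
  exact: (bounded_integrable product_probability mF FM).
by apply: measurableT_comp => //; exact: (measurable_fubini_F iF).
Qed.

End product_probability.

Section gaussian_vector.
Context {R : realType}.

(** A centred Gaussian vector through its characteristic function; [v a] is the variance of the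
    combination with coefficients [a]. The phase [phi] lets real cosines do the work of complex
    exponentials, and degenerate covariances need no separate treatment. *)
Definition gaussian_vector {d : measure_display} {T : measurableType d}
    (P : probability T R) (J : finType) (X : J -> T -> R) (v : (J -> R) -> R) :=
  (forall j, measurable_fun setT (X j)) /\
  forall (a : J -> R) (phi : R),
    \int[P]_w cos (\sum_j a j * X j w + phi) = cos phi * expR (- (v a / 2)).

Context {d : measure_display} {T : measurableType d} {P : probability T R}.

Lemma measurable_lincomb (J : finType) (X : J -> T -> R) (a : J -> R) :
  (forall j, measurable_fun setT (X j)) ->
  measurable_fun setT (fun w => \sum_j a j * X j w).
Proof. by move=> mX; apply: measurable_sum => j; exact: measurable_funM. Qed.

Lemma measurable_cosD (f : T -> R) (c : R) : measurable_fun setT f ->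
  measurable_fun setT (fun w => cos (f w + c)).
Proof.
move=> mf; apply: measurableT_comp.
  exact: (continuous_measurable_fun (@continuous_cos R)).
exact: measurable_funD.
Qed.

Lemma eq_gaussian_vector (J : finType) (X Y : J -> T -> R) (v v' : (J -> R) -> R) :
  (forall j w, X j w = Y j w) -> v =1 v' ->
  gaussian_vector P X v -> gaussian_vector P Y v'.
Proof.
move=> XY vv'.
have -> : X = Y by apply/funext => j; apply/funext => w; exact: XY.
by move=> [mX hX]; split=> // a phi; rewrite hX vv'.
Qed.

Lemma gaussian_vector_linear (I J : finType) (X : J -> T -> R)
    (v : (J -> R) -> R) (A : I -> J -> R) : gaussian_vector P X v ->
  gaussian_vector P (fun i w => \sum_j A i j * X j w)
    (fun a => v (fun j => \sum_i a i * A i j)).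
Proof.
move=> [mX hX]; split=> [i|a phi]; first exact: measurable_lincomb.
rewrite -hX; apply: eq_Rintegral => w _; congr (cos (_ + _)).
under eq_bigr do rewrite mulr_sumr.
rewrite exchange_big/=; apply: eq_bigr => j _.
by rewrite mulr_suml; apply: eq_bigr => i _; rewrite mulrA.
Qed.

End gaussian_vector.

Section gaussian_vector_constructions.
Context {R : realType}.

Lemma gaussian_vectorD {d1 d2 : measure_display} {T1 : measurableType d1}
    {T2 : measurableType d2} (P1 : probability T1 R) (P2 : probability T2 R)
    (J : finType) (X : J -> T1 -> R) (Y : J -> T2 -> R) (v v' : (J -> R) -> R) :
  gaussian_vector P1 X v -> gaussian_vector P2 Y v' ->
  gaussian_vector (product_probability P1 P2)
    (fun j w => X j w.1 + Y j w.2) (fun a => v a + v' a).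
Proof.
move=> [mX hX] [mY hY].
have mXY j : measurable_fun setT (fun w : T1 * T2 => X j w.1 + Y j w.2).
  apply: measurable_funD.
    exact: (measurableT_comp (mX j) measurable_fst).
  exact: (measurableT_comp (mY j) measurable_snd).
split=> // a phi.
rewrite (@Rintegral_product _ _ _ _ _ P1 P2 1); last 2 first.
- by apply: measurable_cosD; exact: measurable_lincomb.
- by move=> z; exact: cos_max.
have inner x : \int[P2]_y cos (\sum_j a j * (X j (x, y).1 + Y j (x, y).2) + phi) =
    expR (- (v' a / 2)) * cos (\sum_j a j * X j x + phi).
  rewrite mulrC -hY; apply: eq_Rintegral => y _ /=; congr cos.
  rewrite addrA; congr (_ + _); rewrite addrC -big_split/=.
  by apply: eq_bigr => j _; rewrite mulrDr.
under eq_Rintegral do rewrite inner.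
rewrite RintegralZl//; last first.
  apply: (@bounded_integrable _ _ _ _ 1) => [|w]; last exact: cos_max.
  by apply: measurable_cosD; exact: measurable_lincomb.
by rewrite hX mulrCA -expRD; congr (_ * expR _); rewrite mulrDl opprD addrC.
Qed.

Lemma gaussian_vector_normal (J : finType) (c : J -> R) :
  gaussian_vector (normal_prob 0 1) (fun j (x : R) => c j * x)
    (fun a => (\sum_j a j * c j) ^+ 2).
Proof.
split=> [j|a phi]; first exact: measurable_funM.
have := Rintegral_normal_cos 0 (oner_neq0 R) (\sum_j a j * c j) phi.
rewrite mulr1 => <-; apply: eq_Rintegral => x _; congr (cos (_ + _)).
by rewrite subr0 mulr_suml; apply: eq_bigr => j _; rewrite mulrA.
Qed.

End gaussian_vector_constructions.

(** * Trigonometric approximation of half-line indicators *)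

Section trigonometric_polynomials.
Context {R : realType} {J : finType}.
Implicit Types (s : seq (R * (J -> R) * R)) (x a : J -> R) (i j : J).

(* The triple (c, a, phi) stands for the function c * cos (<a, x> + phi). *)
Definition trig_eval s x : R :=
  \sum_(e <- s) e.1.1 * cos (\sum_j e.1.2 j * x j + e.2).

(* Multiplying by [a i] and shifting the phase by pi / 2 is d/dx_i. *)
Definition trig_partial i s :=
  [seq (e.1.1 * e.1.2 i, e.1.2, e.2 + pi / 2) | e <- s].

(** The expectation of [trig_eval s] at a Gaussian vector with variance form [v], written without
    the vector so that it can be differentiated in [v]. *)
Definition trig_gauss (v : (J -> R) -> R) s : R :=
  \sum_(e <- s) e.1.1 * (cos e.2 * expR (- (v e.1.2 / 2))).

Definition is_trig (F : (J -> R) -> R) := exists s, trig_eval s =1 F.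

Definition coord_upd x i (t : R) : J -> R := fun j => if j == i then t else x j.

Lemma coord_upd_id x i : coord_upd x i (x i) = x.
Proof. by apply/funext => j; rewrite /coord_upd; case: eqP => // ->. Qed.

Lemma is_trig_cst c : is_trig (cst c).
Proof.
exists [:: (c, cst 0, 0)] => x; rewrite /trig_eval big_seq1/=.
by rewrite big1 ?addr0 ?cos0 ?mulr1// => j _; rewrite /cst mul0r.
Qed.

Lemma is_trigD F G : is_trig F -> is_trig G -> is_trig (fun x => F x + G x).
Proof.
move=> [s sF] [t tG]; exists (s ++ t) => x.
by rewrite /trig_eval big_cat/= -sF -tG.
Qed.

Lemma is_trigM F G : is_trig F -> is_trig G -> is_trig (fun x => F x * G x).
Proof.
move=> [s sF] [t tG].
pose p := fun (e f : R * (J -> R) * R) =>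
  [:: (e.1.1 * f.1.1 / 2, fun j => e.1.2 j + f.1.2 j, e.2 + f.2);
      (e.1.1 * f.1.1 / 2, fun j => e.1.2 j - f.1.2 j, e.2 - f.2)].
exists (flatten [seq p e f | e <- s, f <- t]) => x.
rewrite -sF -tG /trig_eval big_flatten/= big_allpairs_dep/= big_distrl/=.
apply: eq_bigr => e _; rewrite big_distrr/=; apply: eq_bigr => f _.
rewrite /p !big_cons big_nil addr0/=.
set A := \sum_j e.1.2 j * x j + e.2; set B := \sum_j f.1.2 j * x j + f.2.
have -> : \sum_j (e.1.2 j + f.1.2 j) * x j + (e.2 + f.2) = A + B.
  rewrite /A /B addrACA -big_split/=; congr (_ + _).
  by apply: eq_bigr => j _; rewrite mulrDl.
have -> : \sum_j (e.1.2 j - f.1.2 j) * x j + (e.2 - f.2) = A - B.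
  rewrite /A /B opprD addrACA -sumrB; congr (_ + _).
  by apply: eq_bigr => j _; rewrite mulrBl.
by rewrite cosD cosB; field.
Qed.

Lemma is_trigX F n : is_trig F -> is_trig (fun x => F x ^+ n).
Proof.
move=> tF; elim: n => [|n IH].
  by have [s sE] := is_trig_cst 1; exists s => x; rewrite sE expr0.
by have [s sE] := is_trigM tF IH; exists s => x; rewrite sE exprS.
Qed.

Lemma is_trig_prod (A : pred J) (F : J -> (J -> R) -> R) :
  (forall i, is_trig (F i)) -> is_trig (fun x => \prod_(i | A i) F i x).
Proof.
move=> tF; suff /(_ (index_enum J)) : forall r : seq J,
  is_trig (fun x => \prod_(i <- r | A i) F i x) by [].
elim => [|i r IH].
  by have [s sE] := is_trig_cst 1; exists s => x; rewrite sE big_nil.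
case Ai : (A i).
  by have [s sE] := is_trigM (tF i) IH; exists s => x; rewrite sE big_cons Ai.
by have [s sE] := IH; exists s => x; rewrite sE big_cons Ai.
Qed.

Lemma is_trig_sin_coord i (k u : R) : is_trig (fun x => sin (k * (x i - u))).
Proof.
exists [:: (1, fun j => if j == i then k else 0, - (k * u) - pi / 2)] => x.
rewrite /trig_eval big_seq1/= mul1r (bigD1 i)//= eqxx big1 ?addr0; last first.
  by move=> j /negbTE ->; rewrite mul0r.
rewrite addrA -mulrBr; set y := k * _.
by rewrite cosB cos_pihalf sin_pihalf mulr0 mulr1 add0r.
Qed.

Lemma integrable_trig_eval {d : measure_display} {T : measurableType d}
    (P : probability T R) (X : J -> T -> R) s :
  (forall j, measurable_fun setT (X j)) ->
  P.-integrable setT (EFin \o (fun w => trig_eval s (X ^~ w))).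
Proof.
move=> mX; apply: (@bounded_integrable _ _ _ _ (\sum_(e <- s) `|e.1.1|)).
  rewrite /trig_eval; apply: measurable_sum => e; apply: measurable_funM => //.
  by apply: measurable_cosD; exact: measurable_lincomb.
move=> w; apply: le_trans (ler_norm_sum _ _ _) _; apply: ler_sum => e _.
by rewrite normrM ler_piMr// cos_max.
Qed.

Lemma trig_gaussE {d : measure_display} {T : measurableType d}
    (P : probability T R) (X : J -> T -> R) (v : (J -> R) -> R) s :
  gaussian_vector P X v -> \int[P]_w trig_eval s (X ^~ w) = trig_gauss v s.
Proof.
move=> [mX hX]; rewrite /trig_gauss.
have ie (e : R * (J -> R) * R) : P.-integrable setT
    (EFin \o (fun w => cos (\sum_j e.1.2 j * X j w + e.2))).
  apply: (@bounded_integrable _ _ _ _ 1) => [|w]; last exact: cos_max.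
  by apply: measurable_cosD; exact: measurable_lincomb.
have iE t := integrable_trig_eval P t mX.
elim: s => [|e s IH].
  rewrite big_nil; under eq_Rintegral do rewrite /trig_eval big_nil.
  by rewrite Rintegral_probability_cst.
rewrite big_cons -IH -hX.
rewrite -RintegralZl// -RintegralD//.
  by apply: eq_Rintegral => w _; rewrite /trig_eval big_cons.
rewrite (_ : _ \o _ = (fun w => (e.1.1)%:E *
  (EFin \o (fun w => cos (\sum_j e.1.2 j * X j w + e.2))) w)%E)//.
exact: integrableZl.
Qed.

Lemma is_derive_trig_eval s x i (t : R) :
  is_derive t 1 (fun t => trig_eval s (coord_upd x i t))
    (trig_eval (trig_partial i s) (coord_upd x i t)).
Proof.
rewrite /trig_eval /trig_partial.
elim: s => [|e s IH].
  under eq_fun do rewrite big_nil.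
  by rewrite /= big_nil; exact: is_derive_cst.
under eq_fun do rewrite big_cons.
rewrite /= big_cons/=; apply: is_deriveD => //.
pose K := \sum_(j | j != i) e.1.2 j * x j.
have sumE (y : R) : \sum_j e.1.2 j * coord_upd x i y j = e.1.2 i * y + K.
  rewrite (bigD1 i)//= /coord_upd eqxx; congr (_ + _).
  by apply: eq_bigr => j /negbTE ->.
rewrite (_ : (fun y => _) = fun y => e.1.1 * cos (e.1.2 i * y + K + e.2)); last first.
  by apply/funext => y; rewrite sumE.
rewrite sumE addrA cosD cos_pihalf sin_pihalf mulr0 mulr1 sub0r.
by apply: is_derive_eq; rewrite /GRing.scale/=; ring.
Qed.

(** The formal derivative depends only on the function that [s] represents. It can thus be computed
    from the product of steps, whose trigonometric expansion is never made explicit. *)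
Lemma trig_partialE s (F : (J -> R) -> R) x i (l : R) : trig_eval s =1 F ->
  is_derive (x i : R) (1 : R) (fun t : R => F (coord_upd x i t)) l ->
  trig_eval (trig_partial i s) x = l.
Proof.
move=> sF [_ <-].
have <- : (fun t : R => trig_eval s (coord_upd x i t)) =
          (fun t : R => F (coord_upd x i t)) by apply/funext => t; exact: sF.
by have [_ ->] := is_derive_trig_eval s x i (x i); rewrite coord_upd_id.
Qed.

End trigonometric_polynomials.

Lemma is_derive_exprn {R : realType} (f : R -> R) (df x : R) n :
  is_derive x 1 f df ->
  is_derive x 1 (fun y => f y ^+ n.+1) (n.+1%:R * f x ^+ n * df).
Proof.
move=> df1; have -> : (fun y => f y ^+ n.+1) = f ^+ n.+1.
  by apply/funext => y; rewrite exprfctE.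
exact: is_deriveX.
Qed.

(** * Trigonometric steps and their limit *)

Section step_functions.
Context {R : realType}.
Variable l : nat.
Local Notation M := ((4 ^ l)%:R : R).
Local Notation a := (8 ^ l)%N.
Local Notation b := (2 ^ (8 ^ l - l))%N.

(* As [b / 2 ^ a = 2 ^ - l], [bump] jumps from 0 to 1 just above [z = 1 / 2], so
   the trigonometric polynomial [step] jumps just above [x = 0]. *)
Definition bump (z : R) := 1 - (1 - z ^+ a) ^+ b.
Definition dbump (z : R) := b%:R * (1 - z ^+ a) ^+ b.-1 * (a%:R * z ^+ a.-1).
Definition step (x : R) := bump ((1 + sin (M^-1 * x)) / 2).
Definition dstep (x : R) := dbump ((1 + sin (M^-1 * x)) / 2) * (cos (M^-1 * x) / (2 * M)).

Lemma unit_sin (y : R) : 0 <= (1 + sin y) / 2 <= 1.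
Proof.
have := sin_max y; rewrite ler_norml => /andP[h1 h2].
by apply/andP; split; lra.
Qed.

Lemma bump_itv (z : R) : 0 <= z <= 1 -> 0 <= bump z <= 1.
Proof.
move=> /andP[z0 z1]; rewrite /bump subr_ge0 gerBl.
have w0 : 0 <= 1 - z ^+ a by rewrite subr_ge0 exprn_ile1.
by rewrite exprn_ile1 ?exprn_ge0//= lerBlDr lerDl exprn_ge0.
Qed.

Lemma step_itv (x : R) : 0 <= step x <= 1.
Proof. exact: bump_itv (unit_sin _). Qed.

Let M0 : M != 0. Proof. by rewrite pnatr_eq0 expn_eq0. Qed.
Let a0 : (0 < a)%N. Proof. by rewrite expn_gt0. Qed.
Let b0 : (0 < b)%N. Proof. by rewrite expn_gt0. Qed.

Lemma is_derive_step (x : R) : is_derive x 1 step (dstep x).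
Proof.
have H p q : is_derive x 1
    (fun x : R => 1 - (1 - ((1 + sin (M^-1 * x)) / 2) ^+ p.+1) ^+ q.+1)
    (q.+1%:R * (1 - ((1 + sin (M^-1 * x)) / 2) ^+ p.+1) ^+ q *
     (p.+1%:R * ((1 + sin (M^-1 * x)) / 2) ^+ p) * (cos (M^-1 * x) / (2 * M))).
  have dz : is_derive x 1 (fun x : R => (1 + sin (M^-1 * x)) / 2)
     (cos (M^-1 * x) / (2 * M)).
    by apply: is_derive_eq; rewrite /GRing.scale/=; field.
  have dzp := is_derive_exprn p dz.
  have dw : is_derive x 1 (fun x : R => 1 - ((1 + sin (M^-1 * x)) / 2) ^+ p.+1)
     (- (p.+1%:R * ((1 + sin (M^-1 * x)) / 2) ^+ p * (cos (M^-1 * x) / (2 * M)))).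
    by apply: is_derive_eq; rewrite add0r mul1r.
  have dwq := is_derive_exprn q dw.
  by apply: is_derive_eq; rewrite add0r; ring.
by have := H a.-1 b.-1; rewrite !prednK.
Qed.

Lemma dbump_ge0 (z : R) : 0 <= z <= 1 -> 0 <= dbump z.
Proof.
move=> /andP[z0 z1]; rewrite /dbump !mulr_ge0 ?exprn_ge0//.
by rewrite subr_ge0 exprn_ile1.
Qed.

(* [(1 - w)^n * (1 + n w) <= 1] on [0, 1], as [(1 - w) (1 + w) <= 1]. *)
Lemma exp_onem_ub (w : R) n : 0 <= w <= 1 -> (1 - w) ^+ n * (1 + n%:R * w) <= 1.
Proof.
move=> /andP[w0 w1]; have v0 : 0 <= 1 - w by rewrite subr_ge0.
elim: n => [|n IH]; first by rewrite expr0 mul0r addr0 mulr1.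
apply: le_trans IH; rewrite exprSr -mulrA; apply: ler_wpM2l.
  by rewrite exprn_ge0.
have : 0 <= n%:R :> R by rewrite ler0n.
by rewrite -natr1; set k := n%:R => k0; nra.
Qed.

(** For [z >= 1/4], [exp_onem_ub] gives [b (1 - w)^(b - 1) w <= 1] with [w = z^a], and the missing
    factor [z^-1] is at most 4. For [z < 1/4] the crude bound [2^a * 4^-(a - 1) <= 2] is enough. *)
Lemma dbump_ub (z : R) : 0 <= z <= 1 -> dbump z <= 4 * a%:R.
Proof.
move=> z01; have /andP[z0 z1] := z01.
have za0 : 0 <= z ^+ a by rewrite exprn_ge0.
have za1 : z ^+ a <= 1 by rewrite exprn_ile1.
have w0 : 0 <= 1 - z ^+ a by rewrite subr_ge0.
have [z4|z4] := leP (4^-1) z.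
  have bw : b%:R * (1 - z ^+ a) ^+ b.-1 * z ^+ a <= 1.
    have := @exp_onem_ub (z ^+ a) b.-1; rewrite za0 za1 => /(_ isT); apply: le_trans.
    rewrite mulrAC [leLHS]mulrC; apply: ler_wpM2l; first by rewrite exprn_ge0.
    have -> : b%:R = b.-1%:R + 1 :> R by rewrite natr1 prednK.
    by rewrite mulrDl mul1r addrC lerD2r.
  have zz : z ^+ a.-1 <= 4 * z ^+ a.
    rewrite -{2}(prednK a0) exprS mulrA ler_peMl ?exprn_ge0//; lra.
  apply: le_trans (_ : b%:R * (1 - z ^+ a) ^+ b.-1 * (a%:R * (4 * z ^+ a)) <= _).
    apply: ler_wpM2l; first by rewrite mulr_ge0 ?exprn_ge0.
    by apply: ler_wpM2l.
  have -> : b%:R * (1 - z ^+ a) ^+ b.-1 * (a%:R * (4 * z ^+ a)) =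
    (4 * a%:R) * (b%:R * (1 - z ^+ a) ^+ b.-1 * z ^+ a) by ring.
  by rewrite ler_piMr// mulr_ge0.
have -> : 4 * a%:R = a%:R * 4 :> R by rewrite mulrC.
rewrite /dbump mulrCA; apply: ler_wpM2l => //.
rewrite -mulrA mulrCA; apply: le_trans (ler_piMl _ _) _.
- by rewrite mulr_ge0 ?exprn_ge0.
- by rewrite exprn_ile1// gerBl.
apply: le_trans (_ : (2 ^+ a : R) * (4^-1) ^+ a.-1 <= _).
  apply: ler_pM => //; first by rewrite exprn_ge0.
    by rewrite -natrX ler_nat leq_pexp2l// leq_subr.
  by apply: lerXn2r; [exact: z0|rewrite nnegrE invr_ge0|exact: ltW].
rewrite -{1}(prednK a0) exprS -mulrA -exprMn.
have -> : 2 * 4^-1 = 2^-1 :> R by field.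
apply: le_trans (_ : 2 * 1 <= _); last by lra.
by apply: ler_wpM2l => //; apply: exprn_ile1; lra.
Qed.

(** It grows only like [2^l], against the scale [4^l] of the sine: [dstep_bound^2 / (4^l)^2] tends
    to 0, which removes the error of [dstep2_lb] in the limit. *)
Definition dstep_bound : R := 2 * (2 ^ l)%:R.

Lemma dstep_boundE : 4 * a%:R / (2 * M) = dstep_bound.
Proof.
have -> : a = ((2 ^ l) * (4 ^ l))%N by rewrite -expnMn.
by rewrite natrM /dstep_bound; field.
Qed.

Lemma dstep_ub (x : R) : `|dstep x| <= dstep_bound.
Proof.
rewrite -dstep_boundE /dstep normrM ger0_norm ?dbump_ge0 ?unit_sin//.
apply: ler_pM => //.
- exact: dbump_ge0 (unit_sin _).
- exact: dbump_ub (unit_sin _).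
by rewrite normrM normfV normrM !normr_nat ler_piMl ?cos_max.
Qed.

(* [step] can only decrease where [cos (x / M) < 0], where [1 - cos (x / M)] is
   at least 1. *)
Lemma dstep2_lb (x y : R) :
  - (dstep_bound ^+ 2 * ((1 - cos (M^-1 * x)) + (1 - cos (M^-1 * y)))) <=
  dstep x * dstep y.
Proof.
have Mp : 0 < 2 * M by rewrite mulr_gt0// ltr0n expn_gt0.
have cle (z : R) : 0 <= 1 - cos z.
  by rewrite subr_ge0; have := cos_max z; rewrite ler_norml => /andP[].
have D0 : 0 <= dstep_bound ^+ 2 by exact: sqr_ge0.
have neg (z w : R) : cos (M^-1 * z) < 0 ->
    - (dstep_bound ^+ 2 * ((1 - cos (M^-1 * z)) + (1 - cos (M^-1 * w)))) <=
    dstep z * dstep w.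
  move=> cz; apply: le_trans (_ : - (dstep_bound ^+ 2 * 1) <= _).
    rewrite lerN2 ler_wpM2l// -[leLHS]addr0 lerD// lerBrDl.
    by rewrite gerDr ltW.
  rewrite mulr1 lerNl -mulNr; apply: le_trans (ler_norm _) _.
  by rewrite normrM normrN expr2 ler_pM// dstep_ub.
have [cx|cx] := ltP (cos (M^-1 * x)) 0; first exact: neg.
have [cy|cy] := ltP (cos (M^-1 * y)) 0.
  by rewrite [dstep x * _]mulrC [_ - _ + (_ - _)]addrC; exact: neg.
apply: le_trans (_ : 0 <= _).
  by rewrite oppr_le0 mulr_ge0// addr_ge0.
rewrite /dstep; apply: mulr_ge0; apply: mulr_ge0.
- exact: dbump_ge0 (unit_sin _).
- by rewrite divr_ge0// ltW.
- exact: dbump_ge0 (unit_sin _).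
- by rewrite divr_ge0// ltW.
Qed.

End step_functions.

Lemma is_trig_step {R : realType} (J : finType) (l : nat) (i : J) (u : R) :
  is_trig (fun x : J -> R => step l (x i - u)).
Proof.
have tz : is_trig (fun x : J -> R => 2^-1 * (1 + sin ((4 ^ l)%:R^-1 * (x i - u)))).
  apply: is_trigM; first exact: is_trig_cst.
  by apply: is_trigD; [exact: is_trig_cst|exact: is_trig_sin_coord].
have tw : is_trig (fun x : J -> R => 1 + (-1) *
    (2^-1 * (1 + sin ((4 ^ l)%:R^-1 * (x i - u)))) ^+ (8 ^ l)).
  apply: is_trigD; first exact: is_trig_cst.
  by apply: is_trigM; [exact: is_trig_cst|exact: is_trigX].
have := is_trigD (is_trig_cst 1) (is_trigM (is_trig_cst (-1))
  (is_trigX (2 ^ (8 ^ l - l)) tw)).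
by case=> s sE; exists s => x; rewrite sE /step /bump/= !mulN1r [_ / 2]mulrC.
Qed.

Section step_limit.
Context {R : realType}.

Lemma sin_cos1_lb (y : R) : 0 <= y <= 1 -> cos 1 * y <= sin y.
Proof.
move=> /andP[y0 y1].
have [c cy] := @MVT_segment R sin cos 0 y y0 (fun x _ => is_derive_sin x)
  (continuous_subspaceT (@continuous_sin R)).
rewrite sin0 !subr0 => ->; apply: ler_wpM2r => //.
move: cy; rewrite in_itv/= => /andP[c0 cy].
have pi2 : (1 : R) <= pi by apply: le_trans (pi_ge2 R); rewrite ler1n.
have [->//|c1] := eqVneq c 1.
apply/ltW; rewrite ltr_cos ?in_itv/= ?c0 ?ler01 ?pi2//.
- by rewrite lt_neqAle c1 (le_trans cy).
- by rewrite (le_trans cy)// (le_trans y1).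
Qed.

Lemma sin_abs_ub (y : R) : `|sin y| <= `|y|.
Proof.
wlog y0 : y / 0 <= y => [H|].
  have [y0|y0] := leP 0 y; first exact: H.
  by have := H (- y); rewrite sinN !normrN; apply; rewrite oppr_ge0 ltW.
have [c cy] := @MVT_segment R sin cos 0 y y0 (fun x _ => is_derive_sin x)
  (continuous_subspaceT (@continuous_sin R)).
by rewrite sin0 !subr0 => ->; rewrite normrM ler_piMl// cos_max.
Qed.

Lemma cos_quadratic_lb (y : R) : 1 - cos y <= y ^+ 2.
Proof.
have -> : y = y / 2 + y / 2 by field.
rewrite cosD -!expr2 cos2sin2.
have := sin_abs_ub (y / 2); rewrite -(ler_pXn2r (n := 2)) ?nnegrE//.
rewrite !real_normK ?num_real// => h.
have -> : y / 2 + y / 2 = 2 * (y / 2) by field.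
by rewrite exprMn; have := sqr_ge0 (y / 2); set t := (y / 2) ^+ 2 in h *; nra.
Qed.

Lemma bernoulli_onem (w : R) n : 0 <= w <= 1 -> 1 - n%:R * w <= (1 - w) ^+ n.
Proof.
move=> /andP[w0 w1]; elim: n => [|n IH]; first by rewrite mul0r subr0 expr0.
have v0 : 0 <= 1 - w by rewrite subr_ge0.
rewrite exprS; apply: le_trans (ler_wpM2l v0 IH).
have : 0 <= n%:R :> R by rewrite ler0n.
by rewrite -natr1; set k := n%:R => k0; nra.
Qed.

Lemma bernoulli_add (t : R) n : 0 <= t -> 1 + n%:R * t <= (1 + t) ^+ n.
Proof.
move=> t0; elim: n => [|n IH]; first by rewrite mul0r addr0 expr0.
have v0 : 0 <= 1 + t by rewrite addr_ge0.
rewrite exprS; apply: le_trans (ler_wpM2l v0 IH).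
have : 0 <= n%:R :> R by rewrite ler0n.
by rewrite -natr1; set k := n%:R => k0; nra.
Qed.

Lemma cvg_inv_exp2 : ((2 ^ k)%:R : R)^-1 @[k --> \oo] --> 0.
Proof.
apply: (@squeeze_cvgr _ _ _ _ (cst 0) harmonic); last 2 first.
- exact: cvg_cst.
- exact: cvg_harmonic.
apply: nearW => k; rewrite invr_ge0 ler0n/= lef_pV2 ?posrE ?ltr0n ?expn_gt0//.
by rewrite ler_nat ltn_expl.
Qed.

Lemma exp_leB2 (l : nat) : (2 ^ (8 ^ l - l))%:R * (2 ^ l)%:R = 2 ^+ (8 ^ l) :> R.
Proof. by rewrite -natrM -expnD subnK ?natrX// ltnW// ltn_expl. Qed.

(** By [exp_onem_ub], [step >= 1 - 1 / (1 + b w)], so [b w] has to be large. It equals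
    [(1 + sin y)^(8^l) / 2^l]; writing [8^l = 4^l * 2^k * 2], Bernoulli turns the power [4^l] into
    [1 + q], the power [2^k] into [2^k q], and the last square beats [2^l]. *)
Lemma step_lb (k : nat) (x : R) : 0 < x <= (4 ^ k.+1)%:R ->
  1 - 2 / (cos 1 * x) ^+ 2 * ((2 ^ k)%:R)^-1 <= step k.+1 x.
Proof.
move=> /andP[x0 xM]; set l := k.+1; set q := cos 1 * x.
have q0 : 0 < q by rewrite mulr_gt0 ?cos1_gt0.
have M0 : 0 < (4 ^ l)%:R :> R by rewrite ltr0n expn_gt0.
rewrite /step /bump; set y := _^-1 * x.
have y01 : 0 <= y <= 1.
  apply/andP; split; first by rewrite mulr_ge0// ?invr_ge0 ltW.
  by rewrite /y ler_pdivrMl// mulr1.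
set z := (1 + sin y) / 2; set w := z ^+ _; set b := (2 ^ (8 ^ l - l))%N.
have z01 := unit_sin y; rewrite -/z in z01; have /andP[z0 z1] := z01.
have w01 : 0 <= w <= 1 by rewrite /w exprn_ge0// exprn_ile1.
have p0 : 0 < (2 ^ k)%:R :> R by rewrite ltr0n expn_gt0.
have s0 : 0 <= 1 + sin y.
  by have := sin_max y; rewrite ler_norml => /andP[h _]; rewrite -lerBlDl sub0r.
have bw : (2 ^ k)%:R * q ^+ 2 / 2 <= b%:R * w.
  have -> : b%:R * w = (1 + sin y) ^+ (8 ^ l) / (2 ^ l)%:R.
    rewrite /w /z expr_div_n -exp_leB2 -/b.
    by field; rewrite !pnatr_eq0 -!lt0n !expn_gt0.
  have -> : (8 ^ l = 4 ^ l * (2 ^ k * 2))%N by rewrite -expnSr -expnMn.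
  rewrite !exprM ler_pdivlMr ?ltr0n ?expn_gt0//.
  have -> : (2 ^ k)%:R * q ^+ 2 / 2 * (2 ^ l)%:R = ((2 ^ k)%:R * q) ^+ 2.
    by rewrite /l expnS natrM; field.
  apply: lerXn2r.
  - by rewrite nnegrE; apply: mulr_ge0 => //; exact: ltW.
  - by rewrite nnegrE !exprn_ge0.
  apply: le_trans (_ : (1 + q) ^+ (2 ^ k) <= _).
    apply: le_trans (bernoulli_add _ (ltW q0)).
    by rewrite lerDr.
  apply: lerXn2r; rewrite ?nnegrE ?exprn_ge0 ?(addr_ge0 ler01 (ltW q0))//.
  have qy : q / (4 ^ l)%:R = cos 1 * y by rewrite /q /y; ring.
  have qM0 : 0 <= q / (4 ^ l)%:R by rewrite divr_ge0 ?ltW.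
  apply: le_trans (_ : (1 + q / (4 ^ l)%:R) ^+ (4 ^ l) <= _).
    apply: le_trans (bernoulli_add _ qM0).
    by rewrite mulrCA divff ?mulr1// gt_eqF.
  apply: lerXn2r; rewrite ?nnegrE ?(addr_ge0 ler01 qM0)//.
  by rewrite lerD2l qy; exact: sin_cos1_lb.
have v0 : 0 < (2 ^ k)%:R * q ^+ 2 / 2.
  by rewrite divr_gt0// mulr_gt0// exprn_gt0.
rewrite lerD2l lerN2.
have := exp_onem_ub b w01.
rewrite -ler_pdivlMr; last by rewrite ltr_pwDl// (le_trans (ltW v0)).
move=> h; apply: le_trans h _.
apply: le_trans (_ : ((2 ^ k)%:R * q ^+ 2 / 2)^-1 <= _).
  rewrite div1r lef_pV2 ?posrE//; last by rewrite ltr_pwDl// (le_trans (ltW v0)).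
  by rewrite (le_trans bw)// lerDr.
by rewrite le_eqVlt; apply/orP; left; apply/eqP; field; rewrite !gt_eqF.
Qed.

(** On this range the sine is not positive, so the argument of [bump] is at most [1/2], and
    Bernoulli bounds [bump] by [b / 2^a]. *)
Lemma step_ub (l : nat) (x : R) : - (4 ^ l)%:R <= x <= 0 -> step l x <= ((2 ^ l)%:R)^-1.
Proof.
move=> /andP[xM x0].
have M0 : 0 < (4 ^ l)%:R :> R by rewrite ltr0n expn_gt0.
rewrite /step /bump; set y := _^-1 * x.
have siny : sin y <= 0.
  rewrite -oppr_ge0 -sinN; apply: sin_ge0_pi.
  have -> : - y = - x / (4 ^ l)%:R by rewrite /y; ring.
  apply/andP; split; first by rewrite divr_ge0 ?oppr_ge0// ltW.
  apply: le_trans (_ : 1 <= _); first by rewrite ler_pdivrMr// mul1r lerNl.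
  by apply: le_trans (pi_ge2 R); rewrite ler1n.
have /andP[z0 z1] := unit_sin y; set z := (1 + sin y) / 2 in z0 z1 *.
rewrite lerBlDr -lerBlDl.
apply: le_trans (bernoulli_onem _ _); last by rewrite exprn_ge0// exprn_ile1.
rewrite lerD2l lerN2.
apply: le_trans (_ : (2 ^ (8 ^ l - l))%:R * 2^-1 ^+ (8 ^ l) <= _).
  apply: ler_wpM2l => //; apply: lerXn2r; rewrite ?nnegrE//.
  by rewrite /z; lra.
rewrite exprVn -exp_leB2 le_eqVlt; apply/orP; left; apply/eqP; field.
by rewrite !pnatr_eq0 -!lt0n !expn_gt0.
Qed.

(** Convergence holds at every point, 0 included, so atoms of degenerate laws at a threshold cause
    no exception. *)
Lemma cvg_step (x : R) : step l x @[l --> \oo] --> ((0 < x)%R%:R : R).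
Proof.
have lpow (k : nat) : k%:R <= (4 ^ k)%:R :> R.
  by rewrite ler_nat ltnW// ltn_expl.
have [x0|x0] := ltP 0 x.
- rewrite -(cvg_shiftS (fun l => step l x)).
  apply: (@squeeze_cvgr _ _ _ _ (fun k => 1 - (2 / (cos 1 * x) ^+ 2) * ((2 ^ k)%:R)^-1)
    (cst 1)); last 2 first.
  + rewrite -[X in _ --> X]subr0; apply: cvgB; first exact: cvg_cst.
    by rewrite -(mulr0 (2 / (cos 1 * x) ^+ 2)); apply: cvgMr; exact: cvg_inv_exp2.
  + exact: cvg_cst.
  near=> k; have /andP[_ ->] := step_itv k.+1 x; rewrite andbT.
  apply: step_lb; rewrite x0/=; apply: le_trans (lpow _).
  apply: (@le_trans _ _ k%:R); last by rewrite ler_nat.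
  by near: k; exact: nbhs_infty_ger.
- apply: (@squeeze_cvgr _ _ _ _ (cst 0) (fun l => ((2 ^ l)%:R)^-1)); last 2 first.
  + exact: cvg_cst.
  + exact: cvg_inv_exp2.
  near=> l; have /andP[-> _] := step_itv l x => /=.
  apply: step_ub; rewrite x0 andbT lerNl; apply: le_trans (lpow _).
  by near: l; exact: nbhs_infty_ger.
Unshelve. all: end_near. Qed.

End step_limit.

(** * Slepian's inequality *)

Section quadratic_form.
Context {R : realType} {J : finType}.

Definition quad (C : J -> J -> R) (a : J -> R) : R :=
  \sum_i \sum_j C i j * (a i * a j).

Lemma quadZ C (c : R) a : quad C (fun j => c * a j) = c ^+ 2 * quad C a.
Proof.
rewrite /quad mulr_sumr; apply: eq_bigr => i _; rewrite mulr_sumr.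
by apply: eq_bigr => j _; ring.
Qed.

Lemma quadB C D a : quad C a - quad D a = quad (fun i j => C i j - D i j) a.
Proof.
rewrite /quad -sumrB; apply: eq_bigr => i _; rewrite -sumrB.
by apply: eq_bigr => j _; ring.
Qed.

Lemma quad_delta C i (c : R) : quad C (fun j => if j == i then c else 0) = C i i * c ^+ 2.
Proof.
rewrite /quad (bigD1 i)//= (bigD1 i)//= eqxx !big1 ?addr0 ?expr2//.
  by move=> k /negbTE ->; rewrite big1// => j _; rewrite mul0r mulr0.
by move=> k /negbTE ->; rewrite !mulr0.
Qed.

End quadratic_form.

Section orthant.
Context {R : realType} {d : measure_display} {T : measurableType d} {J : finType}.

Definition orthant (A : pred J) (u : J -> R) (X : J -> T -> R) : set T :=
  [set w | forall k, A k -> u k < X k w].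

Lemma measurable_orthant A u X : (forall k, measurable_fun setT (X k)) ->
  measurable (orthant A u X).
Proof.
move=> mX; have -> : orthant A u X =
    \bigcap_(k in [set k | A k]) [set w | u k < X k w] by [].
apply: fin_bigcap_measurable; first exact: finite_finset.
move=> k _; rewrite -[X in measurable X]setTI.
have -> : [set w | u k < X k w] = X k @^-1` `]u k, +oo[%classic.
  by apply/seteqP; split=> w /=; rewrite in_itv/= andbT.
exact: mX.
Qed.

Lemma indic_orthantE A u X w : \1_(orthant A u X) w =
  \prod_(k | A k) (0 < X k w - u k)%R%:R :> R.
Proof.
rewrite indicE; have [/set_mem h|] := boolP (w \in orthant A u X).
  by rewrite big1// => k Ak; rewrite subr_gt0 h.
rewrite notin_setE => /existsNP[k /not_implyP[Ak /negP h]].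
by rewrite (bigD1 k)//= subr_gt0 (negbTE h) mul0r.
Qed.

End orthant.

Section slepian.
Context {R : realType} {J : finType}.

(** The characteristic function is at most 1. *)
Lemma gaussian_vector_ge0 {d : measure_display} {T : measurableType d}
    (P : probability T R) (X : J -> T -> R) v a : gaussian_vector P X v -> 0 <= v a.
Proof.
move=> [mX hX].
have icos : P.-integrable setT (EFin \o (fun w => cos (\sum_j a j * X j w + 0))).
  apply: (@bounded_integrable _ _ _ _ 1) => [|w]; last exact: cos_max.
  by apply: measurable_cosD; exact: measurable_lincomb.
have i1 : P.-integrable setT (EFin \o (fun=> 1)).
  by apply: (@bounded_integrable _ _ _ _ 1) => // w; rewrite normr1.
have : \int[P]_w cos (\sum_j a j * X j w + 0) <= \int[P]_w 1.
  apply: (le_Rintegral measurableT icos i1) => w _.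
  exact: le_trans (ler_norm _) (cos_max _).
rewrite Rintegral_probability_cst.
rewrite hX cos0 mul1r -[X in _ <= X -> _]expR0 ler_expR oppr_le0.
by rewrite pmulr_lge0// invr_gt0.
Qed.

Definition interpol (v0 v1 : (J -> R) -> R) (t : R) a := v0 a + t * (v1 a - v0 a).

(** The heat equation for Gaussian expectations: moving the covariance in the direction [D] acts as
    half the second-order operator with coefficients [D]. On a single cosine both sides are
    explicit. *)
Lemma is_derive_trig_gauss (v0 v1 : (J -> R) -> R) (D : J -> J -> R) s (t : R) :
  (forall a, v1 a - v0 a = quad D a) ->
  is_derive t 1 (fun t => trig_gauss (interpol v0 v1 t) s)
    (2^-1 * \sum_i \sum_j D i j *
       trig_gauss (interpol v0 v1 t) (trig_partial j (trig_partial i s))).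
Proof.
move=> vD; elim: s => [|e s IH].
  under eq_fun do rewrite /trig_gauss big_nil.
  rewrite [X in is_derive _ _ _ X](_ : _ = 0); first exact: is_derive_cst.
  rewrite big1 ?mulr0// => i _; rewrite big1// => j _.
  by rewrite /trig_gauss big_nil mulr0.
under eq_fun do rewrite /trig_gauss big_cons.
pose E t := expR (- (interpol v0 v1 t e.1.2 / 2)).
have dE : is_derive t 1 E (- (quad D e.1.2 / 2) * E t).
  rewrite /E /interpol; apply: is_derive_eq; rewrite /GRing.scale/= -vD.
  by field.
have -> : 2^-1 * (\sum_i \sum_j D i j * trig_gauss (interpol v0 v1 t)
     (trig_partial j (trig_partial i (e :: s)))) =
   - (e.1.1 * (cos e.2 * (quad D e.1.2 / 2 * E t))) +
   2^-1 * (\sum_i \sum_j D i j * trig_gauss (interpol v0 v1 t)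
     (trig_partial j (trig_partial i s))).
  transitivity (2^-1 * (\sum_i \sum_j (- (e.1.1 * (cos e.2 * E t)) *
      (D i j * (e.1.2 i * e.1.2 j)) + D i j * trig_gauss (interpol v0 v1 t)
     (trig_partial j (trig_partial i s))))).
    congr (_ * _); apply: eq_bigr => i _; apply: eq_bigr => j _.
    rewrite /trig_gauss /= big_cons/= !cosDpihalf sinDpihalf -/(E t).
    by ring.
  under eq_bigr do rewrite big_split/= -mulr_sumr.
  by rewrite big_split/= -mulr_sumr -/(quad D e.1.2) /E; field.
apply: is_deriveD => //.
by apply: is_derive_eq; rewrite /GRing.scale/=; ring.
Qed.

Variables (A : pred J) (u : J -> R) (l : nat).

Definition step_prod (x : J -> R) := \prod_(k | A k) step l (x k - u k).

Lemma step_prod_itv x : 0 <= step_prod x <= 1.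
Proof.
apply/andP; split.
  by apply: prodr_ge0 => k _; have /andP[] := step_itv l (x k - u k).
rewrite -[leRHS](@big1_eq _ _ (@GRing.mul R) J (index_enum J) A).
by apply: ler_prod => k _; exact: step_itv.
Qed.

Lemma is_trig_step_prod : is_trig step_prod.
Proof. by apply: is_trig_prod => i; exact: is_trig_step. Qed.

Lemma is_derive_step_shift (c b x : R) :
  is_derive x 1 (fun t : R => step l (t - b) * c) (dstep l (x - b) * c).
Proof.
have ds := is_derive_step l (x - b).
have dx : is_derive x 1 (fun t : R => t - b) 1.
  by apply: is_derive_eq; rewrite subr0.
have dc : is_derive x 1 (fun t : R => step l (t - b)) (dstep l (x - b)).
  by have := @is_derive1_comp R (step l) (fun t => t - b) x _ _ ds dx; rewrite mulr1.
by apply: is_derive_eq; rewrite /GRing.scale/=; ring.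
Qed.

Variable s : seq (R * (J -> R) * R).
Hypothesis sE : trig_eval s =1 step_prod.

Lemma trig_partial_step i x : A i -> trig_eval (trig_partial i s) x =
  dstep l (x i - u i) * \prod_(k | A k && (k != i)) step l (x k - u k).
Proof.
move=> Ai; apply: (trig_partialE sE).
rewrite (_ : (fun t => _) = fun t : R => step l (t - u i) *
    \prod_(k | A k && (k != i)) step l (x k - u k)); last first.
  apply/funext => t; rewrite /step_prod (bigD1 i)//= /coord_upd eqxx; congr (_ * _).
  by apply: eq_bigr => k /andP[_ /negbTE ->].
exact: is_derive_step_shift.
Qed.

Lemma trig_partial_step0 i x : ~~ A i -> trig_eval (trig_partial i s) x = 0.
Proof.
move=> Ai; apply: (trig_partialE sE).
rewrite (_ : (fun t => _) = cst (step_prod x)); first exact: is_derive_cst.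
apply/funext => t; apply: eq_bigr => k Ak; rewrite /coord_upd.
by case: eqP Ak Ai => // -> ->.
Qed.

Lemma trig_partial2_step i j x : A i -> A j -> j != i ->
  trig_eval (trig_partial j (trig_partial i s)) x =
  dstep l (x j - u j) * (dstep l (x i - u i) *
    \prod_(k | A k && (k != i) && (k != j)) step l (x k - u k)).
Proof.
move=> Ai Aj ji; apply: (trig_partialE (fun x => trig_partial_step x Ai)).
rewrite (_ : (fun t => _) = fun t : R => step l (t - u j) * (dstep l (x i - u i) *
    \prod_(k | A k && (k != i) && (k != j)) step l (x k - u k))); last first.
  apply/funext => t; rewrite (bigD1 j)/= ?Aj// /coord_upd eqxx.
  rewrite eq_sym (negbTE ji) mulrCA; congr (_ * (_ * _)).
  by apply: eq_bigr => k /andP[_ /negbTE ->].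
exact: is_derive_step_shift.
Qed.

Lemma trig_partial2_step0 i j x : ~~ (A i && A j) ->
  trig_eval (trig_partial j (trig_partial i s)) x = 0.
Proof.
have [Ai|Ai _] := boolP (A i); last first.
  apply: (trig_partialE (fun x => trig_partial_step0 x Ai)).
  exact: is_derive_cst.
move=> /= Aj; apply: (trig_partialE (fun x => trig_partial_step x Ai)).
have ji : i != j by apply: contra Aj => /eqP <-.
rewrite (_ : (fun t => _) = cst (dstep l (x i - u i) *
    \prod_(k | A k && (k != i)) step l (x k - u k))); first exact: is_derive_cst.
apply/funext => t; rewrite /coord_upd (negbTE ji); congr (_ * _).
apply: eq_bigr => k /andP[Ak _].
by case: eqP Ak Aj => // -> ->.
Qed.

End slepian.

Section slepian_inequality.
Context {R : realType} {J : finType}.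

Lemma gaussian_vector_scale {d : measure_display} {T : measurableType d}
    (P : probability T R) (X : J -> T -> R) C (c : R) :
  gaussian_vector P X (quad C) ->
  gaussian_vector P (fun j w => c * X j w) (fun a => c ^+ 2 * quad C a).
Proof.
move=> [mX hX]; split=> [j|a phi]; first exact: measurable_funM.
rewrite -quadZ -hX; apply: eq_Rintegral => w _; congr (cos (_ + _)).
by apply: eq_bigr => j _; ring.
Qed.

(** A second-moment bound read off the characteristic function: the integral is
    [1 - cos (k b) * expR (- c k^2 / 2)], and [1 - x y <= (1 - x) + (1 - y)] when both factors are
    at most 1. *)
Lemma Rintegral_onem_cos {d : measure_display} {T : measurableType d}
    (P : probability T R) (X : J -> T -> R) v i (k b c : R) :
  gaussian_vector P X v -> v (fun j => if j == i then k else 0) = c * k ^+ 2 ->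
  \int[P]_w (1 - cos (k * (X i w - b))) <= k ^+ 2 * (b ^+ 2 + c).
Proof.
move=> gX vk; have [mX hX] := gX.
have c0 : 0 <= c * k ^+ 2 by rewrite -vk; exact: gaussian_vector_ge0 gX.
have E w : cos (k * (X i w - b)) =
    cos (\sum_j (if j == i then k else 0) * X j w + - (k * b)).
  rewrite (bigD1 i)//= eqxx big1 ?addr0 ?mulrBr//.
  by move=> j /negbTE ->; rewrite mul0r.
have icos : P.-integrable setT (EFin \o (fun w => cos (k * (X i w - b)))).
  apply: (@bounded_integrable _ _ _ _ 1) => [|w]; last exact: cos_max.
  rewrite (_ : (fun w => _) = fun w =>
    cos (\sum_j (if j == i then k else 0) * X j w + - (k * b))); last first.
    by apply/funext.
  by apply: measurable_cosD; exact: measurable_lincomb.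
have i1 : P.-integrable setT (EFin \o (fun=> 1)).
  by apply: (@bounded_integrable _ _ _ _ 1) => // w; rewrite normr1.
rewrite (RintegralB measurableT i1 icos) Rintegral_probability_cst.
rewrite [X in _ - X](_ : _ = cos (k * b) * expR (- (c * k ^+ 2 / 2))); last first.
  rewrite -vk -(cosN (k * b)) -hX.
  by apply: eq_Rintegral => w _; rewrite E.
have h1 := cos_quadratic_lb (k * b).
have h2 := expR_ge1Dx (- (c * k ^+ 2 / 2)).
have h3 := le_trans (ler_norm _) (cos_max (k * b)).
have h4 : expR (- (c * k ^+ 2 / 2)) <= 1.
  by rewrite -[leRHS]expR0 ler_expR oppr_le0 divr_ge0.
have h5 := expR_ge0 (- (c * k ^+ 2 / 2)).
move: h1; rewrite exprMn => h1.
have : (1 - cos (k * b)) * (1 - expR (- (c * k ^+ 2 / 2))) >= 0.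
  by rewrite mulr_ge0// subr_ge0.
set e := expR _ in h2 h4 h5 *; set co := cos _ in h1 h3 *.
set kb := k ^+ 2 * b ^+ 2 in h1 *.
have -> : k ^+ 2 * (b ^+ 2 + c) = kb + c * k ^+ 2 by rewrite /kb; ring.
by set ck := c * k ^+ 2 in c0 h2 *; nra.
Qed.

Context {d0 d1 : measure_display} {T0 : measurableType d0} {T1 : measurableType d1}.
Variables (P0 : probability T0 R) (P1 : probability T1 R).
Variables (X0 : J -> T0 -> R) (X1 : J -> T1 -> R) (C0 C1 : J -> J -> R).
Hypothesis gX0 : gaussian_vector P0 X0 (quad C0).
Hypothesis gX1 : gaussian_vector P1 X1 (quad C1).
Variables (A : pred J) (u : J -> R).
Hypothesis C_diag : forall i, A i -> C1 i i = C0 i i.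
Hypothesis C_le : forall i j, A i -> A j -> C0 i j <= C1 i j.

Let v (t : R) := interpol (quad C0) (quad C1) t.

(** Independent copies mixed with weights [sqrt (1 - t)] and [sqrt t] realize the interpolated
    variance, so that [trig_gauss (v t)] is an expectation and can be estimated pointwise. *)
Let gXt (t : R) : 0 <= t <= 1 -> gaussian_vector (product_probability P0 P1)
  (fun j w => Num.sqrt (1 - t) * X0 j w.1 + Num.sqrt t * X1 j w.2) (v t).
Proof.
move=> /andP[t0 t1].
have := gaussian_vectorD (gaussian_vector_scale (Num.sqrt (1 - t)) gX0)
  (gaussian_vector_scale (Num.sqrt t) gX1).
apply: eq_gaussian_vector => // a.
by rewrite !sqr_sqrtr ?subr_ge0// /v /interpol; ring.
Qed.

(** Monotone steps would make the mixed derivative nonnegative. Here [dstep2_lb] leaves a deficit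
    controlled by means of [1 - cos], hence by second moments over [(4^l)^2]. The variances stay
    those of [C0] along the interpolation, as the diagonals agree on [A]. *)
Let trig_partial2_lb l s (t : R) i j : trig_eval s =1 step_prod A u l ->
  0 <= t <= 1 -> A i -> A j -> j != i ->
  - (4 * (u i ^+ 2 + C0 i i + (u j ^+ 2 + C0 j j)) * ((2 ^ l)%:R)^-1) <=
  trig_gauss (v t) (trig_partial j (trig_partial i s)).
Proof.
move=> sE t01 Ai Aj ji; have gt := gXt t01; have [mX hX] := gt.
rewrite -(trig_gaussE _ gt).
set P := product_probability _ _ in gt mX hX *; set X := fun j _ => _ in gt mX hX *.
pose k : R := (4 ^ l)%:R^-1; pose B := dstep_bound l : R.
pose c i w := 1 - cos (k * (X i w - u i)).
have mc m : measurable_fun setT (c m).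
  apply: measurable_funB => //; apply: measurableT_comp.
    exact: (continuous_measurable_fun (@continuous_cos R)).
  apply: measurable_funM => //; apply: measurable_funB => //; exact: mX.
have ic m : P.-integrable setT (EFin \o c m).
  apply: (@bounded_integrable _ _ _ _ (1 + 1)) => // w.
  by apply: le_trans (ler_normB _ _) _; rewrite normr1 lerD2l cos_max.
have vk m : A m -> v t (fun j => if j == m then k else 0) = C0 m m * k ^+ 2.
  by move=> Am; rewrite /v /interpol !quad_delta C_diag// subrr mulr0 addr0.
have ci m : A m -> \int[P]_w c m w <= k ^+ 2 * (u m ^+ 2 + C0 m m).
  by move=> Am; apply: Rintegral_onem_cos gt _; exact: vk.
have Bk : B ^+ 2 * k ^+ 2 = 4 * ((4 ^ l)%:R)^-1.
  rewrite /B /k /dstep_bound.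
  have -> : (4 ^ l = 2 ^ l * 2 ^ l)%N by rewrite -expnMn.
  by rewrite natrM; field; rewrite pnatr_eq0 expn_eq0.
have icc : P.-integrable setT (EFin \o (fun w => c j w + c i w)).
  by rewrite (_ : _ \o _ = ((EFin \o c j) \+ (EFin \o c i))%E)//; apply: integrableD.
apply: le_trans (_ : - B ^+ 2 * (\int[P]_w (c j w + c i w)) <= _).
  rewrite RintegralD// mulNr lerN2.
  apply: le_trans (ler_wpM2l (sqr_ge0 B) (lerD (ci j Aj) (ci i Ai))) _.
  rewrite -mulrDr mulrA Bk [u j ^+ 2 + _ + _]addrC -!mulrA; apply: ler_wpM2l => //.
  rewrite mulrC; apply: ler_wpM2l.
    apply: addr_ge0; apply: addr_ge0; rewrite ?sqr_ge0//.
      have := gaussian_vector_ge0 (fun j => if j == i then 1 else 0) gX0.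
      by rewrite quad_delta expr1n mulr1.
    have := gaussian_vector_ge0 (fun k => if k == j then 1 else 0) gX0.
    by rewrite quad_delta expr1n mulr1.
  rewrite lef_pV2 ?posrE ?ltr0n ?expn_gt0// ler_nat.
  have -> : (4 ^ l = 2 ^ l * 2 ^ l)%N by rewrite -expnMn.
  by rewrite leq_pmulr// expn_gt0.
rewrite -RintegralZl//; apply: le_Rintegral => //.
- exact: (integrableZl measurableT _ icc).
- exact: integrable_trig_eval.
- move=> w _; rewrite (trig_partial2_step sE)//.
  set p := \prod_(k | _) _.
  have /andP[p0 p1] : 0 <= p <= 1.
    apply/andP; split.
      by apply: prodr_ge0 => m _; have /andP[] := step_itv l (X m w - u m).
    rewrite /p -[leRHS](@big1_eq _ _ (@GRing.mul R) J (index_enum J)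
      (fun k => A k && (k != i) && (k != j))).
    by apply: ler_prod => m _; exact: step_itv.
  have h := dstep2_lb l (X j w - u j) (X i w - u i).
  rewrite mulrA.
  have E0 : 0 <= B ^+ 2 * (c j w + c i w).
    rewrite mulr_ge0 ?sqr_ge0// addr_ge0// subr_ge0;
      exact: le_trans (ler_norm _) (cos_max _).
  rewrite mulNr; apply: le_trans (_ : - (B ^+ 2 * (c j w + c i w)) * p <= _).
    by rewrite mulNr lerN2 ler_piMr.
  by apply: ler_wpM2r.
Qed.

Let D i j := C1 i j - C0 i j.
Let E := \sum_i \sum_j `|D i j| *
  (4 * (`|u i| ^+ 2 + `|C0 i i| + (`|u j| ^+ 2 + `|C0 j j|))).

(** Mean value theorem along the interpolation. Outside [A] the mixed derivatives vanish, on the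
    diagonal [D] does, and elsewhere [D] is nonnegative and [trig_partial2_lb] applies. The constant
    [E] does not depend on [l]. *)
Let trig_gauss_slepian l s : trig_eval s =1 step_prod A u l ->
  trig_gauss (quad C0) s <= trig_gauss (quad C1) s + E * ((2 ^ l)%:R)^-1.
Proof.
move=> sE; pose r t := trig_gauss (v t) s.
have vD a : quad C1 a - quad C0 a = quad D a by rewrite quadB.
have dr (t : R) : is_derive t 1 r (2^-1 * \sum_i \sum_j D i j *
    trig_gauss (v t) (trig_partial j (trig_partial i s))).
  exact: is_derive_trig_gauss.
have cr : {within `[0, 1], continuous r}.
  apply: continuous_subspaceT => t; apply: differentiable_continuous.
  by apply/derivable1_diffP; have [] := dr t.
have [t t01] := @MVT_segment R r _ 0 1 ler01 (fun t _ => dr t) cr.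
have -> : r 1 = trig_gauss (quad C1) s.
  by apply: eq_bigr => e _; rewrite /v /interpol mul1r subrKC.
have -> : r 0 = trig_gauss (quad C0) s.
  by apply: eq_bigr => e _; rewrite /v /interpol mul0r addr0.
rewrite subr0 mulr1 => rE.
rewrite -lerBlDl -opprB lerNl rE.
have t01' : 0 <= t <= 1 by move: t01; rewrite in_itv.
apply: le_trans (_ : 2^-1 * (- (E * ((2 ^ l)%:R)^-1)) <= _).
  rewrite mulrN lerN2 ler_piMl ?invf_le1//; last by rewrite ler1n.
  apply: mulr_ge0; last by rewrite invr_ge0.
  by apply: sumr_ge0 => i _; apply: sumr_ge0 => j _; rewrite !(mulr_ge0, addr_ge0).
apply: ler_wpM2l; first by rewrite invr_ge0.
rewrite /E mulr_suml -sumrN; apply: ler_sum => i _.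
rewrite mulr_suml -sumrN; apply: ler_sum => j _.
have p0 : 0 <= ((2 ^ l)%:R)^-1 :> R by rewrite invr_ge0.
have RHS0 : 0 <= `|D i j| *
    (4 * (`|u i| ^+ 2 + `|C0 i i| + (`|u j| ^+ 2 + `|C0 j j|))) / (2 ^ l)%:R.
  by rewrite !(mulr_ge0, addr_ge0).
have [/andP[Ai Aj]|nA] := boolP (A i && A j); last first.
  rewrite -(trig_gaussE _ (gXt t01')).
  under eq_Rintegral do rewrite (trig_partial2_step0 sE _ nA).
  by rewrite Rintegral_probability_cst mulr0 oppr_le0.
have [ji|ji] := eqVneq j i.
  by rewrite ji /D C_diag// subrr mul0r -ji oppr_le0.
have D0 : 0 <= D i j by rewrite subr_ge0 C_le.
rewrite -mulrA -mulrN (ger0_norm D0); apply: ler_wpM2l => //.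
apply: le_trans (trig_partial2_lb sE t01' Ai Aj ji).
rewrite lerN2; apply: ler_wpM2r => //; apply: ler_wpM2l => //.
by rewrite !real_normK ?num_real// !lerD// ler_norm.
Qed.

Let cvg_orthant {d : measure_display} {T : measurableType d} (P : probability T R)
    (X : J -> T -> R) : (forall j, measurable_fun setT (X j)) ->
  \int[P]_w step_prod A u l (X ^~ w) @[l --> \oo] --> fine (P (orthant A u X)).
Proof.
move=> mX; have mO := measurable_orthant A u mX.
rewrite -(Rintegral_indic_probability P mO).
apply: (@bounded_cvg_Rintegral _ _ _ P 1).
- move=> l; have [s sE] := is_trig_step_prod A u l.
  rewrite (_ : (fun w => _) = (fun w => trig_eval s (X ^~ w))); last first.
    by apply/funext => w; rewrite sE.
  by have /integrableP[/measurable_EFinP] := integrable_trig_eval P s mX.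
- by move=> l w; have /andP[h0 h1] := step_prod_itv A u l (X ^~ w); rewrite ger0_norm.
- move=> w; rewrite indic_orthantE /step_prod.
  suff : forall r : seq J,
      \prod_(k <- r | A k) step l (X k w - u k) @[l --> \oo] -->
      (\prod_(k <- r | A k) (0 < X k w - u k)%R%:R : R) by apply.
  elim=> [|k r IH].
    under eq_fun do rewrite big_nil.
    by rewrite big_nil; exact: cvg_cst.
  under eq_fun do rewrite big_cons.
  by rewrite big_cons; case: (A k) => //; apply: cvgM => //; exact: cvg_step.
Qed.

Theorem slepian :
  fine (P0 (orthant A u X0)) <= fine (P1 (orthant A u X1)).
Proof.
have [mX0 _] := gX0; have [mX1 _] := gX1.
have c1 : \int[P1]_w step_prod A u l (X1 ^~ w) + E * ((2 ^ l)%:R)^-1 @[l --> \oo] -->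
    fine (P1 (orthant A u X1)).
  rewrite -[X in _ --> X]addr0; apply: cvgD; first exact: cvg_orthant.
  by rewrite -(mulr0 E); apply: cvgMr; exact: cvg_inv_exp2.
apply: (ler_cvg_to (@cvg_orthant _ _ P0 _ mX0) c1); apply: nearW => l.
have [s sE] := is_trig_step_prod A u l.
have E0 : \int[P0]_w step_prod A u l (X0 ^~ w) = trig_gauss (quad C0) s.
  by rewrite -(trig_gaussE s gX0); apply: eq_Rintegral => w _; rewrite sE.
have E1 : \int[P1]_w step_prod A u l (X1 ^~ w) = trig_gauss (quad C1) s.
  by rewrite -(trig_gaussE s gX1); apply: eq_Rintegral => w _; rewrite sE.
by rewrite E0 E1; exact: trig_gauss_slepian.
Qed.

End slepian_inequality.

(** Slepian's inequality in both directions. It takes the place of the uniqueness theorem for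
    characteristic functions. *)
Corollary gaussian_orthant_eq {R : realType} {J : finType} {d0 d1 : measure_display}
    {T0 : measurableType d0} {T1 : measurableType d1}
    (P0 : probability T0 R) (P1 : probability T1 R)
    (X0 : J -> T0 -> R) (X1 : J -> T1 -> R) (C0 C1 : J -> J -> R)
    (A : pred J) (u : J -> R) :
  gaussian_vector P0 X0 (quad C0) -> gaussian_vector P1 X1 (quad C1) ->
  (forall i j, A i -> A j -> C0 i j = C1 i j) ->
  fine (P0 (orthant A u X0)) = fine (P1 (orthant A u X1)).
Proof.
move=> g0 g1 CC; apply/eqP; rewrite eq_le; apply/andP; split.
- apply: (slepian g0 g1) => [i Ai|i j Ai Aj]; first by rewrite CC.
  by rewrite CC.
- apply: (slepian g1 g0) => [i Ai|i j Ai Aj]; first by rewrite CC.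
  by rewrite CC.
Qed.

(** * Correlated pairs of normal variables *)

Section normal_affine.
Context {R : realType}.
Variables (m s : R).
Hypothesis s0 : s != 0.

Definition affine_map (z : R) : R := m + s * z.

Let measurable_affine :
  @measurable_fun _ _ (measurableTypeR R) (measurableTypeR R) setT affine_map.
Proof. by apply: measurable_funD => //; exact: measurable_funM. Qed.

Let affine_rv : {RV (normal_prob (0 : R) 1) >-> measurableTypeR R} :=
  MeasurableFun.Pack (MeasurableFun.Class
    (isMeasurableFun.Build _ _ _ _ _ measurable_affine)).

(** Rays generate the Borel sets, and on rays both measures are orthant probabilities of
    one-dimensional Gaussian vectors with the same variance. *)
Lemma normal_prob_affine (A : set R) : measurable A ->
  distribution (normal_prob 0 1) affine_rv A = normal_prob m s A.
Proof.
move=> mA.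
apply: (@measure_unique _ R (measurableTypeR R) (@RGenOInfty.G R)
  (fun k => `](- k%:R)%R, +oo[%classic) _ _ _ _
  (distribution (normal_prob 0 1) affine_rv) (normal_prob m s)) => //.
- exact: RGenOInfty.measurableE.
- move=> _ _ [x ->] [y ->]; exists (Num.max x y).
  apply/seteqP; split=> z /=; rewrite !in_itv/= !andbT gt_max.
    by move=> [-> ->].
  by move=> /andP[].
- by move=> i; exists (- i%:R).
- apply/seteqP; split=> // x _.
  have [n xn] : exists n : nat, `|x| < n%:R.
    by exists (Num.truncn `|x|).+1; rewrite truncnS_gt.
  exists n => //=; rewrite in_itv/= andbT ltrNl.
  by apply: le_lt_trans xn; rewrite -normrN ler_norm.
- move=> _ [u ->].
  have S (F : unit -> R) : \sum_j F j = F tt by rewrite (big_pred1 tt)//; case.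
  have g0 := gaussian_vector_normal (fun _ : unit => s).
  have g1 : gaussian_vector (normal_prob m s) (fun (_ : unit) (y : R) => y - m)
      (fun a => (\sum_j a j * s) ^+ 2).
    split=> [j|a phi]; first exact: measurable_funB.
    under eq_Rintegral do rewrite S.
    by rewrite Rintegral_normal_cos// S.
  have E a : (\sum_(j : unit) a j * s) ^+ 2 = quad (fun _ _ => s ^+ 2) a.
    by rewrite /quad !S; ring.
  have e1 : orthant predT (fun=> u - m) (fun (_ : unit) (x : R) => s * x) =
      affine_map @^-1` `]u, +oo[.
    apply/seteqP; split=> z /=; rewrite /orthant/affine_map/= in_itv/= andbT.
      by move=> /(_ tt isT); rewrite ltrBlDl.
    by move=> h _ _; rewrite ltrBlDl.
  have e2 : orthant predT (fun=> u - m) (fun (_ : unit) (x : R) => x - m) =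
      `]u, +oo[%classic.
    apply/seteqP; split=> z /=; rewrite /orthant/= in_itv/= andbT.
      by move=> /(_ tt isT); rewrite ltrD2r.
    by move=> h _ _; rewrite ltrD2r.
  have h : fine (normal_prob 0 1 (affine_map @^-1` `]u, +oo[)) =
      fine (normal_prob m s `]u, +oo[%classic).
    rewrite -e1 -e2.
    have g0' := eq_gaussian_vector (fun _ _ => erefl) E g0.
    have g1' := eq_gaussian_vector (fun _ _ => erefl) E g1.
    exact: (gaussian_orthant_eq (A := predT) (fun=> u - m) g0' g1' (fun _ _ _ _ => erefl)).
  have f1 : normal_prob 0 1 (affine_map @^-1` `]u, +oo[) \is a fin_num.
    by apply: fin_num_measure; rewrite -[X in measurable X]setTI; exact: measurable_affine.
  have f2 : normal_prob m s `]u, +oo[%classic \is a fin_num.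
    by apply: fin_num_measure; exact: measurable_itv.
  by rewrite [LHS](_ : _ = normal_prob 0 1 (affine_map @^-1` `]u, +oo[))//
    -(fineK f1) h fineK.
- by move=> k; apply: le_lt_trans (ltry 1); exact: probability_le1.
Qed.

Lemma Rintegral_normal_affine (M : R) (f : R -> R) : measurable_fun setT f ->
  (forall x, `|f x| <= M) ->
  \int[normal_prob 0 1]_z f (m + s * z) = \int[normal_prob m s]_y f y.
Proof.
move=> mf fM.
have e1 : (\int[distribution (normal_prob 0 1) affine_rv]_y (f y)%:E =
    \int[normal_prob 0 1]_z (f (m + s * z))%:E)%E.
  rewrite integral_distribution//; first exact/measurable_EFinP.
  have i : (normal_prob 0 1).-integrable setT (EFin \o (f \o affine_map)).
    apply: (@bounded_integrable _ _ _ _ M) => [|z]; last exact: fM.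
    exact: measurableT_comp.
  exact: i.
have e2 : (\int[distribution (normal_prob 0 1) affine_rv]_y (f y)%:E =
    \int[normal_prob m s]_y (f y)%:E)%E.
  by apply: eq_measure_integral => A mA _; exact: normal_prob_affine.
by rewrite /Rintegral -e1 e2.
Qed.

End normal_affine.

Section noise_correlation.
Context {R : realType}.
Local Notation gamma := (normal_prob (0 : R) 1).

(** The tangent at [t * s] lies below the exponential at [s] and at 0; average the two inequalities
    with weights [t] and [1 - t]. *)
Lemma expR_convex (t s : R) : 0 <= t <= 1 -> expR (t * s) <= 1 - t + t * expR s.
Proof.
move=> /andP[t0 t1].
have h1 : expR (t * s) * (1 + (1 - t) * s) <= expR s.
  have -> : expR s = expR (t * s) * expR ((1 - t) * s).
    by rewrite -expRD; congr expR; ring.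
  by apply: ler_wpM2l (expR_ge1Dx _); exact: expR_ge0.
have h2 : expR (t * s) * (1 - t * s) <= 1.
  have e : expR (t * s) * expR (- (t * s)) = 1 by rewrite -expRD subrr expR0.
  rewrite -[leRHS]e.
  by apply: ler_wpM2l (expR_ge1Dx _); exact: expR_ge0.
have t1' : 0 <= 1 - t by rewrite subr_ge0.
have := lerD (ler_wpM2l t0 h1) (ler_wpM2l t1' h2).
rewrite mulr1 [leRHS]addrC; apply: le_trans.
by rewrite le_eqVlt; apply/orP; left; apply/eqP; ring.
Qed.

(** The reference exponential moment: its product with the standard normal density is [sqrt 2] times
    the density of variance 2. All tilts below are powers of it. *)
Definition gexp (x : R) : R := expR (x ^+ 2 / 4).

Let sqrt2_neq0 : Num.sqrt 2 != 0 :> R. Proof. by rewrite gt_eqF// sqrtr_gt0. Qed.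

Lemma measurable_gexp : measurable_fun setT gexp.
Proof.
apply: measurableT_comp; first exact: measurable_expR.
by apply: measurable_funM => //; exact: measurable_funX.
Qed.

Lemma gexp_pdfE (x : R) :
  gexp x * normal_pdf 0 1 x = Num.sqrt 2 * normal_pdf 0 (Num.sqrt 2) x.
Proof.
have q2 : (Num.sqrt 2 : R) ^+ 2 = 2 by rewrite sqr_sqrtr.
rewrite !normal_pdfE ?oner_neq0// /normal_fun /normal_peak q2 expr1n mul1r subr0.
have -> : 2 * pi *+ 2 = 2 * (pi *+ 2) :> R by rewrite -mulrnAr.
rewrite (sqrtrM (pi *+ 2)) ?ler0n//; set q := Num.sqrt (pi *+ 2).
have q0 : q != 0 by rewrite gt_eqF// sqrtr_gt0 mulrn_wgt0// pi_gt0.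
have -> : expR (- x ^+ 2 / (2 *+ 2)) = gexp x * expR (- x ^+ 2 / 2).
  by rewrite /gexp -expRD; congr expR; field.
by field; rewrite q0.
Qed.

Lemma integrable_gexp : gamma.-integrable setT (EFin \o gexp).
Proof.
apply: (integrable_density (mu := lebesgue_measure) (g := normal_pdf 0 1)) => //.
- exact: measurable_normal_pdf.
- by move=> x; exact: normal_pdf_ge0.
- exact: measurable_gexp.
under eq_fun do rewrite gexp_pdfE EFinM.
by apply: integrableZl => //; exact: integrable_normal_pdf.
Qed.

Lemma Rintegral_gexp : \int[gamma]_x gexp x = Num.sqrt 2.
Proof.
rewrite Rintegral_normal//; last first.
  under eq_fun do rewrite gexp_pdfE EFinM.
  by apply: integrableZl => //; exact: integrable_normal_pdf.
  exact: measurable_gexp.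
under eq_Rintegral do rewrite gexp_pdfE.
rewrite RintegralZl//; last exact: integrable_normal_pdf.
by rewrite /Rintegral integral_normal_pdf/= mulr1.
Qed.

(** * Exponential tilts of a function with mean at least [p] *)

Section tilting.
Variables (psi : R -> R) (p : R).
Hypothesis mpsi : measurable_fun setT psi.
Hypothesis psi01 : forall x, 0 <= psi x <= 1.
Hypothesis p0 : 0 < p.
Hypothesis ppsi : p <= \int[gamma]_x psi x.
Local Notation a := (ln (Num.sqrt 2 / p)).

Lemma integrable_psi_gexp (h : R -> R) : measurable_fun setT h ->
  (forall x, 0 <= h x <= gexp x) ->
  gamma.-integrable setT (EFin \o (fun x => psi x * h x)).
Proof.
move=> mh hg; apply: (@le_integrable _ _ _ gamma setT measurableT _ (EFin \o gexp)).
- by apply/measurable_EFinP; exact: measurable_funM.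
- move=> x _ /=; have /andP[s0 s1] := psi01 x; have /andP[h0 h1] := hg x.
  rewrite lee_fin ger0_norm ?mulr_ge0// ger0_norm ?expR_ge0//.
  by apply: le_trans h1; rewrite ler_piMl.
- exact: integrable_gexp.
Qed.

Let ipsi : gamma.-integrable setT (EFin \o psi).
Proof.
apply: (@bounded_integrable _ _ _ _ 1) => // x.
by have /andP[s0 s1] := psi01 x; rewrite ger0_norm.
Qed.

Let ipg : gamma.-integrable setT (EFin \o (fun x => psi x * gexp x)).
Proof.
apply: integrable_psi_gexp; first exact: measurable_gexp.
by move=> x; rewrite expR_ge0 lexx.
Qed.

Let expa : expR a = Num.sqrt 2 / p.
Proof. by rewrite lnK// posrE divr_gt0// sqrtr_gt0. Qed.

Let psi_gexp_ub : \int[gamma]_x (psi x * gexp x) <= expR a * \int[gamma]_x psi x.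
Proof.
apply: le_trans (_ : Num.sqrt 2 <= _).
  rewrite -Rintegral_gexp; apply: (le_Rintegral measurableT ipg integrable_gexp).
  move=> x _; have /andP[s0 s1] := psi01 x.
  by rewrite ler_piMl// expR_ge0.
rewrite expa mulrAC ler_pdivlMr//; apply: ler_wpM2l => //.
Qed.

Let measurable_expR_sqr (t : R) : measurable_fun setT (fun x : R => expR (t * (x ^+ 2 / 4))).
Proof.
apply: measurableT_comp; first exact: measurable_expR.
apply: measurable_funM => //; apply: measurable_funM => //; exact: measurable_funX.
Qed.

Lemma tilt_integrable (t : R) : t <= 1 -> gamma.-integrable setT
  (EFin \o (fun x => psi x * expR (t * (x ^+ 2 / 4)))).
Proof.
move=> t1; apply: integrable_psi_gexp => // x.
by rewrite expR_ge0/= ler_expR ler_piMl// divr_ge0// sqr_ge0.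
Qed.

Let gexpE x : expR (x ^+ 2 / 4 - a) = gexp x / expR a.
Proof. by rewrite expRD expRN. Qed.

Let ilin (b c : R) : gamma.-integrable setT
  (EFin \o (fun x => b * psi x + c * (psi x * gexp x))).
Proof.
exact: (integrableD measurableT (integrableZl measurableT b ipsi)
  (integrableZl measurableT c ipg)).
Qed.

Let Rlin (b c : R) : \int[gamma]_x (b * psi x + c * (psi x * gexp x)) =
  b * \int[gamma]_x psi x + c * \int[gamma]_x (psi x * gexp x).
Proof.
rewrite RintegralD//; last 2 first.
- exact: (integrableZl measurableT _ ipsi).
- exact: (integrableZl measurableT _ ipg).
by rewrite !RintegralZl.
Qed.

(* By convexity [exp (t q) <= exp (t a) (1 - t + t exp (q - a))], and [a] is such
   that [exp (- a)] times the integral of [gexp] is [p]. *)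
Lemma tilt_ub (t : R) : 0 <= t <= 1 ->
  \int[gamma]_x (psi x * expR (t * (x ^+ 2 / 4))) <=
  expR (t * a) * \int[gamma]_x psi x.
Proof.
move=> t01; have /andP[t0 t1] := t01.
apply: le_trans (_ : \int[gamma]_x (expR (t * a) * (1 - t) * psi x +
    expR (t * a) * t / expR a * (psi x * gexp x)) <= _).
  apply: (le_Rintegral measurableT (tilt_integrable t1) (ilin _ _)) => x _.
  have -> : expR (t * (x ^+ 2 / 4)) = expR (t * a) * expR (t * (x ^+ 2 / 4 - a)).
    by rewrite -expRD; congr expR; ring.
  have /andP[s0 s1] := psi01 x.
  rewrite [leRHS](_ : _ = psi x * (expR (t * a) * (1 - t + t * expR (x ^+ 2 / 4 - a)))).
    apply: ler_wpM2l => //; apply: ler_wpM2l; first exact: expR_ge0.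
    exact: expR_convex.
  by rewrite gexpE; field; rewrite gt_eqF ?expR_gt0.
rewrite Rlin.
have E0 : 0 <= expR (t * a) * t / expR a by rewrite !mulr_ge0 ?invr_ge0 ?expR_ge0.
apply: le_trans (lerD (lexx _) (ler_wpM2l E0 psi_gexp_ub)) _.
rewrite le_eqVlt; apply/orP; left; apply/eqP; field.
by rewrite gt_eqF// expR_gt0.
Qed.

(** With [q = x^2 / 4], two tangent bounds give [expR (- c (q - a)) >= 1 - c (expR (q - a) - 1)].
    Weighted by [psi], the mean of [expR (q - a)] is at most that of 1, by [psi_gexp_ub], so the
    correction has the right sign and [c] may be arbitrarily large. *)
Lemma tilt_lb (c : R) : 0 <= c ->
  expR (- (c * a)) * \int[gamma]_x psi x <=
  \int[gamma]_x (psi x * expR (- c * (x ^+ 2 / 4))).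
Proof.
move=> c0.
apply: le_trans (_ : \int[gamma]_x (expR (- (c * a)) * (1 + c) * psi x +
    - (expR (- (c * a)) * c / expR a) * (psi x * gexp x)) <= _); last first.
  have c1 : - c <= 1 by rewrite (le_trans _ ler01)// oppr_le0.
  apply: (le_Rintegral measurableT (ilin _ _) (tilt_integrable c1)) => x _.
  have -> : expR (- c * (x ^+ 2 / 4)) = expR (- (c * a)) * expR (- (c * (x ^+ 2 / 4 - a))).
    by rewrite -expRD; congr expR; ring.
  have /andP[s0 s1] := psi01 x.
  rewrite [leLHS](_ : _ = psi x * (expR (- (c * a)) * (1 - c * (expR (x ^+ 2 / 4 - a) - 1)))).
    apply: ler_wpM2l => //; apply: ler_wpM2l; first exact: expR_ge0.
    apply: le_trans (expR_ge1Dx _); rewrite lerD2l lerN2; apply: ler_wpM2l => //.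
    by rewrite lerBrDl expR_ge1Dx.
  by rewrite gexpE; field; rewrite gt_eqF ?expR_gt0.
rewrite Rlin.
have E0 : 0 <= expR (- (c * a)) * c / expR a by rewrite !mulr_ge0 ?invr_ge0 ?expR_ge0.
have := ler_wpM2l E0 psi_gexp_ub; rewrite -lerN2 -!mulNr => h.
apply: le_trans (lerD (lexx _) h).
rewrite le_eqVlt; apply/orP; left; apply/eqP; field.
by rewrite gt_eqF// expR_gt0.
Qed.

End tilting.

(** * Conditional density of a correlated pair *)

Section correlated_normals.
Variables (t : R).
Hypothesis t_le : `|t| <= 2^-1.
Local Notation rho := (Num.sqrt (1 - t ^+ 2)).

Let tt : 0 <= `|t|. Proof. exact: normr_ge0. Qed.
Let t2 : t ^+ 2 = `|t| ^+ 2. Proof. by rewrite real_normK ?num_real. Qed.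
Let r2 : 0 < 1 - t ^+ 2.
Proof. by rewrite t2; move: tt t_le; move: `|t| => a a0 a1; nra. Qed.
Let rho0 : 0 < rho. Proof. by rewrite sqrtr_gt0. Qed.
Let rhoE : rho ^+ 2 = 1 - t ^+ 2. Proof. by rewrite sqr_sqrtr// ltW. Qed.
Let rho_le1 : rho <= 1.
Proof.
by rewrite -[leRHS]sqrtr1 ler_wsqrtr// gerBl sqr_ge0.
Qed.

Let rho_inv_ub : rho^-1 <= expR `|t|.
Proof.
rewrite -[leLHS]mul1r ler_pdivrMr//.
rewrite -(ler_pXn2r (n := 2)) ?nnegrE ?mulr_ge0 ?expR_ge0 ?(ltW rho0)//.
rewrite expr1n exprMn rhoE -expRM_natr mulr_natr t2.
have := expR_ge1Dx (`|t| *+ 2); rewrite mulr2n => h.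
have h1 : 0 < 1 - `|t| ^+ 2 by rewrite -t2.
apply: le_trans (ler_wpM2r (ltW h1) h).
by move: tt t_le; move: `|t| => a a0 a1; nra.
Qed.

Let cross (x y : R) : `|2 * (t * (x * y))| <= `|t| * (x ^+ 2 + y ^+ 2).
Proof.
rewrite mulrCA normrM; apply: ler_wpM2l => //.
rewrite ler_norml; have := sqr_ge0 (x + y); have := sqr_ge0 (x - y).
by move=> h1 h2; apply/andP; split; nra.
Qed.

Let exponentE (x y : R) : - (y - t * x) ^+ 2 / (rho ^+ 2 *+ 2) =
  - y ^+ 2 / 2 +
  (2 * (t * (x * y)) - t ^+ 2 * (x ^+ 2 + y ^+ 2)) / (2 * (1 - t ^+ 2)).
Proof. by rewrite rhoE; field; rewrite gt_eqF. Qed.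

Let pdf01E (y : R) : normal_pdf 0 1 y = normal_peak 1 * expR (- y ^+ 2 / 2).
Proof. by rewrite normal_pdfE ?oner_neq0// /normal_fun subr0 expr1n. Qed.

Let pdfE (x y : R) : normal_pdf (t * x) rho y = rho^-1 * normal_peak 1 *
  expR (- (y - t * x) ^+ 2 / (rho ^+ 2 *+ 2)).
Proof.
rewrite normal_pdfE ?gt_eqF// /normal_fun; congr (_ * _).
rewrite /normal_peak expr1n mul1r -mulrnAr sqrtrM ?sqr_ge0// sqrtr_sqr.
by rewrite (ger0_norm (ltW rho0)) invfM.
Qed.

Let peak0 : 0 <= normal_peak 1 :> R. Proof. exact: normal_peak_ge0. Qed.

(** The ratio to the standard density is the Mehler kernel. Bounding its cross term by [cross]
    separates the variables and leaves the exponent [|t| / (2 (1 + |t|))] on [x^2 + y^2], at most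
    [|t| / 2]; the prefactor [rho^-1] is at most [expR |t|]. *)
Lemma normal_pdf_correlated_ub (x y : R) : normal_pdf (t * x) rho y <=
  expR `|t| * expR (2 * `|t| * (x ^+ 2 / 4)) *
  (expR (2 * `|t| * (y ^+ 2 / 4)) * normal_pdf 0 1 y).
Proof.
rewrite pdfE pdf01E.
have -> : expR `|t| * expR (2 * `|t| * (x ^+ 2 / 4)) *
    (expR (2 * `|t| * (y ^+ 2 / 4)) * (normal_peak 1 * expR (- y ^+ 2 / 2))) =
    expR `|t| * normal_peak 1 *
    (expR (2 * `|t| * (x ^+ 2 / 4)) * expR (2 * `|t| * (y ^+ 2 / 4)) *
     expR (- y ^+ 2 / 2)) by ring.
apply: ler_pM; rewrite ?mulr_ge0 ?invr_ge0 ?expR_ge0 ?(ltW rho0)//.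
  by apply: ler_wpM2r.
rewrite -!expRD ler_expR exponentE addrC lerD2r.
rewrite ler_pdivrMr ?mulr_gt0//.
have := cross x y; rewrite ler_norml => /andP[_ h].
apply: le_trans (lerB h (lexx _)) _.
have s0 : 0 <= x ^+ 2 + y ^+ 2 by rewrite addr_ge0 ?sqr_ge0.
rewrite t2 -mulrBl.
rewrite [leRHS](_ : _ = `|t| * (1 - `|t| ^+ 2) * (x ^+ 2 + y ^+ 2)); last by field.
apply: ler_wpM2r => //.
by move: tt t_le; move: `|t| => a a0 a1; have := sqr_ge0 a; nra.
Qed.

(** Here the exponent is [|t| / (2 (1 - |t|))], at most [|t|] because [|t| <= 1/2]; hence the factor
    4 where the upper bound has 2. *)
Lemma normal_pdf_correlated_lb (x y : R) :
  expR (- (4 * `|t|) * (x ^+ 2 / 4)) *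
  (expR (- (4 * `|t|) * (y ^+ 2 / 4)) * normal_pdf 0 1 y) <=
  normal_pdf (t * x) rho y.
Proof.
rewrite pdfE pdf01E.
have -> : expR (- (4 * `|t|) * (x ^+ 2 / 4)) *
    (expR (- (4 * `|t|) * (y ^+ 2 / 4)) * (normal_peak 1 * expR (- y ^+ 2 / 2))) =
    1 * normal_peak 1 *
    (expR (- (4 * `|t|) * (x ^+ 2 / 4)) * expR (- (4 * `|t|) * (y ^+ 2 / 4)) *
     expR (- y ^+ 2 / 2)) by ring.
apply: ler_pM; rewrite ?mulr_ge0 ?expR_ge0//.
  by apply: ler_wpM2r => //; rewrite invf_ge1.
rewrite -!expRD ler_expR exponentE addrC lerD2l.
rewrite ler_pdivlMr ?mulr_gt0//.
have := cross x y; rewrite ler_norml => /andP[h _].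
apply: le_trans (lerB h (lexx _)).
have s0 : 0 <= x ^+ 2 + y ^+ 2 by rewrite addr_ge0 ?sqr_ge0.
rewrite t2.
rewrite [leLHS](_ : _ = - (2 * `|t| * (1 - `|t| ^+ 2)) * (x ^+ 2 + y ^+ 2)); last by field.
rewrite [leRHS](_ : _ = - (`|t| + `|t| ^+ 2) * (x ^+ 2 + y ^+ 2)); last by ring.
apply: ler_wpM2r => //.
by move: tt t_le; move: `|t| => a a0 a1; have := sqr_ge0 a; nra.
Qed.

End correlated_normals.

End noise_correlation.

Section correlated_product.
Context {R : realType}.
Local Notation gamma := (normal_prob (0 : R) 1).
Local Notation leb := (@lebesgue_measure R).
Variables (psi1 psi2 : R -> R) (t p : R).
Hypothesis mpsi1 : measurable_fun setT psi1.
Hypothesis mpsi2 : measurable_fun setT psi2.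
Hypothesis psi1_01 : forall x, 0 <= psi1 x <= 1.
Hypothesis psi2_01 : forall x, 0 <= psi2 x <= 1.
Hypothesis t_le : `|t| <= 2^-1.
Hypothesis p0 : 0 < p.
Hypothesis p_psi1 : p <= \int[gamma]_x psi1 x.
Hypothesis p_psi2 : p <= \int[gamma]_x psi2 x.
Local Notation rho := (Num.sqrt (1 - t ^+ 2)).
Local Notation a := (ln (Num.sqrt 2 / p)).

Let rho0 : rho != 0.
Proof.
rewrite gt_eqF// sqrtr_gt0 -[t ^+ 2]real_normK ?num_real//.
by move: (normr_ge0 t) t_le; move: `|t| => b b0 b1; nra.
Qed.

(** The conditional mean of [psi2 Y] given [X = x], for standard normal [X] and [Y] with correlation
    [t] (the Mehler or Ornstein-Uhlenbeck operator). *)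
Definition smoothed (x : R) := \int[gamma]_z psi2 (t * x + rho * z).

Let psi2_pdf_integrable x :
  leb.-integrable setT (fun y => (psi2 y * normal_pdf (t * x) rho y)%:E).
Proof.
apply: (@le_integrable _ _ _ leb setT measurableT _
  (fun y => (normal_pdf (t * x) rho y)%:E)).
- apply/measurable_EFinP; apply: measurable_funM => //; exact: measurable_normal_pdf.
- move=> y _ /=; have /andP[s0 s1] := psi2_01 y.
  rewrite lee_fin normrM (ger0_norm s0) ger0_norm ?normal_pdf_ge0//.
  by rewrite ler_piMl// normal_pdf_ge0.
- exact: integrable_normal_pdf.
Qed.

Let smoothedE x : smoothed x = \int[leb]_y (psi2 y * normal_pdf (t * x) rho y).
Proof.
rewrite /smoothed (@Rintegral_normal_affine _ (t * x) rho rho0 1 psi2 mpsi2).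
  by rewrite Rintegral_normal.
by move=> y; have /andP[s0 s1] := psi2_01 y; rewrite ger0_norm.
Qed.

Let mexp (c : R) : measurable_fun setT (fun x : R => expR (c * (x ^+ 2 / 4))).
Proof.
apply: measurableT_comp; first exact: measurable_expR.
apply: measurable_funM => //; apply: measurable_funM => //; exact: measurable_funX.
Qed.

Let tilted_pdf_integrable (c : R) : c <= 1 ->
  leb.-integrable setT (fun y => (psi2 y * expR (c * (y ^+ 2 / 4)) * normal_pdf 0 1 y)%:E).
Proof.
move=> c1; apply: (@le_integrable _ _ _ leb setT measurableT _
  (fun y => (gexp y * normal_pdf 0 1 y)%:E)).
- apply/measurable_EFinP; apply: measurable_funM; last exact: measurable_normal_pdf.
  by apply: measurable_funM => //; exact: mexp.
- move=> y _ /=; have /andP[s0 s1] := psi2_01 y.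
  rewrite lee_fin [leLHS]ger0_norm ?mulr_ge0 ?expR_ge0 ?normal_pdf_ge0//.
  rewrite ger0_norm ?mulr_ge0 ?expR_ge0 ?normal_pdf_ge0//.
  apply: ler_wpM2r; first exact: normal_pdf_ge0.
  rewrite -[leRHS]mul1r; apply: ler_pM => //.
  by rewrite ler_expR ler_piMl// divr_ge0// sqr_ge0.
- under eq_fun do rewrite gexp_pdfE EFinM.
  by apply: integrableZl => //; exact: integrable_normal_pdf.
Qed.

Let tilted_pdfE (c : R) : c <= 1 ->
  \int[gamma]_y (psi2 y * expR (c * (y ^+ 2 / 4))) =
  \int[leb]_y (psi2 y * expR (c * (y ^+ 2 / 4)) * normal_pdf 0 1 y).
Proof.
move=> c1; have m : measurable_fun setT (fun y : R => psi2 y * expR (c * (y ^+ 2 / 4))).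
  by apply: measurable_funM => //; exact: mexp.
by rewrite (Rintegral_normal m (tilted_pdf_integrable c1)).
Qed.

Lemma smoothed_itv x : 0 <= smoothed x <= 1.
Proof.
have i2 : gamma.-integrable setT (EFin \o (fun z => psi2 (t * x + rho * z))).
  apply: (@bounded_integrable _ _ _ _ 1) => [|z].
    apply: measurableT_comp => //; apply: measurable_funD => //.
  by have /andP[s0 s1] := psi2_01 (t * x + rho * z); rewrite ger0_norm.
apply/andP; split.
  by apply: Rintegral_ge0 => z _; have /andP[] := psi2_01 (t * x + rho * z).
rewrite -[leRHS](Rintegral_probability_cst gamma).
apply: (le_Rintegral measurableT i2) => [|z _].
  by apply: (@bounded_integrable _ _ _ _ 1) => // z; rewrite normr1.
by have /andP[] := psi2_01 (t * x + rho * z).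
Qed.

Lemma measurable_smoothed : measurable_fun setT smoothed.
Proof.
apply: (@measurable_Rintegral_section _ _ _ _ _ gamma gamma 1
  (fun z => psi2 (t * z.1 + rho * z.2))) => [|z].
  apply: measurableT_comp => //; apply: measurable_funD; apply: measurable_funM => //.
by have /andP[s0 s1] := psi2_01 (t * z.1 + rho * z.2); rewrite ger0_norm.
Qed.

Let tt : 0 <= `|t|. Proof. exact: normr_ge0. Qed.
Let t2 : 0 <= 2 * `|t| <= 1.
Proof. by rewrite mulr_ge0//= mulrC -ler_pdivlMr// mul1r. Qed.

Let a_ub : a <= 2^-1 + ln p^-1.
Proof.
rewrite ln_div ?posrE ?sqrtr_gt0// lnV ?posrE//; apply: lerD => //.
rewrite -(ler_pM2l (ltr0n R 2 : 0 < 2%:R)) divff// mulr_natl -lnXn ?sqrtr_gt0//.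
by rewrite sqr_sqrtr// -[leRHS]expRK ler_ln ?posrE ?expR_gt0// (le_trans _ (expR_ge1Dx _)).
Qed.

Let p_le1 : p <= 1.
Proof.
apply: le_trans p_psi1 _; rewrite -[leRHS](Rintegral_probability_cst gamma).
apply: le_Rintegral => //.
- apply: (@bounded_integrable _ _ _ _ 1) => // x.
  by have /andP[s0 s1] := psi1_01 x; rewrite ger0_norm.
- by apply: (@bounded_integrable _ _ _ _ 1) => // z; rewrite normr1.
- by move=> x _; have /andP[] := psi1_01 x.
Qed.

Let lnp0 : 0 <= ln p^-1.
Proof. by rewrite ln_ge0// invf_ge1. Qed.

Let p1 := \int[gamma]_x psi1 x.
Let p2 := \int[gamma]_x psi2 x.
Let p1_ge0 : 0 <= p1. Proof. exact: le_trans (ltW p0) p_psi1. Qed.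
Let p2_ge0 : 0 <= p2. Proof. exact: le_trans (ltW p0) p_psi2. Qed.

Let smoothed_ub x : smoothed x <=
  expR `|t| * expR (2 * `|t| * (x ^+ 2 / 4)) * (expR (2 * `|t| * a) * p2).
Proof.
have /andP[t20 t21] := t2.
set c := expR `|t| * _; have c0 : 0 <= c by rewrite mulr_ge0 ?expR_ge0.
apply: le_trans (ler_wpM2l c0 (tilt_ub mpsi2 psi2_01 p0 p_psi2 t2)).
rewrite tilted_pdfE// smoothedE -RintegralZl//; last exact: tilted_pdf_integrable.
apply: (le_Rintegral measurableT (psi2_pdf_integrable x)
  (integrableZl measurableT c (tilted_pdf_integrable t21))).
- move=> y _; have /andP[s0 s1] := psi2_01 y.
  rewrite -mulrA mulrCA; apply: ler_wpM2l => //.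
  exact: normal_pdf_correlated_ub.
Qed.

Let smoothed_lb x : expR (- (4 * `|t|) * (x ^+ 2 / 4)) *
  (expR (- (4 * `|t| * a)) * p2) <= smoothed x.
Proof.
have t4 : 0 <= 4 * `|t| by rewrite mulr_ge0.
have t41 : - (4 * `|t|) <= 1 by rewrite (le_trans _ ler01)// oppr_le0.
set c := expR _; have c0 : 0 <= c by exact: expR_ge0.
apply: le_trans (ler_wpM2l c0 (tilt_lb mpsi2 psi2_01 p0 p_psi2 t4)) _.
rewrite tilted_pdfE// smoothedE -RintegralZl//; last exact: tilted_pdf_integrable.
apply: (le_Rintegral measurableT
  (integrableZl measurableT c (tilted_pdf_integrable t41)) (psi2_pdf_integrable x)).
- move=> y _; have /andP[s0 s1] := psi2_01 y.
  rewrite -mulrA mulrCA; apply: ler_wpM2l => //.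
  exact: normal_pdf_correlated_lb.
Qed.

Let ismoothed : gamma.-integrable setT (EFin \o (fun x => psi1 x * smoothed x)).
Proof.
apply: (@bounded_integrable _ _ _ _ 1) => [|x].
  by apply: measurable_funM => //; exact: measurable_smoothed.
have /andP[s0 s1] := psi1_01 x; have /andP[h0 h1] := smoothed_itv x.
by rewrite ger0_norm ?mulr_ge0// mulr_ile1.
Qed.

(** One tilt in each variable gives the exponent [|t| (1 + 4 a)]. It is relaxed to the form that the
    lower bound requires. *)
Lemma correlated_product_ub : \int[gamma]_x (psi1 x * smoothed x) <=
  expR (`|t| * (4 + 8 * ln p^-1)) * (p1 * p2).
Proof.
have /andP[t20 t21] := t2.
set c := expR `|t| * (expR (2 * `|t| * a) * p2).
have c0 : 0 <= c by rewrite !mulr_ge0 ?expR_ge0.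
have i1 := tilt_integrable mpsi1 psi1_01 t21.
apply: le_trans (_ : \int[gamma]_x (c * (psi1 x * expR (2 * `|t| * (x ^+ 2 / 4)))) <= _).
  apply: (le_Rintegral measurableT ismoothed (integrableZl measurableT c i1)).
  - move=> x _; have /andP[s0 s1] := psi1_01 x.
    rewrite mulrCA; apply: ler_wpM2l => //; apply: le_trans (smoothed_ub x) _.
    by rewrite /c le_eqVlt; apply/orP; left; apply/eqP; ring.
rewrite RintegralZl//.
apply: le_trans (ler_wpM2l c0 (tilt_ub mpsi1 psi1_01 p0 p_psi1 t2)) _.
rewrite -/p1 /c.
rewrite [leLHS](_ : _ = expR (`|t| + 2 * `|t| * a + 2 * `|t| * a) * (p1 * p2)); last first.
  by rewrite !expRD; ring.
apply: ler_wpM2r; first exact: mulr_ge0.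
rewrite ler_expR [leLHS](_ : _ = `|t| * (1 + 4 * a)); last by ring.
apply: ler_wpM2l => //; move: a_ub lnp0; move: a (ln p^-1) => b c' h1 h2.
lra.
Qed.

(** Each of the two tilts costs [4 |t| a], and [a <= 1/2 + ln p^-1] produces the constants 4 and
    8. *)
Lemma correlated_product_lb : expR (- (`|t| * (4 + 8 * ln p^-1))) * (p1 * p2) <=
  \int[gamma]_x (psi1 x * smoothed x).
Proof.
have t4 : 0 <= 4 * `|t| by rewrite mulr_ge0.
have t41 : - (4 * `|t|) <= 1 by rewrite (le_trans _ ler01)// oppr_le0.
set c := expR (- (4 * `|t| * a)) * p2.
have c0 : 0 <= c by rewrite mulr_ge0 ?expR_ge0.
have i1 := tilt_integrable mpsi1 psi1_01 t41.
apply: le_trans (_ : \int[gamma]_x (c * (psi1 x * expR (- (4 * `|t|) * (x ^+ 2 / 4)))) <= _);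
  last first.
  apply: (le_Rintegral measurableT (integrableZl measurableT c i1) ismoothed).
  - move=> x _; have /andP[s0 s1] := psi1_01 x.
    rewrite mulrCA; apply: ler_wpM2l => //; apply: le_trans (smoothed_lb x).
    by rewrite /c le_eqVlt; apply/orP; left; apply/eqP; ring.
rewrite RintegralZl//.
apply: le_trans (ler_wpM2l c0 (tilt_lb mpsi1 psi1_01 p0 p_psi1 t4)).
rewrite -/p1 /c.
rewrite [leRHS](_ : _ = expR (- (4 * `|t| * a) + - (4 * `|t| * a)) * (p1 * p2)); last first.
  by rewrite !expRD; ring.
apply: ler_wpM2r; first exact: mulr_ge0.
rewrite ler_expR [leRHS](_ : _ = - (`|t| * (8 * a))); last by ring.
rewrite lerN2; apply: ler_wpM2l => //; move: a_ub lnp0; move: a (ln p^-1) => b c' h1 h2.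
lra.
Qed.

End correlated_product.

(** * Comparison of two blocks *)

Section quad_algebra.
Context {R : realType} {J : finType}.
Implicit Types (C D : J -> J -> R) (a x y : J -> R) (B : pred J).

Definition mask B a : J -> R := fun j => if B j then a j else 0.

Lemma quadDl C D a : quad (fun i j => C i j + D i j) a = quad C a + quad D a.
Proof.
rewrite /quad -big_split/=; apply: eq_bigr => i _.
by rewrite -big_split/=; apply: eq_bigr => j _; rewrite mulrDl.
Qed.

Lemma quadZl C (c : R) a : quad (fun i j => c * C i j) a = c * quad C a.
Proof.
rewrite /quad mulr_sumr; apply: eq_bigr => i _.
by rewrite mulr_sumr; apply: eq_bigr => j _; rewrite -mulrA.
Qed.

Lemma quad_rank1 x y a : quad (fun i j => x i * y j) a =
  (\sum_i a i * x i) * (\sum_i a i * y i).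
Proof.
rewrite /quad mulr_suml; apply: eq_bigr => i _; rewrite mulr_sumr.
by apply: eq_bigr => j _; ring.
Qed.

Lemma quad_mask B C a :
  quad (fun i j => if B i && B j then C i j else 0) a = quad C (mask B a).
Proof.
rewrite /quad /mask; apply: eq_bigr => i _; apply: eq_bigr => j _.
by case: (B i) => /=; case: (B j) => /=; rewrite ?(mul0r, mulr0).
Qed.

Lemma quad_sub C a v (s : R) : (forall i j, C i j = C j i) ->
  quad C (fun j => a j - s * v j) = quad C a -
  2 * s * (\sum_i a i * \sum_j v j * C i j) + s ^+ 2 * quad C v.
Proof.
move=> Csym.
transitivity (\sum_i \sum_j (C i j * (a i * a j) - s * (a i * (v j * C i j)) -
   s * (a j * (v i * C j i)) + s ^+ 2 * (C i j * (v i * v j)))).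
  apply: eq_bigr => i _; apply: eq_bigr => j _; rewrite (Csym j i); ring.
have -> : \sum_i a i * (\sum_j v j * C i j) = \sum_i \sum_j a i * (v j * C i j).
  by apply: eq_bigr => i _; rewrite mulr_sumr.
have E1 : \sum_i \sum_j s * (a i * (v j * C i j)) =
    s * \sum_i \sum_j a i * (v j * C i j).
  by rewrite mulr_sumr; apply: eq_bigr => i _; rewrite mulr_sumr.
have E2 : \sum_i \sum_j s * (a j * (v i * C j i)) =
    s * \sum_i \sum_j a i * (v j * C i j).
  by rewrite exchange_big/= E1.
have E3 : \sum_i \sum_j s ^+ 2 * (C i j * (v i * v j)) = s ^+ 2 * quad C v.
  by rewrite /quad mulr_sumr; apply: eq_bigr => i _; rewrite mulr_sumr.
under eq_bigr do rewrite big_split/= sumrB sumrB.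
rewrite big_split/= !sumrB E1 E2 E3 /quad; ring.
Qed.

End quad_algebra.

Section block.
Context {R : realType} {d : measure_display} {T : measurableType d}.
Context {P : probability T R} {J : finType}.
Variables (X : J -> T -> R) (C : J -> J -> R) (B : pred J) (v : J -> R).
Local Notation gamma := (normal_prob (0 : R) 1).
Hypothesis gX : gaussian_vector P X (quad C).
Hypothesis Csym : forall i j, C i j = C j i.
Hypothesis v1 : quad C (mask B v) = 1.

(** The covariance of [X i] with the projection, that is, the combination of the block with weights
    [v]; [v1] makes the projection standard normal. *)
Definition block_cov i := \sum_j mask B v j * C i j.

(* The part of the block that is independent of the standard normal variable
   [\sum_j mask B v j * X j]. *)
Definition block_rest i w :=
  if B i then X i w - block_cov i * \sum_j mask B v j * X j w else 0.

Definition block_dot a := \sum_i a i * mask B block_cov i.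

(** Subtracting the regression on a unit-variance variable lowers the variance by the square of the
    covariance with it, which is [block_dot a]. *)
Lemma gaussian_block_rest : gaussian_vector P block_rest
  (fun a => quad C (mask B a) - block_dot a ^+ 2).
Proof.
pose M (i j : J) : R :=
  if B i then (if j == i then 1 else 0) - block_cov i * mask B v j else 0.
have := gaussian_vector_linear M gX; apply: eq_gaussian_vector.
  move=> i w; rewrite /M /block_rest; case: (B i); last first.
    by rewrite big1// => j _; rewrite mul0r.
  under eq_bigr do rewrite mulrBl.
  rewrite sumrB (bigD1 i)//= eqxx mul1r big1 ?addr0; last first.
    by move=> j /negbTE ->; rewrite mul0r.
  by congr (_ - _); rewrite mulr_sumr; apply: eq_bigr => j _; rewrite mulrA.
move=> a.
have -> : (fun j => \sum_i a i * M i j) =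
    (fun j => mask B a j - block_dot a * mask B v j).
  apply/funext => j; rewrite /M /block_dot mulr_suml.
  transitivity (\sum_i ((if j == i then mask B a i else 0) -
      a i * mask B block_cov i * mask B v j)).
    apply: eq_bigr => i _; rewrite /mask; case: (B i).
      by case: (j == i); ring.
    by case: (j == i); rewrite !(mulr0, mul0r) subr0.
  rewrite sumrB; congr (_ - _).
  rewrite (bigD1 j)//= eqxx big1 ?addr0// => i.
  by rewrite eq_sym => /negbTE ->.
rewrite quad_sub// v1 mulr1.
have -> : \sum_i mask B a i * \sum_j mask B v j * C i j = block_dot a.
  apply: eq_bigr => i _; rewrite /mask /block_cov.
  by case: (B i); rewrite ?(mul0r, mulr0).
by ring.
Qed.

Variables (A : pred J) (u : J -> R).

(** The conditional probability of the orthant event on the block when the projection equals [x];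
    the residual is independent of the projection. *)
Definition block_prob (x : R) :=
  fine (P (orthant [pred j | A j && B j] u (fun i w => block_cov i * x + block_rest i w))).

Let mrest i : measurable_fun setT (block_rest i).
Proof. by have [] := gaussian_block_rest. Qed.

Let mpair i : measurable_fun setT
  (fun z : measurableTypeR R * T => block_cov i * z.1 + block_rest i z.2).
Proof.
apply: measurable_funD.
  by apply: measurable_funM => //; exact: measurable_fst.
exact: (measurableT_comp (mrest i) measurable_snd).
Qed.

Let mpair2 x i : measurable_fun setT (fun w => block_cov i * x + block_rest i w).
Proof. exact: measurable_funD. Qed.

Let mpO := measurable_orthant [pred j | A j && B j] u mpair.

Lemma block_probE x : block_prob x = \int[P]_w
  \1_(orthant [pred j | A j && B j] u (fun i z => block_cov i * z.1 + block_rest i z.2))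
     (x, w).
Proof.
rewrite /block_prob -Rintegral_indic_probability; last exact: measurable_orthant.
by apply: eq_Rintegral => w _; rewrite !indicE.
Qed.

Lemma measurable_block_prob : measurable_fun setT block_prob.
Proof.
have -> : block_prob = fun x => \int[P]_w
  \1_(orthant [pred j | A j && B j] u (fun i z => block_cov i * z.1 + block_rest i z.2))
     (x, w) by apply/funext => x; exact: block_probE.
apply: (@measurable_Rintegral_section _ _ _ _ _ gamma P 1) => [|z].
  exact: measurable_indic.
by rewrite indicE; case: (_ \in _); rewrite ?normr1 ?normr0.
Qed.

Lemma block_prob_itv x : 0 <= block_prob x <= 1.
Proof.
have mO := measurable_orthant [pred j | A j && B j] u (mpair2 x).
rewrite /block_prob fine_ge0//= -[leRHS]/(fine 1%E) fine_le//.
- exact: fin_num_measure.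
- exact: probability_le1.
Qed.

(** Replacing the projection by an independent standard normal variable leaves the covariances
    within the block unchanged, hence also the orthant probability. *)
Lemma Rintegral_block_prob :
  \int[gamma]_x block_prob x = fine (P (orthant [pred j | A j && B j] u X)).
Proof.
have := gaussian_vectorD (gaussian_vector_normal (mask B block_cov)) gaussian_block_rest.
move=> /(eq_gaussian_vector (fun _ _ => erefl)
  (_ : _ =1 quad (fun i j => if B i && B j then C i j else 0))) => g.
under eq_Rintegral do rewrite block_probE.
rewrite -(@Rintegral_product _ _ _ _ _ gamma P 1 \1_(orthant _ _ _)); last 2 first.
- exact: measurable_indic.
- by move=> z; rewrite indicE; case: (_ \in _); rewrite ?normr1 ?normr0.
rewrite Rintegral_indic_probability//.
transitivity (fine (product_probability gamma P (orthant [pred j | A j && B j] u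
    (fun i z => mask B block_cov i * z.1 + block_rest i z.2)))).
  apply: congr1; apply: congr1.
  apply/seteqP; split=> z h i /= /andP[Ai Bi]; have := h i; rewrite /= Ai Bi => /(_ isT);
    by rewrite /mask Bi.
apply: (gaussian_orthant_eq (A := [pred j | A j && B j]) u (g _) gX).
- by move=> a; rewrite quad_mask /block_dot; ring.
- by move=> i j /= /andP[_ ->] /andP[_ ->].
Qed.

End block.

Section two_blocks.
Context {R : realType} {d : measure_display} {T : measurableType d}.
Variables (P : probability T R) (J : finType).
Variables (X : J -> T -> R) (C : J -> J -> R) (b : pred J) (v : J -> R).
Local Notation gamma := (normal_prob (0 : R) 1).
Hypothesis gX : gaussian_vector P X (quad C).
Hypothesis Csym : forall i j, C i j = C j i.
Local Notation nb := [pred j | ~~ b j].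
Hypothesis v1 : quad C (mask b v) = 1.
Hypothesis v2 : quad C (mask nb v) = 1.
Local Notation h1 := (block_cov C b v).
Local Notation h2 := (block_cov C nb v).
Let x := mask b h1.
Let y := mask nb h2.

Lemma Rintegral_product_mul {d1 d2 : measure_display} {T1 : measurableType d1}
    {T2 : measurableType d2} (P1 : probability T1 R) (P2 : probability T2 R)
    (f : T1 -> R) (g : T2 -> R) :
  measurable_fun setT f -> measurable_fun setT g ->
  (forall w, `|f w| <= 1) -> (forall w, `|g w| <= 1) ->
  \int[product_probability P1 P2]_w (f w.1 * g w.2) =
  (\int[P1]_w f w) * (\int[P2]_w g w).
Proof.
move=> mf mg f1 g1.
rewrite (@Rintegral_product _ _ _ _ _ P1 P2 1 (fun w => f w.1 * g w.2)).
- have ig := bounded_integrable P2 mg g1.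
  have E w : \int[P2]_z (f (w, z).1 * g (w, z).2) = f w * \int[P2]_w g w.
    by rewrite -RintegralZl.
  under eq_Rintegral do rewrite E.
  by rewrite RintegralZr//; exact: (bounded_integrable P1 mf f1).
- apply: measurable_funM.
    exact: (measurableT_comp mf measurable_fst).
  exact: (measurableT_comp mg measurable_snd).
- by move=> w; rewrite normrM mulr_ile1.
Qed.

Lemma Rintegral_indic_ub {d1 : measure_display} {T1 : measurableType d1} (S : set T1) w :
  `|\1_S w| <= 1 :> R.
Proof. by rewrite indicE; case: (_ \in _); rewrite ?normr1 ?normr0. Qed.

Definition coupled_cov (t : R) i j :=
  (if b i && b j then C i j else 0) + (if nb i && nb j then C i j else 0) +
  t * (x i * y j + y i * x j).

Variable t : R.
Hypothesis t_le : `|t| <= 2^-1.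
Local Notation rho := (Num.sqrt (1 - t ^+ 2)).

(* A realization of [coupled_cov]: each block keeps its law, and only the two
   standard normal projections are correlated. *)
Definition coupled i (z : measurableTypeR R * (measurableTypeR R * (T * T))) :=
  (x i + t * y i) * z.1 + ((rho * y i) * z.2.1 +
    (block_rest X C b v i z.2.2.1 + block_rest X C nb v i z.2.2.2)).

Lemma gaussian_coupled : gaussian_vector
  (product_probability gamma (product_probability gamma (product_probability P P)))
  coupled (quad (coupled_cov t)).
Proof.
have g1 := gaussian_block_rest gX Csym v1.
have g2 := gaussian_block_rest gX Csym v2.
have := gaussian_vectorD (gaussian_vector_normal (fun i => x i + t * y i))
  (gaussian_vectorD (gaussian_vector_normal (fun i => rho * y i)) (gaussian_vectorD g1 g2)).
apply: eq_gaussian_vector => // a.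
rewrite /coupled_cov !quadDl quadZl quadDl !quad_rank1 !quad_mask.
have -> : \sum_j a j * (x j + t * y j) = block_dot C b v a + t * block_dot C nb v a.
  rewrite /block_dot mulr_sumr -big_split/=; apply: eq_bigr => j _.
  by rewrite -/x -/y; ring.
have -> : \sum_j a j * (rho * y j) = rho * block_dot C nb v a.
  by rewrite /block_dot mulr_sumr; apply: eq_bigr => j _; rewrite -/y; ring.
have -> : \sum_i a i * x i = block_dot C b v a by [].
have -> : \sum_i a i * y i = block_dot C nb v a by [].
rewrite exprMn sqr_sqrtr; first by ring.
rewrite -[t ^+ 2]real_normK ?num_real//.
by move: (normr_ge0 t) t_le; move: `|t| => c c0 c1; nra.
Qed.

Variables (A : pred J) (u : J -> R).
Local Notation psi1 := (@block_prob R d T P J X C b v A u).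
Local Notation psi2 := (@block_prob R d T P J X C nb v A u).

(** Once the correlated variables [r] and [t * r + rho * z] are fixed, the blocks depend on
    independent residuals and the indicator factors. Integrating over [z] produces [smoothed]. *)
Lemma coupled_orthantE :
  fine (product_probability gamma (product_probability gamma (product_probability P P))
    (orthant A u coupled)) = \int[gamma]_r (psi1 r * smoothed psi2 t r).
Proof.
have [mZ _] := gaussian_coupled.
have mO := measurable_orthant A u mZ.
have mrest1 i : measurable_fun setT (block_rest X C b v i).
  by have [] := gaussian_block_rest gX Csym v1.
have mrest2 i : measurable_fun setT (block_rest X C nb v i).
  by have [] := gaussian_block_rest gX Csym v2.
pose O1 r := orthant [pred j | A j && b j] u (fun i w => h1 i * r + block_rest X C b v i w).
pose O2 r := orthant [pred j | A j && nb j] u (fun i w => h2 i * r + block_rest X C nb v i w).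
have mO1 r : measurable (O1 r).
  by apply: measurable_orthant => i; exact: measurable_funD.
have mO2 r : measurable (O2 r).
  by apply: measurable_orthant => i; exact: measurable_funD.
have E r z w : \1_(orthant A u coupled) (r, (z, w)) =
    \1_(O1 r) w.1 * \1_(O2 (t * r + rho * z)) w.2 :> R.
  rewrite !indic_orthantE (bigID b)/=; congr (_ * _).
    apply: eq_bigr => k /andP[Ak bk].
    rewrite (_ : coupled k _ = h1 k * r + block_rest X C b v k w.1)//.
    rewrite /coupled /x /y /mask /= bk /= [block_rest X C nb v k _](_ : _ = 0); last first.
      by rewrite /block_rest /= bk.
    by ring.
  apply: eq_bigr => k /andP[Ak bk].
  rewrite (_ : coupled k _ =
    h2 k * (t * r + rho * z) + block_rest X C nb v k w.2)//.
  rewrite /coupled /x /y /mask /= bk /= (negbTE bk) [block_rest X C b v k _](_ : _ = 0); last first.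
    by rewrite /block_rest (negbTE bk).
  by ring.
rewrite -Rintegral_indic_probability//.
rewrite (@Rintegral_product _ _ _ _ _ _ _ 1); last 2 first.
- exact: measurable_indic.
- by move=> z; exact: Rintegral_indic_ub.
apply: eq_Rintegral => r _.
have ipsi2 : gamma.-integrable setT (EFin \o (fun z => psi2 (t * r + rho * z))).
  apply: (@bounded_integrable _ _ _ _ 1) => [|z].
    apply: measurableT_comp; first exact: measurable_block_prob gX Csym v2 _ _.
    by apply: measurable_funD => //.
  have /andP[s0 s1] := block_prob_itv gX Csym v2 A u (t * r + rho * z).
  by rewrite ger0_norm.
rewrite (@Rintegral_product _ _ _ _ _ _ _ 1
  (fun z => \1_(orthant A u coupled) (r, z))); last 2 first.
- by apply: measurable_fun_pair2; exact: measurable_indic.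
- by move=> z; exact: Rintegral_indic_ub.
rewrite /smoothed -RintegralZl//; apply: eq_Rintegral => z _.
under eq_Rintegral do rewrite E.
rewrite (Rintegral_product_mul P P); last 4 first.
- exact: measurable_indic.
- exact: measurable_indic.
- by move=> w; exact: Rintegral_indic_ub.
- by move=> w; exact: Rintegral_indic_ub.
by rewrite !Rintegral_indic_probability.
Qed.

End two_blocks.

Section two_blocks_bounds.
Context {R : realType} {d : measure_display} {T : measurableType d}.
Variables (P : probability T R) (J : finType).
Variables (X : J -> T -> R) (C : J -> J -> R) (b : pred J) (v : J -> R).
Hypothesis gX : gaussian_vector P X (quad C).
Hypothesis Csym : forall i j, C i j = C j i.
Local Notation nb := [pred j | ~~ b j].
Hypothesis v1 : quad C (mask b v) = 1.
Hypothesis v2 : quad C (mask nb v) = 1.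
Variables (A : pred J) (u : J -> R) (t p : R).
Hypothesis t0 : 0 <= t.
Hypothesis t_le : t <= 2^-1.
Hypothesis C_le : forall i j, A i -> A j -> b i -> ~~ b j ->
  `|C i j| <= t * (block_cov C b v i * block_cov C nb v j).
Hypothesis p0 : 0 < p.
Local Notation p1 := (fine (P (orthant [pred j | A j && b j] u X))).
Local Notation p2 := (fine (P (orthant [pred j | A j && ~~ b j] u X))).
Hypothesis p_p1 : p <= p1.
Hypothesis p_p2 : p <= p2.

Let ct (s : R) i j : A i -> A j -> s = t \/ s = - t ->
  (b i == b j -> coupled_cov C b v s i j = C i j) /\
  (b i != b j -> exists2 c, coupled_cov C b v s i j = s * c & `|C i j| <= t * c).
Proof.
move=> Ai Aj _; rewrite /coupled_cov /mask /=.
case bi : (b i); case bj : (b j) => /=; split=> // _.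
- by ring.
- exists (block_cov C b v i * block_cov C nb v j); first by ring.
  by apply: C_le; rewrite ?bi ?bj.
- exists (block_cov C nb v i * block_cov C b v j); first by ring.
  by rewrite Csym [X in t * X]mulrC; apply: C_le; rewrite ?bi ?bj.
- by ring.
Qed.

Let E1 := Rintegral_block_prob gX Csym v1 A u.
Let E2 := Rintegral_block_prob gX Csym v2 A u.

(** The coupling with [t] dominates all cross covariances whatever their sign, and the one with
    [- t] lies below them; within blocks nothing changes, so Slepian's inequality applies to
    both. *)
Lemma two_blocks_ub : fine (P (orthant A u X)) <=
  expR (t * (4 + 8 * ln p^-1)) * (p1 * p2).
Proof.
have tn : `|t| <= 2^-1 by rewrite ger0_norm.
apply: le_trans (_ : fine (product_probability (normal_prob 0 1)
   (product_probability (normal_prob 0 1) (product_probability P P))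
    (orthant A u (coupled X C b v t))) <= _).
  apply: (slepian gX (gaussian_coupled gX Csym v1 v2 tn)).
    by move=> i Ai; have [-> //] := ct Ai Ai (or_introl erefl).
  move=> i j Ai Aj; have [e1 e2] := ct Ai Aj (or_introl (erefl t)).
  have [bb|bb] := boolP (b i == b j); first by rewrite e1.
  have [c -> cC] := e2 bb.
  exact: le_trans (ler_norm _) cC.
rewrite coupled_orthantE//.
have := @correlated_product_ub R _ _ t p (measurable_block_prob gX Csym v1 A u)
  (measurable_block_prob gX Csym v2 A u) (block_prob_itv gX Csym v1 A u)
  (block_prob_itv gX Csym v2 A u) tn p0.
by rewrite ger0_norm// E1 E2; apply.
Qed.

Lemma two_blocks_lb : expR (- (t * (4 + 8 * ln p^-1))) * (p1 * p2) <=
  fine (P (orthant A u X)).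
Proof.
have tn : `|- t| <= 2^-1 by rewrite normrN ger0_norm.
apply: (@le_trans _ _ (fine (product_probability (normal_prob 0 1)
   (product_probability (normal_prob 0 1) (product_probability P P))
    (orthant A u (coupled X C b v (- t)))))); last first.
  apply: (slepian (gaussian_coupled gX Csym v1 v2 tn) gX).
    by move=> i Ai; have [-> //] := ct Ai Ai (or_intror erefl).
  move=> i j Ai Aj; have [e1 e2] := ct Ai Aj (or_intror (erefl (- t))).
  have [bb|bb] := boolP (b i == b j); first by rewrite e1.
  have [c -> cC] := e2 bb.
  by rewrite mulNr lerNl; apply: le_trans (ler_norm _) _; rewrite normrN.
rewrite coupled_orthantE//.
have := @correlated_product_lb R _ _ (- t) p (measurable_block_prob gX Csym v1 A u)
  (measurable_block_prob gX Csym v2 A u) (block_prob_itv gX Csym v1 A u)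
  (block_prob_itv gX Csym v2 A u) tn p0.
by rewrite normrN ger0_norm// E1 E2; apply.
Qed.

End two_blocks_bounds.

(** * Covariances of a stationary Gaussian process *)

Section laws.
Context {R : realType} {d : measure_display} {T : measurableType d}.
Variable P : probability T R.

Lemma ge0_integral_law {d' : measure_display} {T' : measurableType d'}
    (X : T -> T') (mu : {measure set T' -> \bar R}) (g : T' -> \bar R) :
  measurable_fun setT X -> (forall A, measurable A -> P (X @^-1` A) = mu A) ->
  measurable_fun setT g -> (forall x, 0 <= g x)%E ->
  (\int[P]_w g (X w) = \int[mu]_x g x)%E.
Proof.
move=> mX law mg g0.
pose X' : {mfun T >-> T'} := MeasurableFun.Pack (MeasurableFun.Class
    (isMeasurableFun.Build _ _ _ _ _ mX)).
transitivity (\int[distribution P X']_x g x)%E.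
  by rewrite ge0_integral_distribution.
by apply: eq_measure_integral => A mA _; exact: law.
Qed.

Lemma integrable_law {d' : measure_display} {T' : measurableType d'}
    (X : T -> T') (mu : {measure set T' -> \bar R}) (g : T' -> R) :
  measurable_fun setT X -> (forall A, measurable A -> P (X @^-1` A) = mu A) ->
  mu.-integrable setT (EFin \o g) ->
  P.-integrable setT (EFin \o (g \o X)) /\ \int[P]_w g (X w) = \int[mu]_x g x.
Proof.
move=> mX law ig; have /integrableP[/measurable_EFinP mg fg] := ig.
have iX : P.-integrable setT (EFin \o (g \o X)).
  apply/integrableP; split; first by apply/measurable_EFinP; exact: measurableT_comp.
  apply: le_lt_trans fg.
  rewrite (@ge0_integral_law _ _ X mu (fun x => `|(g x)%:E|)%E)//.
  by do 2 apply: measurableT_comp => //.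
split=> //.
pose X' : {mfun T >-> T'} := MeasurableFun.Pack (MeasurableFun.Class
    (isMeasurableFun.Build _ _ _ _ _ mX)).
rewrite /Rintegral.
have e1 : (\int[distribution P X']_x (g x)%:E = \int[P]_w (g (X w))%:E)%E.
  by rewrite integral_distribution//; exact/measurable_EFinP.
have e2 : (\int[distribution P X']_x (g x)%:E = \int[mu]_x (g x)%:E)%E.
  by apply: eq_measure_integral => A mA _; exact: law.
by rewrite -e1 e2.
Qed.

Lemma integrable_dirac {d' : measure_display} {T' : measurableType d'} (a : T')
    (g : T' -> R) : measurable_fun setT g ->
  (\d_a : {measure set T' -> \bar R}).-integrable setT (EFin \o g) /\
  \int[(\d_a : {measure set T' -> \bar R})]_x g x = g a.
Proof.
move=> mg; split.
  apply/integrableP; split; first exact/measurable_EFinP.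
  rewrite integral_dirac//=.
    by rewrite diracT mul1e ltry.
  by do 2 apply: measurableT_comp => //.
rewrite /Rintegral integral_dirac//; last exact/measurable_EFinP.
by rewrite diracT mul1e.
Qed.

(** A zero mean forces the parameter [m] to be 0, for a point mass as for a genuine normal law, and
    then the second moment is the variance. *)
Lemma centred_gaussian (X : T -> R) : measurable_fun setT X -> is_gaussian P X ->
  P.-integrable setT (EFin \o X) /\ P.-integrable setT (EFin \o (fun w => X w ^+ 2)) /\
  (\int[P]_w X w = 0 -> forall phi,
    \int[P]_w cos (X w + phi) = cos phi * expR (- (\int[P]_w (X w ^+ 2) / 2))).
Proof.
move=> mX [m [s [s0]]]; have [_|sn0] := eqVneq s 0.
  move=> law.
  have L (g : R -> R) : measurable_fun setT g ->
      P.-integrable setT (EFin \o (g \o X)) /\ \int[P]_w g (X w) = g m.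
    move=> mg; have [ig <-] := integrable_dirac m mg.
    apply: integrable_law => //.
  have [i1 e1] := L id (@measurable_id _ _ setT).
  have msqr : measurable_fun setT (fun x : R => x ^+ 2) by exact: measurable_funX.
  have [i2 e2] := L _ msqr.
  split=> //; split=> // m0 phi.
  have mc : measurable_fun setT (fun x : R => cos (x + phi)) by exact: measurable_cosD.
  have [_ e3] := L _ mc.
  rewrite e2 e3; move: e1; rewrite m0 => <-.
  by rewrite add0r expr0n/= mul0r oppr0 expR0 mulr1.
move=> law.
have L (g : R -> R) (c : R) : measurable_fun setT g ->
    (forall x, `|g x| <= c + c * (x - m) ^+ 2) ->
    P.-integrable setT (EFin \o (g \o X)) /\ \int[P]_w g (X w) = \int[normal_prob m s]_x g x.
  move=> mg gc; exact: (@integrable_law _ (measurableTypeR R) X (normal_prob m s) g mX law (integrable_normal_sqr sn0 mg gc)).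
have abs_ub (x : R) : `|x - m| <= 1 + (x - m) ^+ 2.
  have := sqr_ge0 (`|x - m| - 2^-1).
  by rewrite -(real_normK (num_real (x - m))); nra.
have xm (x : R) : x = (x - m) + m by rewrite subrK.
have m1 : 0 <= `|m| by [].
have [i1 e1] : P.-integrable setT (EFin \o (id \o X)) /\
    \int[P]_w X w = \int[normal_prob m s]_x x.
  apply: (L id (1 + `|m|)) => // x; rewrite /= {1}(xm x).
  apply: le_trans (ler_normD _ _) _; have := abs_ub x; have := sqr_ge0 (x - m).
  by move: (`|x - m|) (`|m|) m1 ((x - m) ^+ 2) => a b b0 q q0 aq; nra.
have msqr : measurable_fun setT (fun x : R => x ^+ 2) by exact: measurable_funX.
have [i2 e2] : P.-integrable setT (EFin \o ((fun x => x ^+ 2) \o X)) /\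
    \int[P]_w (X w ^+ 2) = \int[normal_prob m s]_x (x ^+ 2).
  apply: (L (fun x => x ^+ 2) (2 + 2 * m ^+ 2)) => // x.
  rewrite ger0_norm ?sqr_ge0// {1}(xm x).
  have := sqr_ge0 (x - m - m); have := sqr_ge0 (x - m); have := sqr_ge0 m.
  by move: (x - m) => y h1 h2 h3; nra.
split=> //; split=> // m0 phi.
have mE : m = 0.
  have h := Rintegral_normal_centred m sn0.
  have ix : (normal_prob m s).-integrable setT (EFin \o (fun x : R => x)).
    apply: (@integrable_normal_sqr _ m s sn0 (1 + `|m|)) => // x; rewrite /= {1}(xm x).
    apply: le_trans (ler_normD _ _) _; have := abs_ub x; have := sqr_ge0 (x - m).
    by move: (`|x - m|) (`|m|) m1 ((x - m) ^+ 2) => a b b0 q q0 aq; nra.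
  have im : (normal_prob m s).-integrable setT (EFin \o (fun=> m)).
    exact: (@bounded_integrable _ _ _ _ `|m|).
  move: h; rewrite RintegralB// Rintegral_probability_cst -e1 m0 sub0r.
  by move/eqP; rewrite oppr_eq0 => /eqP.
have mc : measurable_fun setT (fun x : R => cos (x + phi)) by exact: measurable_cosD.
have [_ ->] : P.-integrable setT (EFin \o ((fun x => cos (x + phi)) \o X)) /\
    \int[P]_w cos (X w + phi) = \int[normal_prob m s]_x cos (x + phi).
  apply: (L (fun x => cos (x + phi)) 1) => // x.
  by apply: le_trans (cos_max _) _; rewrite lerDl mul1r sqr_ge0.
have v : \int[normal_prob m s]_x (x ^+ 2) = s ^+ 2.
  rewrite -(Rintegral_normal_variance m sn0).
  by apply: eq_Rintegral => x _; rewrite mE subr0.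
rewrite e2 v -[s ^+ 2](congr1 (fun y => y ^+ 2) (mul1r s)).
rewrite -(Rintegral_normal_cos m sn0 1 phi).
by apply: eq_Rintegral => x _; rewrite mE subr0 mul1r.
Qed.

End laws.

Section process_covariance.
Context {R : realType} {d : measure_display} {T : measurableType d}.
Variables (P : probability T R) (f : R -> {RV P >-> R}).
Hypothesis hf : SGP f.
Local Notation K := (covariance_kernel f).

Let mf t : measurable_fun setT (f t). Proof. exact: measurable_funP. Qed.

Lemma gaussian_lincomb (J : finType) (t a : J -> R) :
  is_gaussian P (fun w => \sum_j a j * f (t j) w).
Proof.
have := SGP_gaussian hf (fun i : 'I_#|J| => t (enum_val i)) (fun i => a (enum_val i)).
congr (is_gaussian P _); apply/funext => w.
by rewrite [RHS](reindex (@enum_val J predT))//; exact/onW_bij/enum_val_bij.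
Qed.

Let gaussian_f t : is_gaussian P (f t).
Proof.
have := gaussian_lincomb (fun _ : unit => t) (fun=> 1).
congr (is_gaussian P _); apply/funext => w.
by rewrite (big_pred1 tt) ?mul1r//; case.
Qed.

Let integrable_f t : P.-integrable setT (EFin \o f t).
Proof. by have [] := centred_gaussian (mf t) (gaussian_f t). Qed.

Let integrable_f2 t : P.-integrable setT (EFin \o (fun w => f t w ^+ 2)).
Proof. by have [_ []] := centred_gaussian (mf t) (gaussian_f t). Qed.

Let integrable_ff s t : P.-integrable setT (EFin \o (fun w => f s w * f t w)).
Proof.
apply: (@le_integrable _ _ _ P setT measurableT _
  (fun w => (f s w ^+ 2 + f t w ^+ 2)%:E)).
- by apply/measurable_EFinP; exact: measurable_funM.
- move=> w _ /=; rewrite lee_fin [leRHS]ger0_norm ?addr_ge0 ?sqr_ge0// normrM.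
  rewrite -(real_normK (num_real (f s w))) -(real_normK (num_real (f t w))).
  have := sqr_ge0 (`|f s w| - `|f t w|).
  by move: (normr_ge0 (f s w)) (normr_ge0 (f t w)); move: `|_| `|_| => x y; nra.
- exact: (integrableD measurableT (integrable_f2 s) (integrable_f2 t)).
Qed.

Let mean_f t : \int[P]_w f t w = 0.
Proof. by have := SGP_centred hf t; rewrite unlock /Rintegral => ->. Qed.

(** Stationarity shifts the times [(0, t - s)] by [s], so the two products have the same law
    [mu]. *)
Lemma covarianceE s t : \int[P]_w (f s w * f t w) = K (t - s).
Proof.
transitivity (\int[P]_w (f 0 w * f (t - s) w)); last first.
  by rewrite /covariance_kernel unlock.
pose tm (i : 'I_2) : R := if i == ord0 then 0 else t - s.
pose pr (x : 2.-tuple R) := tnth x ord0 * tnth x ord_max.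
have mpr : measurable_fun setT pr.
  by apply: measurable_funM; exact: measurable_tnth.
pose mu : {measure set (measurableTypeR R) -> \bar R} :=
  distribution P (MeasurableFun.Pack (MeasurableFun.Class
    (isMeasurableFun.Build _ _ _ _ _
      (measurable_funM (mf 0) (mf (t - s)) :
        @measurable_fun _ _ T (measurableTypeR R) setT (fun w => f 0 w * f (t - s) w))))).
have law A : measurable A -> P ((fun w => f s w * f t w) @^-1` A) = mu A.
  move=> mA.
  have := @SGP_stationary _ _ _ _ _ hf 2 tm s (pr @^-1` A).
  have mB : measurable (pr @^-1` A) by rewrite -[X in measurable X]setTI; exact: mpr.
  move=> /(_ mB).
  have -> : (fun w => [tuple f (tm i + s) w | i < 2]) @^-1` (pr @^-1` A) =
      (fun w => f s w * f t w) @^-1` A.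
    by apply/seteqP; split=> w; rewrite /preimage/= /pr !tnth_mktuple /tm/= add0r subrK.
  have -> : (fun w => [tuple f (tm i) w | i < 2]) @^-1` (pr @^-1` A) =
      (fun w => f 0 w * f (t - s) w) @^-1` A.
    by apply/seteqP; split=> w; rewrite /preimage/= /pr !tnth_mktuple /tm.
  by move=> ->.
have mid : measurable_fun setT (fun x : R => x) by exact: measurable_id.
have imu : mu.-integrable setT (EFin \o (fun x : R => x)).
  have h := integrable_ff 0 (t - s).
  apply: integrable_pushforward => //; exact/measurable_EFinP.
have [_ ->] := @integrable_law _ _ _ P _ (measurableTypeR R)
  (fun w => f s w * f t w) mu (fun x => x) (measurable_funM (mf s) (mf t)) law imu.
have [_ ->//] := @integrable_law _ _ _ P _ (measurableTypeR R)
  (fun w => f 0 w * f (t - s) w) mu (fun x => x) (measurable_funM (mf 0) (mf (t - s)))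
  (fun _ _ => erefl) imu.
Qed.

Lemma covariance_kernelN x : K (- x) = K x.
Proof.
rewrite -[- x]sub0r -covarianceE -[x in RHS]subr0 -covarianceE.
by apply: eq_Rintegral => w _; rewrite mulrC.
Qed.

(** The weights [sg] serve for sign patterns: negativity of [f] on an interval becomes positivity of
    [- f]. *)
Lemma process_gaussian_vector (J : finType) (t sg : J -> R) :
  gaussian_vector P (fun j w => sg j * f (t j) w)
    (quad (fun i j => sg i * sg j * K (t i - t j))).
Proof.
split=> [j|a phi]; first exact: measurable_funM.
pose c j := a j * sg j.
have E w : \sum_j a j * (sg j * f (t j) w) = \sum_j c j * f (t j) w.
  by apply: eq_bigr => j _; rewrite mulrA.
have mX : measurable_fun setT (fun w => \sum_j c j * f (t j) w).
  by apply: measurable_sum => j; exact: measurable_funM.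
have [_ [_ H]] := centred_gaussian mX (gaussian_lincomb t c).
have icf j : P.-integrable setT (EFin \o (fun w => c j * f (t j) w)).
  exact: (integrableZl measurableT (c j) (integrable_f (t j))).
have sumR (I : finType) (F : I -> T -> R) :
    (forall i, P.-integrable setT (EFin \o F i)) ->
    \int[P]_w (\sum_i F i w) = \sum_i \int[P]_w F i w.
  move=> iF; suff H' (r : seq I) : P.-integrable setT (EFin \o (fun w => \sum_(i <- r) F i w)) /\
      \int[P]_w (\sum_(i <- r) F i w) = \sum_(i <- r) \int[P]_w F i w by apply: (H' _).2.
  elim: r => [|i r [IH1 IH2]].
    rewrite big_nil; split.
      apply: (@bounded_integrable _ _ _ _ 0) => [|w]; last by rewrite big_nil normr0.
      by under eq_fun do rewrite big_nil; exact: measurable_cst.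
    under eq_Rintegral do rewrite big_nil.
    exact: Rintegral_probability_cst.
  split.
    have -> : (fun w => \sum_(k <- i :: r) F k w) = (fun w => F i w + \sum_(k <- r) F k w).
      by apply/funext => w; rewrite big_cons.
    exact: (integrableD measurableT (iF i) IH1).
  under eq_Rintegral do rewrite big_cons.
  by rewrite RintegralD// big_cons IH2.
have m0 : \int[P]_w \sum_j c j * f (t j) w = 0.
  rewrite sumR// big1// => j _; rewrite RintegralZl//.
  by rewrite mean_f mulr0.
suff <- : \int[P]_w (\sum_j c j * f (t j) w) ^+ 2 =
    quad (fun i j => sg i * sg j * K (t i - t j)) a.
  by rewrite -(H m0 phi); apply: eq_Rintegral => w _; rewrite E.
have -> : \int[P]_w (\sum_j c j * f (t j) w) ^+ 2 =
    \int[P]_w \sum_j \sum_i c i * c j * (f (t j) w * f (t i) w).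
  apply: eq_Rintegral => w _; rewrite expr2 mulr_suml; apply: eq_bigr => j _.
  by rewrite mulr_sumr; apply: eq_bigr => i _; ring.
have icff i j : P.-integrable setT (EFin \o (fun w => c i * c j * (f (t j) w * f (t i) w))).
  exact: (integrableZl measurableT (c i * c j) (integrable_ff (t j) (t i))).
rewrite sumR; last first.
  move=> j; have -> : EFin \o (fun w => \sum_i c i * c j * (f (t j) w * f (t i) w)) =
      (fun w => \sum_(i <- index_enum J) (c i * c j * (f (t j) w * f (t i) w))%:E)%E.
    by apply/funext => w; rewrite /= sumEFin.
  by apply: integrable_sum => // i _; exact: icff.
apply: eq_bigr => j _; rewrite sumR//; apply: eq_bigr => i _.
rewrite RintegralZl// covarianceE /c -opprB covariance_kernelN; ring.
Qed.

End process_covariance.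

(** * The process on a grid *)

Lemma eq_orthant {R : realType} {d : measure_display} {T : measurableType d}
    {J : finType} (A A' : pred J) (u : J -> R) (X : J -> T -> R) :
  A =1 A' -> orthant A u X = orthant A' u X.
Proof.
by move=> AA'; apply/seteqP; split=> w h j Aj; apply: h; move: Aj; rewrite AA'.
Qed.

Section grid.
Context {R : realType} {d : measure_display} {T : measurableType d}.
Variables (P : probability T R) (f : R -> {RV P >-> R}).
Hypothesis hf : SGP f.
Local Notation K := (covariance_kernel f).
Hypothesis Kpos : forall x, 0 < K x.

(** The variance of [f x - f 0] is nonnegative. *)
Lemma covariance_kernel_le x : K x <= K 0.
Proof.
pose t (i : bool) : R := if i then x else 0.
have := gaussian_vector_ge0 (fun i : bool => if i then 1 else - 1)
  (process_gaussian_vector hf t (fun=> 1)).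
rewrite /quad !big_bool /t !mul1r !subr0 subrr sub0r covariance_kernelN//=.
by move: (K x) (K 0) => a b; lra.
Qed.

Variables (k n m : nat) (x : 'I_k -> 'I_n -> R) (sg : 'I_k -> R) (delta kappa : R).
Hypothesis sg2 : forall i, sg i ^+ 2 = 1.
Hypothesis delta0 : 0 < delta.
Hypothesis x_near : forall i l, exists2 l' : 'I_n, (l' < m)%N & delta <= K (x i l - x i l').
Hypothesis kappa0 : 0 <= kappa.
Hypothesis x_far : forall i i' l l', i != i' -> K (x i l - x i' l') <= kappa.
Hypothesis small : (k * m)%:R * kappa <= delta / 2.
Hypothesis k2 : (2 <= k)%N.
Hypothesis n0 : (0 < n)%N.

Let J : finType := ('I_k * 'I_n)%type.

Definition grid_proc (j : J) w := sg j.1 * f (x j.1 j.2) w.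

Definition grid_cov (j j' : J) := sg j.1 * sg j'.1 * K (x j.1 j.2 - x j'.1 j'.2).

(** Only the first [m] points of each group enter the projection, so the estimates involve [m] but
    not the number [n] of grid points, which tends to infinity. *)
Definition grid_weight (j : J) : R := (j.2 < m)%N%:R.

Lemma gaussian_grid_proc : gaussian_vector P grid_proc (quad grid_cov).
Proof. exact: process_gaussian_vector. Qed.

Lemma grid_cov_sym j j' : grid_cov j j' = grid_cov j' j.
Proof.
by rewrite /grid_cov -[x j'.1 _ - _]opprB covariance_kernelN// [sg j.1 * _]mulrC.
Qed.

Let norm_cov j j' : `|grid_cov j j'| = K (x j.1 j.2 - x j'.1 j'.2).
Proof.
have h i : `|sg i| = 1.
  by apply/eqP; rewrite -sqrp_eq1// real_normK ?num_real// sg2.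
by rewrite /grid_cov !normrM !h !mul1r ger0_norm// ltW.
Qed.

(** Only an inequality, as [m] may exceed [n]. *)
Let sum_lt (y : R) : 0 <= y -> \sum_(l < n | (l < m)%N) y <= m%:R * y.
Proof.
move=> y0; rewrite sumr_const -[leLHS]mulr_natl; apply: ler_wpM2r => //; rewrite ler_nat.
have -> : #|[pred l : 'I_n | (l < m)%N]| = size [seq l : 'I_n <- enum 'I_n | (l < m)%N].
  by rewrite cardE /enum_mem filter_predT.
rewrite -(size_map val) -[leqRHS](size_iota 0 m).
apply: uniq_leq_size.
  rewrite map_inj_uniq; last exact: val_inj.
  by rewrite filter_uniq// enum_uniq.
by move=> _ /mapP[l + ->]; rewrite mem_filter mem_iota add0n => /andP[].
Qed.

Section block_weights.
Variable Bk : pred 'I_k.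
Local Notation B := [pred j : J | Bk j.1].

Let cov := block_cov grid_cov B grid_weight.

Let covE j : cov j = \sum_(i' | Bk i') \sum_(l' < n | (l' < m)%N) grid_cov j (i', l').
Proof.
rewrite pair_big_dep/= /cov /block_cov [RHS]big_mkcond/=; apply: eq_bigr => -[i' l'] _.
rewrite /mask /grid_weight/=; case: (Bk i') => /=; last by rewrite mul0r.
by case: (l' < m)%N; rewrite ?mul1r ?mul0r.
Qed.

(** Within the group of [j] the signs cancel, all covariances are positive and [x_near] supplies one
    of at least [delta]. The other groups of the block may carry the opposite sign, but their at
    most [k * m] terms cost no more than [delta / 2]. *)
Lemma grid_cov_lb j : Bk j.1 -> delta / 2 <= cov j.
Proof.
move=> Bj; rewrite covE (bigD1 j.1)//=.
have h1 : delta <= \sum_(l' < n | (l' < m)%N) grid_cov j (j.1, l').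
  have [l' lm dl] := x_near j.1 j.2.
  have e l : grid_cov j (j.1, l) = K (x j.1 j.2 - x j.1 l).
    by rewrite /grid_cov/= -expr2 sg2 mul1r.
  rewrite (bigD1 l')//= e -[leLHS]addr0; apply: lerD => //.
  by apply: sumr_ge0 => l _; rewrite e ltW.
have h2 : - (delta / 2) <=
    \sum_(i | Bk i && (i != j.1)) \sum_(l' < n | (l' < m)%N) grid_cov j (i, l').
  apply: le_trans (_ : - ((k * m)%:R * kappa) <= _); first by rewrite lerN2.
  apply: le_trans (_ : \sum_(i | Bk i && (i != j.1)) - (m%:R * kappa) <= _).
    rewrite sumrN lerN2 natrM -mulrA sumr_const -[leLHS]mulr_natl.
    apply: ler_wpM2r; first by rewrite mulr_ge0.
    by rewrite ler_nat -[leqRHS](card_ord k) max_card.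
  apply: ler_sum => i /andP[_ ij].
  apply: le_trans (_ : - \sum_(l' < n | (l' < m)%N) kappa <= _).
    by rewrite lerN2; exact: sum_lt.
  rewrite -sumrN; apply: ler_sum => l' _.
  rewrite lerNl; apply: le_trans (ler_norm _) _; rewrite normrN norm_cov/=.
  by apply: x_far; rewrite eq_sym.
by apply: le_trans (lerD h1 h2); lra.
Qed.

Definition grid_var := quad grid_cov (mask B grid_weight).

Let varE : grid_var = \sum_j mask B grid_weight j * cov j.
Proof.
rewrite /grid_var /quad /cov /block_cov; apply: eq_bigr => j _; rewrite mulr_sumr.
by apply: eq_bigr => j' _; ring.
Qed.

Lemma grid_var_gt0 : (exists i, Bk i) -> 0 < grid_var.
Proof.
move=> [i Bi]; have [l lm _] := x_near i (Ordinal n0).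
rewrite varE (bigD1 (i, l))//= {1}/mask /= Bi /grid_weight/= lm mul1r.
apply: ltr_pwDl.
  by apply: lt_le_trans (grid_cov_lb (j := (i, l)) Bi); rewrite divr_gt0.
apply: sumr_ge0 => -[i' l'] _; rewrite /mask/=.
have [Bi'|_] := boolP (Bk i'); last by rewrite mul0r.
rewrite mulr_ge0//; apply: le_trans (grid_cov_lb (j := (i', l')) Bi').
by rewrite divr_ge0// ltW.
Qed.

Lemma grid_var_ub : grid_var <= (k * m)%:R ^+ 2 * K 0.
Proof.
have wt0 j : 0 <= mask B grid_weight j.
  by rewrite /mask; case: (B j).
have wtS : \sum_j mask B grid_weight j <= (k * m)%:R.
  rewrite (_ : \sum_j _ = \sum_(i | Bk i) \sum_(l < n | (l < m)%N) 1); last first.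
    rewrite pair_big_dep/= [RHS]big_mkcond/=; apply: eq_bigr => -[i l] _.
    by rewrite /mask /grid_weight/=; case: (Bk i) => //=; case: (l < m)%N.
  apply: le_trans (_ : \sum_(i | Bk i) m%:R <= _).
    by apply: ler_sum => i _; have := sum_lt ler01; rewrite mulr1.
  rewrite sumr_const -[leLHS]mulr_natl -natrM ler_nat leq_mul2r.
  by rewrite -[X in (_ <= X)%N](card_ord k) max_card orbT.
have S0 : 0 <= \sum_j mask B grid_weight j by exact: sumr_ge0.
apply: le_trans (_ : (\sum_j mask B grid_weight j) ^+ 2 * K 0 <= _); last first.
  apply: ler_wpM2r; first exact: ltW.
  by apply: lerXn2r; rewrite ?nnegrE.
rewrite expr2 mulr_suml mulr_suml; apply: ler_sum => j _.
rewrite mulr_sumr mulr_suml; apply: ler_sum => j' _.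
rewrite mulrC; apply: ler_wpM2l; first exact: mulr_ge0.
apply: le_trans (ler_norm _) _; rewrite norm_cov; exact: covariance_kernel_le.
Qed.

(** The weights are prescribed on the block only: a single [v] can then carry the different
    normalizations of two complementary blocks. *)
Lemma grid_normalized v : (exists i, Bk i) ->
  (forall j, Bk j.1 -> v j = (Num.sqrt grid_var)^-1 * grid_weight j) ->
  quad grid_cov (mask B v) = 1 /\
  forall j, Bk j.1 -> delta / 2 / Num.sqrt ((k * m)%:R ^+ 2 * K 0) <=
    block_cov grid_cov B v j.
Proof.
move=> exB vE; have V0 := grid_var_gt0 exB.
have s0 : 0 < Num.sqrt grid_var by rewrite sqrtr_gt0.
have mE : mask B v = (fun j => (Num.sqrt grid_var)^-1 * mask B grid_weight j).
  apply/funext => j; rewrite /mask /=; case: ifPn => [/vE //|_]; first by rewrite mulr0.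
split; first by rewrite mE quadZ exprVn sqr_sqrtr ?(ltW V0)// mulVf// gt_eqF.
move=> j Bj; rewrite /block_cov mE.
under eq_bigr do rewrite -mulrA.
rewrite -mulr_sumr mulrC; apply: ler_pM.
- by rewrite invr_ge0 sqrtr_ge0.
- by rewrite divr_ge0// ltW.
- by rewrite lef_pV2 ?posrE ?sqrtr_gt0 ?(lt_le_trans V0) ?grid_var_ub// ler_wsqrtr// grid_var_ub.
- exact: grid_cov_lb.
Qed.

End block_weights.

Local Notation t := (4 * kappa * ((k * m)%:R ^+ 2 * K 0) / delta ^+ 2).
Hypothesis t_le : t <= 2^-1.

(** With [q] the lower bound of [grid_normalized] for the covariances with either projection, [t] is
    chosen so that [t * q^2 = kappa], the bound on the cross covariances. *)
Lemma grid_split (i0 : 'I_k) (A : pred J) (u : J -> R) (p : R) :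
  0 < p ->
  p <= fine (P (orthant [pred j | A j && (j.1 == i0)] u grid_proc)) ->
  p <= fine (P (orthant [pred j | A j && (j.1 != i0)] u grid_proc)) ->
  expR (- (t * (4 + 8 * ln p^-1))) *
    (fine (P (orthant [pred j | A j && (j.1 == i0)] u grid_proc)) *
     fine (P (orthant [pred j | A j && (j.1 != i0)] u grid_proc))) <=
  fine (P (orthant A u grid_proc)) <=
  expR (t * (4 + 8 * ln p^-1)) *
    (fine (P (orthant [pred j | A j && (j.1 == i0)] u grid_proc)) *
     fine (P (orthant [pred j | A j && (j.1 != i0)] u grid_proc))).
Proof.
move=> p0 pp1 pp2.
pose v (j : J) := (Num.sqrt (grid_var (if j.1 == i0 then pred1 i0 else predC1 i0)))^-1
  * grid_weight j.
have ex2 : exists i, predC1 i0 i.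
  have [i /negbTE ni] : exists i, ~~ (i == i0); last by exists i; rewrite /= ni.
  apply: contrapT => h; have : (#|'I_k| <= 1)%N.
    apply/card_le1_eqP => i i' _ _; have e j : j = i0.
      by have [//|ji] := eqVneq j i0; case: h; exists j.
    by rewrite (e i) (e i').
  by rewrite card_ord leqNgt k2.
have [v1 c1] := @grid_normalized (pred1 i0) v (ex_intro _ i0 (eqxx i0))
  (fun j (e : j.1 == i0) => ltac:(by rewrite /v e)).
have [v2 c2] := @grid_normalized (predC1 i0) v ex2
  (fun j (e : j.1 != i0) => ltac:(by rewrite /v (negbTE e))).
have W0 : 0 < (k * m)%:R ^+ 2 * K 0.
  by apply: lt_le_trans (grid_var_ub (pred1 i0)); apply: grid_var_gt0; exists i0 => /=.
have t0 : 0 <= t.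
  by rewrite divr_ge0 ?sqr_ge0// mulr_ge0 ?(ltW W0)// mulr_ge0.
have C_le j j' : A j -> A j' -> j.1 == i0 -> j'.1 != i0 -> `|grid_cov j j'| <=
    t * (block_cov grid_cov [pred j : J | j.1 == i0] v j *
         block_cov grid_cov [pred j : J | j.1 != i0] v j').
  move=> _ _ e e'; rewrite norm_cov.
  apply: le_trans (x_far _ _ _) _; first by rewrite (eqP e) eq_sym.
  have q0 : 0 <= delta / 2 / Num.sqrt ((k * m)%:R ^+ 2 * K 0).
    by rewrite divr_ge0 ?sqrtr_ge0// divr_ge0// ltW.
  have := ler_pM q0 q0 (c1 _ e) (c2 _ e').
  move=> /(ler_wpM2l t0); apply: le_trans.
  rewrite -expr2 !exprMn !exprVn sqr_sqrtr ?(ltW W0)//.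
  rewrite le_eqVlt; apply/orP; left; apply/eqP.
  by move: (_ * K 0) W0 => W W0; field; rewrite !gt_eqF.
apply/andP; split.
- exact: (two_blocks_lb gaussian_grid_proc grid_cov_sym v1 v2 t0 t_le C_le p0 pp1 pp2).
- exact: (two_blocks_ub gaussian_grid_proc grid_cov_sym v1 v2 t0 t_le C_le p0 pp1 pp2).
Qed.

(** Induction on the number [q] of groups. Since [e <= 1/2], each splitting loses at most a factor
    2, so every probability met on the way is at least [(ps / 2)^k]. This common lower bound keeps
    the same [e] at every step. *)
Lemma grid_product (u : J -> R) (ps : R) :
  let p i := fine (P (orthant [pred j : J | j.1 == i] u grid_proc)) in
  let e := t * (4 + 8 * ln ((ps / 2) ^+ k)^-1) in
  0 < ps -> (forall i, ps <= p i) -> e <= 2^-1 ->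
  expR (- (k%:R * e)) * \prod_i p i <=
    fine (P (orthant predT u grid_proc)) <= expR (k%:R * e) * \prod_i p i.
Proof.
move=> p e ps0 psp e2.
have mX j : measurable_fun setT (grid_proc j) by have [] := gaussian_grid_proc.
have p1 i : p i <= 1.
  rewrite -lee_fin /p fineK ?fin_num_measure//; last exact: measurable_orthant.
  by apply: probability_le1; exact: measurable_orthant.
have p0 i : 0 <= p i by rewrite (le_trans (ltW ps0)).
have psh : 0 < ps / 2 by rewrite divr_gt0.
have ps1 : ps / 2 <= 1.
  by have := le_trans (psp (Ordinal (ltnW k2))) (p1 _); lra.
have eh : 2^-1 <= expR (- e).
  by apply: le_trans (expR_ge1Dx _); lra.
have B1 (q : nat) : (q <= k)%N ->
    expR (- (q%:R * e)) * \prod_(i < k | (i < q)%N) p i <=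
      fine (P (orthant [pred j : J | (j.1 < q)%N] u grid_proc)) <=
    expR (q%:R * e) * \prod_(i < k | (i < q)%N) p i.
  elim: q => [_|q IH qk].
    rewrite !mul0r oppr0 expR0 !mul1r big_pred0//.
    have -> : orthant [pred j : J | (j.1 < 0)%N] u grid_proc = setT.
      by apply/seteqP; split=> // w _ j.
    by have -> : P [set: T] = 1%E; [rewrite probability_setT|rewrite lexx].
  have /andP[l1 l2] := IH (ltnW qk).
  pose i0 := Ordinal qk.
  have O1 : orthant [pred j : J | (j.1 < q.+1)%N && (j.1 == i0)] u grid_proc =
      orthant [pred j : J | j.1 == i0] u grid_proc.
    by apply: eq_orthant => j /=; apply: andb_idl => /eqP ->.
  have O2 : orthant [pred j : J | (j.1 < q.+1)%N && (j.1 != i0)] u grid_proc =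
      orthant [pred j : J | (j.1 < q)%N] u grid_proc.
    apply: eq_orthant => j /=; rewrite ltnS [in RHS]ltn_neqAle andbC; congr andb.
  have PE : \prod_(i < k | (i < q.+1)%N) p i = p i0 * \prod_(i < k | (i < q)%N) p i.
    rewrite (bigD1 i0)//=; congr (_ * _); apply: eq_bigl => i.
    by rewrite ltnS [in RHS]ltn_neqAle andbC.
  have pr0 : 0 <= \prod_(i < k | (i < q)%N) p i by exact: prodr_ge0.
  have prl : ps ^+ k <= \prod_(i < k | (i < q)%N) p i.
    apply: le_trans (_ : \prod_(i < k) p i <= _).
      by rewrite -[X in _ ^+ X](card_ord k) -prodr_const; apply: ler_prod => i _; rewrite ltW//= psp.
    rewrite (bigID (fun i : 'I_k => (i < q)%N))/= -[leRHS]mulr1.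
    apply: ler_wpM2l => //; apply: prodr_ile1 => i _; rewrite p0//=.
  have pp1 : (ps / 2) ^+ k <= p i0.
    apply: le_trans (psp i0); apply: le_trans (_ : ps / 2 <= _); last by lra.
    rewrite -[leRHS]expr1; apply: ler_wiXn2l => //; [exact: ltW|exact: ltnW].
  have pp2 : (ps / 2) ^+ k <= fine (P (orthant [pred j : J | (j.1 < q)%N] u grid_proc)).
    apply: le_trans l1; rewrite exprMn mulrC; apply: ler_pM => //.
    - by rewrite exprn_ge0// ltW.
    rewrite -mulrN expRM_natl.
    apply: le_trans (_ : 2^-1 ^+ q <= _).
      by apply: ler_wiXn2l => //; [lra|exact: ltnW].
    by apply: lerXn2r => //; rewrite nnegrE ?expR_ge0.
  have := @grid_split i0 [pred j : J | (j.1 < q.+1)%N] u _ (exprn_gt0 k psh).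
  rewrite O1 O2 => /(_ pp1 pp2) /andP[h1 h2]; rewrite PE; apply/andP; split.
    apply: le_trans h1; rewrite -/e -/(p i0).
    rewrite -natr1 mulrDl mul1r opprD expRD.
    have := ler_wpM2l (mulr_ge0 (expR_ge0 (- e)) (p0 i0)) l1.
    by congr (_ <= _); ring.
  apply: le_trans h2 _; rewrite -/e -/(p i0).
  rewrite -natr1 mulrDl mul1r expRD.
  have := ler_wpM2l (mulr_ge0 (expR_ge0 e) (p0 i0)) l2.
  by congr (_ <= _); ring.
have := B1 k (leqnn k).
have -> : \prod_(i < k | (i < k)%N) p i = \prod_i p i.
  by apply: eq_bigl => i; rewrite ltn_ord.
by rewrite (@eq_orthant _ _ _ _ _ predT)// => j /=; rewrite ltn_ord.
Qed.

End grid.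

(** * From grids to intervals *)

Lemma eq_seq_lim {R : realType} (u v : nat -> R) (a b : R) :
  u n @[n --> \oo] --> a -> v n @[n --> \oo] --> b -> u =1 v -> a = b.
Proof.
by move=> ua vb /funext uv; rewrite uv in ua; exact: (cvg_unique (@Rhausdorff R) ua vb).
Qed.

Section real_measure_limits.
Context {R : realType} {d : measure_display} {T : measurableType d}.
Variable P : probability T R.

Lemma fine_probability_le (A B : set T) : measurable A -> measurable B ->
  A `<=` B -> fine (P A) <= fine (P B).
Proof.
move=> mA mB AB; apply: fine_le; rewrite ?fin_num_measure//.
by apply: le_measure => //; rewrite inE.
Qed.

Lemma fine_probability_cvg (F : (set T)^nat) (A : set T) :
  measurable A -> (P \o F) x @[x --> \oo] --> P A ->
  fine (P (F n)) @[n --> \oo] --> fine (P A).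
Proof.
move=> mA h; have : (P \o F) x @[x --> \oo] --> (fine (P A))%:E.
  by rewrite fineK ?fin_num_measure.
by move=> /fine_cvgP[].
Qed.

End real_measure_limits.

Section above.
Context {R : realType} {d : measure_display} {T : measurableType d}.
Variables (P : probability T R) (f : R -> {RV P >-> R}).

(** For a continuous path and points dense in a compact interval, this is positivity of [s * f] on
    the interval. The margin [1/(j + 1)] survives the passage from the points to their closure, and
    countability gives measurability. *)
Definition above (x : nat -> R) (s : R) : set T :=
  [set w | exists j : nat, forall l, j.+1%:R^-1 < s * f (x l) w].

Variables (k : nat) (x : 'I_k -> nat -> R) (sg : 'I_k -> R) (I : pred 'I_k).

Definition block_above (j : nat) : set T :=
  [set w | forall i, I i -> forall l, j.+1%:R^-1 < sg i * f (x i l) w].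

Local Notation O n j := (orthant [pred q : 'I_k * 'I_n | I q.1]
  (fun=> j.+1%:R^-1) (grid_proc f (fun i (l : 'I_n) => x i l) sg)).

Lemma measurable_grid_orthant n (A : pred ('I_k * 'I_n)) u :
  measurable (orthant A u (grid_proc f (fun i (l : 'I_n) => x i l) sg)).
Proof. by apply: measurable_orthant => q; exact: measurable_funM. Qed.

(** The offset makes every grid of the sequence contain the [m] points that define the
    projection. *)
Lemma block_aboveE m j : block_above j = \bigcap_n O (n + m)%N j.
Proof.
apply/seteqP; split=> [w h n _ [i l] /= Ii|w h i Ii l]; first exact: h.
have ll : (l < l.+1 + m)%N by rewrite addSn ltnS leq_addr.
exact: (h l.+1 Logic.I (i, Ordinal ll) Ii).
Qed.

Lemma measurable_block_above j : measurable (block_above j).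
Proof.
rewrite (block_aboveE 0); apply: bigcap_measurable; first by exists 0%N.
by move=> n _; exact: measurable_grid_orthant.
Qed.

Lemma grid_orthant_cvg m j :
  fine (P (O (n + m)%N j)) @[n --> \oo] --> fine (P (block_above j)).
Proof.
apply: fine_probability_cvg; first exact: measurable_block_above.
rewrite (block_aboveE m); apply: nonincreasing_cvg_mu.
- by apply: le_lt_trans (probability_le1 _ _) (ltry 1); exact: measurable_grid_orthant.
- by move=> n; exact: measurable_grid_orthant.
- by rewrite -block_aboveE; exact: measurable_block_above.
move=> n n' nn'; apply/subsetPset => w h [i l] Ii.
have ll : (l < n' + m)%N by apply: leq_trans (ltn_ord l) _; rewrite leq_add2r.
exact: (h (i, Ordinal ll) Ii).
Qed.

Lemma block_above_le_orthant n j : block_above j `<=` O n j.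
Proof. by move=> w h [i l] Ii; exact: h. Qed.

Lemma block_above_homo : {homo block_above : n m / (n <= m)%N >-> (n <= m)%O}.
Proof.
move=> j j' jj'; apply/subsetPset => w h i Ii l; apply: le_lt_trans (h i Ii l).
by rewrite lef_pV2 ?posrE// ler_nat.
Qed.

Lemma bigcup_block_above :
  \bigcup_j block_above j = [set w | forall i, I i -> above (x i) (sg i) w].
Proof.
apply/seteqP; split=> [w [j _ h] i Ii|w h]; first by exists j; exact: h.
have [jf jfP] : exists jf : 'I_k -> nat, forall i, I i ->
    forall l, (jf i).+1%:R^-1 < sg i * f (x i l) w.
  have /choice[jf h'] : forall i, exists j : nat, I i ->
      forall l, j.+1%:R^-1 < sg i * f (x i l) w.
    move=> i; have [Ii|nI] := boolP (I i); last by exists 0%N.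
    by have [j hj] := h i Ii; exists j.
  by exists jf.
exists (\max_i jf i)%N => // i Ii l; apply: le_lt_trans (jfP i Ii l).
by rewrite lef_pV2 ?posrE// ler_nat ltnS leq_bigmax.
Qed.

Lemma measurable_all_above :
  measurable [set w | forall i, I i -> above (x i) (sg i) w].
Proof.
rewrite -bigcup_block_above; apply: bigcup_measurable => j _.
exact: measurable_block_above.
Qed.

Lemma block_above_cvg : fine (P (block_above j)) @[j --> \oo] -->
  fine (P [set w | forall i, I i -> above (x i) (sg i) w]).
Proof.
apply: fine_probability_cvg; first exact: measurable_all_above.
rewrite -bigcup_block_above; apply: nondecreasing_cvg_mu.
- by move=> j; exact: measurable_block_above.
- by rewrite bigcup_block_above; exact: measurable_all_above.
exact: block_above_homo.
Qed.

End above.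

Section above_law.
Context {R : realType} {d : measure_display} {T : measurableType d}.
Variables (P : probability T R) (f : R -> {RV P >-> R}).
Hypothesis hf : SGP f.

Lemma measurable_above x s : measurable (above f x s).
Proof.
have := @measurable_all_above _ _ _ P f 1 (fun=> x) (fun=> s) predT.
by congr (measurable _); apply/seteqP; split=> w h; [exact: (h ord0)|].
Qed.

(** A translation or a change of sign does not alter the covariances on a finite grid; the equality
    passes through the limits in the grid and in the margin. *)
Lemma above_law (x : nat -> R) (s s' h : R) : s ^+ 2 = s' ^+ 2 ->
  fine (P (above f (fun l => x l + h) s)) = fine (P (above f x s')).
Proof.
move=> ss.
have E (y : nat -> R) (s1 : R) : above f y s1 =
    [set w | forall i : 'I_1, predT i -> above f y s1 w].
  by apply/seteqP; split=> w H; [|exact: (H ord0)].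
rewrite (E x s') (E (fun l => x l + h) s).
have C1 := @block_above_cvg _ _ _ P f 1 (fun=> fun l => x l + h) (fun=> s) predT.
have C2 := @block_above_cvg _ _ _ P f 1 (fun=> x) (fun=> s') predT.
apply: (eq_seq_lim C1 C2) => j.
have D1 := @grid_orthant_cvg _ _ _ P f 1 (fun=> fun l => x l + h) (fun=> s) predT 0 j.
have D2 := @grid_orthant_cvg _ _ _ P f 1 (fun=> x) (fun=> s') predT 0 j.
apply: (eq_seq_lim D1 D2) => n.
have g1 := process_gaussian_vector hf
  (fun q : 'I_1 * 'I_(n + 0) => x q.2 + h) (fun=> s).
have g2 := process_gaussian_vector hf
  (fun q : 'I_1 * 'I_(n + 0) => x q.2) (fun=> s').
apply: (gaussian_orthant_eq _ g1 g2) => -[i l] [i' l'] _ _ /=.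
by rewrite -!expr2 ss; congr (_ * covariance_kernel f _); ring.
Qed.

End above_law.

(** * Continuous paths and dense grids *)

Section continuous_paths.
Context {R : realType}.

Lemma above_continuous (g : R -> R) (a b : R) (x : nat -> R) :
  a <= b -> continuous g -> (forall l, x l \in `[a, b]) ->
  (forall t e, t \in `[a, b] -> 0 < e -> exists l, `|x l - t| < e) ->
  (exists j : nat, forall l, j.+1%:R^-1 < g (x l)) <-> (forall t, t \in `[a, b] -> 0 < g t).
Proof.
move=> ab cg xab xd; split=> [[j hj] t tab|h].
  rewrite ltNge; apply/negP => gt0.
  have j0 : 0 < j.+1%:R^-1 :> R by [].
  have := cg t; move=> /cvgrPdist_lt/(_ _ j0)[e /= e0 he].
  have [l xl] := xd t e tab e0.
  have := he (x l); rewrite /= distrC [X in _ -> X < _]distrC => /(_ xl) /ltr_normlW.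
  by have := hj l; move: (_^-1) (g t) gt0 => y z; lra.
have [c cab hc] := EVT_min ab (continuous_subspaceT cg).
exists (Num.truncn (g c)^-1) => l; apply: lt_le_trans (hc _ (xab l)).
have gc0 := h c cab.
rewrite invf_plt ?posrE//.
by have /andP[] := truncn_itv (ltW (etrans (invr_gt0 _) gc0)).
Qed.

Lemma no_zero_sign (g : R -> R) (a b : R) :
  a <= b -> continuous g ->
  (forall t, t \in `[a, b] -> g t != 0) <->
  (exists s : bool, forall t, t \in `[a, b] -> 0 < (-1) ^+ s * g t).
Proof.
move=> ab cg; split=> [h|[s h] t tab]; last first.
  by have := h t tab; apply: contraTneq => ->; rewrite mulr0 ltxx.
have aab : a \in `[a, b] by rewrite in_itv/= lexx ab.
exists (g a < 0) => t tab; have ta : a <= t by move: tab; rewrite in_itv => /andP[].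
have cw : {within `[a, t], continuous g} by exact: continuous_subspaceT.
have nz : ~ (Num.min (g a) (g t) <= 0 <= Num.max (g a) (g t)).
  move=> /(IVT ta cw)[c cat gc]; suff /h : c \in `[a, b] by rewrite gc eqxx.
  move: cat tab; rewrite !in_itv/= => /andP[ac ct] /andP[_ tb].
  by rewrite ac (le_trans ct tb).
have ga := h a aab; have gt := h t tab.
have [ga0|ga0] := ltP (g a) 0.
  rewrite expr1 mulN1r oppr_gt0 ltNge; apply/negP => gt0; apply: nz.
  by rewrite ge_min (ltW ga0) le_max gt0 orbT.
rewrite expr0 mul1r ltNge; apply/negP => gt0; apply: nz.
by rewrite ge_min gt0 le_max ga0 orbT.
Qed.

End continuous_paths.

Section grid_points.
Context {R : realType}.
Implicit Types (a b r t e : R) (m l : nat).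

(** A dense sequence in [[0, 1]]: an enumeration of the rationals clamped to the interval, with 0
    for the numbers that code no rational. *)
Definition unit_rat (l : nat) : R :=
  Num.max 0 (Num.min 1 (ratr (odflt 0 (unpickle l)))).

Lemma unit_rat_itv l : 0 <= unit_rat l <= 1.
Proof. by rewrite /unit_rat le_max lexx/= ge_max ler01 ge_min lexx. Qed.

Lemma unit_rat_dense t e : 0 <= t <= 1 -> 0 < e -> exists l, `|unit_rat l - t| < e.
Proof.
move=> /andP[t0 t1] e0.
have [q] : exists q : rat, (ratr q : R) \in `](t - e), (t + e)[.
  by apply: rat_in_itvoo; lra.
rewrite in_itv => /andP[q1 q2]; exists (pickle q).
rewrite /unit_rat pickleK/= ltr_distl; move: q1 q2; move: (ratr q) => y q1 q2.
rewrite lt_max lt_min gt_max gt_min.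
apply/andP; split; last by apply/andP; split; [lra|apply/orP; right].
by apply/orP; right; apply/andP; split; [lra|].
Qed.

(* The first [m] points, at unit steps, serve to build the variable onto which
   the process is projected; the others are dense in the interval. *)
Definition grid_points m a b l : R :=
  a + (if (l < m)%N then Num.min l%:R (b - a) else (b - a) * unit_rat (l - m)).

Lemma grid_points_shift m a b l : grid_points m a b l = grid_points m 0 (b - a) l + a.
Proof. by rewrite /grid_points add0r subr0 addrC. Qed.

Lemma grid_points_itv m a b l : a <= b -> grid_points m a b l \in `[a, b].
Proof.
move=> ab; rewrite in_itv/= /grid_points; have ab0 : 0 <= b - a by rewrite subr_ge0.
case: ifP => _.
  by rewrite lerDl le_min ler0n ab0/= -lerBrDl ge_min lexx orbT.
have /andP[q0 q1] := unit_rat_itv (l - m).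
by rewrite lerDl mulr_ge0//= -lerBrDl -[leRHS]mulr1 ler_wpM2l.
Qed.

Lemma grid_points_dense m a b t e : a <= b -> t \in `[a, b] -> 0 < e ->
  exists l, `|grid_points m a b l - t| < e.
Proof.
move=> ab; rewrite in_itv/= => /andP[ta tb] e0.
have [ba|ba] := eqVneq b a.
  exists 0%N; have /itvP h := grid_points_itv m 0 ab.
  rewrite ltr_distl; apply/andP; split.
    by apply: lt_le_trans (_ : a <= _); [rewrite ba in tb; lra|rewrite h].
  by apply: le_lt_trans (_ : b < _); [rewrite h|lra].
have ab0 : 0 < b - a by rewrite subr_gt0 lt_neqAle eq_sym ba.
have [|l hl] := @unit_rat_dense ((t - a) / (b - a)) (e / (b - a)) _ (divr_gt0 e0 ab0).
  by rewrite divr_ge0 ?subr_ge0//= ler_pdivrMr// mul1r lerB.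
exists (l + m)%N; rewrite /grid_points ltnNge leq_addl/= addnK.
have -> : a + (b - a) * unit_rat l - t = (unit_rat l - (t - a) / (b - a)) * (b - a).
  by field; rewrite gt_eqF.
by rewrite normrM [`|b - a|]gtr0_norm// -ltr_pdivlMr.
Qed.

Lemma grid_points_near m a b l : a <= b -> (Num.truncn (b - a) < m)%N ->
  exists2 l', (l' < m)%N & `|grid_points m a b l - grid_points m a b l'| <= 1.
Proof.
move=> ab bam; have /andP[h1 h2] : a <= grid_points m a b l <= b.
  by have := grid_points_itv m l ab; rewrite in_itv.
set y := grid_points m a b l in h1 h2 *.
have y0 : 0 <= y - a by rewrite subr_ge0.
have lm : (Num.truncn (y - a) < m)%N.
  by apply: leq_ltn_trans bam; apply: le_truncn; rewrite lerB.
(* The unit-step point just below [y]; it does not exceed [b], so the cap by [b - a] is inactive. *)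
exists (Num.truncn (y - a)) => //; rewrite {1}/grid_points lm.
have /andP[k1 k2] := truncn_itv y0.
rewrite min_l; last by rewrite (le_trans k1)// lerB.
by move: k2; rewrite -natr1 ler_norml; move: (_%:R) k1 => z k1 k2; apply/andP; split; lra.
Qed.

End grid_points.

(** * Outer probability and decomposition by signs *)

Section outer_probability.
Context {R : realType} {d : measure_display} {T : measurableType d}.
Variable P : probability T R.

Lemma mu_ext_fin_num (A : set T) : mu_ext P A \is a fin_num.
Proof.
rewrite ge0_fin_numE; last exact: outer_measure_ge0.
apply: le_lt_trans (le_mu_ext P (@subsetT _ A)) _.
rewrite measurable_mu_extE//.
exact: le_lt_trans (probability_le1 P measurableT) (ltry 1).
Qed.

Lemma prob_measurable (A : set T) : measurable A -> prob P A = fine (P A).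
Proof. by move=> mA; rewrite /prob measurable_mu_extE. Qed.

Lemma prob_le (A B : set T) : A `<=` B -> prob P A <= prob P B.
Proof. by move=> AB; apply: fine_le (le_mu_ext P AB); exact: mu_ext_fin_num. Qed.

(** Subadditivity of the outer measure absorbs the null set. Through this, [no_zero] is replaced by
    measurable events. *)
Lemma prob_ae_eq (A B : set T) : {ae P, forall w, A w <-> B w} -> prob P A = prob P B.
Proof.
move=> [N [mN N0 hN]].
suff H C D : (forall w, ~ N w -> (C w <-> D w)) -> prob P C <= prob P D.
  have h w : ~ N w -> (A w <-> B w) by apply: contra_notP => /hN.
  by apply/eqP; rewrite eq_le !H// => w /h [].
move=> h; apply: fine_le; rewrite ?mu_ext_fin_num//.
apply: le_trans (_ : mu_ext P (D `|` N) <= _)%E.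
  apply: le_mu_ext => w Cw; have [Nw|nN] := pselect (N w); first by right.
  by left; apply/h.
apply: le_trans (outer_measureU2 _ _ _) _.
by rewrite [X in (_ + X)%E](measurable_mu_extE P mN) [X in (_ + X)%E]N0 adde0.
Qed.

Lemma fine_probability_sum (J : finType) (F : J -> set T) :
  (forall i, measurable (F i)) -> (forall i j w, F i w -> F j w -> i = j) ->
  fine (P [set w | exists i, F i w]) = \sum_i fine (P (F i)).
Proof.
move=> mF dF.
have -> : [set w | exists i, F i w] = \bigcup_(i in [set` index_enum J]) F i.
  apply/seteqP; split=> w [i]; first by exists i => //=; exact: mem_index_enum.
  by move=> _ Fi; exists i.
rewrite measure_fin_bigcup//.
- rewrite -fsbig_seq ?index_enum_uniq// sum_fine// => i _.
  by rewrite fin_num_measure.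
- by apply/trivIsetP => i j _ _ /eqP ij; apply/seteqP; split=> // w [Fi /(dF _ _ _ Fi)].
Qed.

End outer_probability.

Section no_zero.
Context {R : realType} {d : measure_display} {T : measurableType d}.
Variables (P : probability T R) (f : R -> {RV P >-> R}).
Hypothesis hf : SGP f.
Hypothesis hC2 : C2_smooth f.

Lemma ae_continuous : {ae P, forall w, continuous (fun t => f t w)}.
Proof.
move: hC2; apply: filterS => w [df _ _] t.
by apply: differentiable_continuous; apply/derivable1_diffP.
Qed.

Definition sign (s : bool) : R := (-1) ^+ s.

Lemma ae_above m a b s : a <= b -> {ae P, forall w, above f (grid_points m a b) s w <->
  forall t, t \in `[a, b] -> 0 < s * f t w}.
Proof.
move=> ab; move: ae_continuous; apply: filterS => w cw.
apply: (@above_continuous _ (fun t => s * f t w) a b _ ab) => [t|l|t e tab e0].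
- by apply: cvgM; [exact: cvg_cst|exact: cw].
- exact: grid_points_itv.
- exact: grid_points_dense.
Qed.

Variables (k m : nat) (a b : 'I_k -> R).
Hypothesis ab : forall i, a i <= b i.
Local Notation x i := (grid_points m (a i) (b i)).

Lemma above_sign_inj (y : nat -> R) (s s' : bool) w :
  above f y (sign s) w -> above f y (sign s') w -> s = s'.
Proof.
move=> [j /(_ 0%N) h] [j' /(_ 0%N) h'].
have {}h : 0 < sign s * f (y 0%N) w by apply: le_lt_trans h.
have {}h' : 0 < sign s' * f (y 0%N) w by apply: le_lt_trans h'.
by move: h h'; rewrite /sign; case: s; case: s' => //; rewrite !(expr1, expr0); lra.
Qed.

(** Up to a null set, absence of zeros is the disjoint union of two sign events, equally likely by
    symmetry. *)
Lemma prob_no_zero i : prob P (no_zero f `[a i, b i]) =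
  2 * fine (P (above f (x i) 1)).
Proof.
rewrite (@prob_ae_eq _ _ _ _ _
  [set w | exists s : bool, above f (x i) (sign s) w]); last first.
  move: ae_continuous (ae_above m (sign true) (ab i)) (ae_above m (sign false) (ab i)).
  apply: filterS3 => w cw at_ af.
  have h : no_zero f `[a i, b i] w <-> _ := no_zero_sign (ab i) cw.
  split; first by move=> /h[s hs]; exists s; case: s hs => hs; [apply/at_|apply/af].
  by move=> [s hs]; apply/h; exists s; case: s hs => hs; [apply/at_|apply/af].
have mA s : measurable (above f (x i) (sign s)) by exact: measurable_above.
rewrite prob_measurable; last first.
  have -> : [set w | exists s : bool, above f (x i) (sign s) w] =
      above f (x i) (sign true) `|` above f (x i) (sign false).
    apply/seteqP; split=> w; first by case=> -[] h; [left|right].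
    by case=> h; [exists true|exists false].
  exact: measurableU.
rewrite fine_probability_sum//; last by move=> s s' w; exact: above_sign_inj.
have e s : fine (P (above f (x i) (sign s))) = fine (P (above f (x i) 1)).
  rewrite -[RHS](@above_law _ _ _ _ _ hf (x i) (sign s) 1 0); last first.
    by rewrite /sign sqrr_sign expr1n.
  by congr (fine (P (above f _ _))); apply/funext => l; rewrite addr0.
by rewrite big_bool/= !e; ring.
Qed.

(** One sign per interval; different patterns may have different probabilities, so the sum over
    patterns is kept. *)
Lemma prob_bigcap_no_zero :
  prob P (\bigcap_(i in [set: 'I_k]) no_zero f `[a i, b i]) =
  \sum_(s : {ffun 'I_k -> bool})
    fine (P [set w | forall i, predT i -> above f (x i) (sign (s i)) w]).
Proof.
have mA s : measurable [set w | forall i, predT i -> above f (x i) (sign (s i)) w].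
  exact: measurable_all_above.
rewrite -fine_probability_sum//; last first.
  move=> s s' w h h'; apply/ffunP => i.
  exact: above_sign_inj (h i isT) (h' i isT).
rewrite (@prob_ae_eq _ _ _ _ _ [set w | exists s : {ffun 'I_k -> bool},
    forall i, predT i -> above f (x i) (sign (s i)) w]).
  rewrite prob_measurable//.
  rewrite (_ : [set w | _] = \bigcup_(s in [set: {ffun 'I_k -> bool}])
      [set w | forall i, predT i -> above f (x i) (sign (s i)) w]).
    by apply: fin_bigcup_measurable => //; exact: finite_finset.
  by apply/seteqP; split=> w [s]; exists s.
have h : {ae P, forall w, forall q : 'I_k * bool,
    above f (x q.1) (sign q.2) w <->
    forall t, t \in `[a q.1, b q.1] -> 0 < sign q.2 * f t w}.
  apply: filter_forall => q; exact: ae_above.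
move: ae_continuous h; apply: filterS2 => w cw h.
have hz i : no_zero f `[a i, b i] w <-> _ := no_zero_sign (ab i) cw.
split=> [H|[s hs] i _]; last first.
  by apply/hz; exists (s i); apply/(h (i, s i)); exact: hs.
have /choice[s hs] : forall i, exists s : bool, above f (x i) (sign s) w.
  by move=> i; have /hz[s /(h (i, s))] := H i Logic.I; exists s.
by exists (finfun s) => i _; rewrite ffunE.
Qed.

End no_zero.

(** * Persistence probabilities *)

Section normal_tail.
Context {R : realType}.

Definition normal_tail (c : R) : R := fine (normal_prob (0 : R) 1 `]c, +oo[).

Lemma normal_tail_gt0 c : 0 < normal_tail c.
Proof.
pose a : R := `|c| + 1; pose A : set R := `[a, a + 1]%classic.
have a0 : 0 < a by rewrite /a ltr_wpDl.
have mA : measurable A by exact: measurable_itv.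
have Ac : A `<=` `]c, +oo[%classic.
  move=> y; rewrite /A /= !in_itv/= andbT => /andP[+ _]; apply: lt_le_trans.
  by rewrite /a (le_lt_trans (ler_norm c))// ltrDl.
pose q := normal_pdf 0 1 (a + 1).
have q0 : 0 < q.
  by rewrite /q normal_pdfE// mulr_gt0 ?expR_gt0// normal_peak_gt0.
apply: lt_le_trans (q0) _; rewrite -lee_fin /normal_tail fineK ?fin_num_measure//.
apply: (@le_trans _ _ (normal_prob 0 1 A)); last by apply: le_measure; rewrite ?inE.
rewrite /normal_prob.
apply: (@le_trans _ _ (\int[lebesgue_measure]_(x in A) (cst q%:E x))%E).
  have -> : (\int[lebesgue_measure]_(x in A) (cst q%:E x) = q%:E * lebesgue_measure A)%E.
    exact: integral_cst.
  rewrite lebesgue_measure_itv/= lte_fin ltrDl ltr01 -EFinB.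
  by rewrite [a + 1]addrC addrK mule1.
apply: ge0_le_integral => //=.
- by move=> x _; rewrite lee_fin ltW.
- by apply/measurable_EFinP; apply: measurable_funTS; exact: measurable_normal_pdf.
move=> x; rewrite /A/= in_itv/= => /andP[ax xa].
rewrite lee_fin /q !normal_pdfE// ler_wpM2l ?normal_peak_ge0// /normal_fun ler_expR.
have x0 : 0 <= x by apply: le_trans ax; exact: ltW.
by rewrite !subr0 ler_wpM2r// ?lerN2 ?lerXn2r ?nnegrE// addr_ge0// ltW.
Qed.

Lemma normal_tail_small (e : R) : 0 < e -> exists c, normal_tail c <= e.
Proof.
move=> e0; pose F (n : nat) : set R := `]n%:R, +oo[%classic.
have F0 : \bigcap_n F n = set0.
  rewrite -subset0 => x h; have := h (Num.truncn x).+1 Logic.I.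
  by rewrite /F/= in_itv/= andbT; apply/negP; rewrite -leNgt ltW// truncnS_gt.
have mF n : measurable (F n) by exact: measurable_itv.
have : (normal_prob (0 : R) 1 \o F) x @[x --> \oo] --> normal_prob (0 : R) 1 (\bigcap_n F n).
  apply: nonincreasing_cvg_mu => //.
  - rewrite ltey_eq; apply/orP; left; apply: fin_num_measure; exact: mF.
  - by rewrite F0.
  - move=> n m nm; apply/subsetPset => x; rewrite /F/= !in_itv/= !andbT.
    by apply: le_lt_trans; rewrite ler_nat.
move=> /(fine_probability_cvg _); rewrite F0 => /(_ measurable0).
rewrite measure0 => /cvgrPdist_le/(_ e e0)[N _ /(_ N (leqnn N))/=].
rewrite sub0r normrN => h; exists N%:R; apply: le_trans h; exact: ler_norm.
Qed.

End normal_tail.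

Section orthant_positivity.
Context {R : realType} {d : measure_display} {T : measurableType d}.
Context {P : probability T R} {J : finType}.
Variables (X : J -> T -> R) (C : J -> J -> R) (B : pred J) (v : J -> R).
Hypothesis gX : gaussian_vector P X (quad C).
Hypothesis Csym : forall i j, C i j = C j i.
Hypothesis v1 : quad C (mask B v) = 1.
Variables (h0 r u0 u1 : R).
Hypothesis h0_gt0 : 0 < h0.
Hypothesis cov_lb : forall i, B i -> h0 <= block_cov C B v i.
Hypothesis tail_r : normal_tail r <= 4^-1.
Hypothesis u0_le : u0 <= u1.
Local Notation O u := (orthant B (fun=> u) X).
Hypothesis O_half : 2^-1 <= fine (P (O u0)).

Let bp u := @block_prob R d T P J X C B v predT (fun=> u).

Let mrest x i : measurable_fun setT (fun w => block_cov C B v i * x + block_rest X C B v i w).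
Proof.
by apply: measurable_funD => //; have [] := gaussian_block_rest gX Csym v1.
Qed.

Let bp_le u u' x x' : (forall i, B i -> u' - u <= h0 * (x' - x)) -> x <= x' ->
  bp u x <= bp u' x'.
Proof.
move=> h xx'; apply: fine_probability_le; [exact: measurable_orthant..|].
move=> w H i Bi; have := H i Bi; have := h i Bi.
have := ler_wpM2r (_ : 0 <= x' - x) (cov_lb Bi); rewrite subr_ge0 => /(_ xx').
by move: (block_cov _ _ _ _) (block_rest _ _ _ _ _ _) => y z; lra.
Qed.

Let ibp u : (normal_prob (0 : R) 1).-integrable setT (EFin \o bp u).
Proof.
apply: (@bounded_integrable _ _ _ _ 1); first exact: (measurable_block_prob gX Csym v1).
by move=> x; have /andP[h1 h2] := block_prob_itv gX Csym v1 predT (fun=> u) x; rewrite ger0_norm.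
Qed.

Let Ebp u : \int[normal_prob (0 : R) 1]_x bp u x = fine (P (O u)).
Proof. by rewrite (Rintegral_block_prob gX Csym v1). Qed.

Let itail c : (normal_prob (0 : R) 1).-integrable setT
  (EFin \o (\1_(`]c, +oo[%classic : set R) : R -> R)).
Proof.
apply: (@bounded_integrable _ _ _ _ 1) => [|x]; first exact: measurable_indic.
by rewrite indicE; case: (_ \in _); rewrite ?normr1 ?normr0.
Qed.

(** The conditional probability [bp u0] increases with the projection, so it is at least [1/4] at
    [r]: otherwise the event at [u0] could not reach [1/2]. Raising the projection by
    [(u1 - u0) / h0] lifts every coordinate of the block by at least [u1 - u0]. *)
Lemma orthant_lb : 4^-1 * normal_tail (r + (u1 - u0) / h0) <= fine (P (O u1)).
Proof.
have h4 : 4^-1 <= bp u0 r.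
  suff : fine (P (O u0)) <= bp u0 r + normal_tail r by move: O_half tail_r; lra.
  rewrite -Ebp -[X in X + _](Rintegral_probability_cst (normal_prob (0 : R) 1)).
  rewrite /normal_tail -Rintegral_indic_probability//.
  have ic : (normal_prob (0 : R) 1).-integrable setT (EFin \o (fun=> bp u0 r)).
    exact: (@bounded_integrable _ _ _ _ `|bp u0 r|).
  rewrite -RintegralD//; apply: le_Rintegral => //.
    exact: (integrableD measurableT ic (itail r)).
  move=> x _; rewrite indicE/= mem_setE in_itv/= andbT.
  have /andP[b0 b1] := block_prob_itv gX Csym v1 predT (fun=> u0) r.
  have /andP[_ b2] := block_prob_itv gX Csym v1 predT (fun=> u0) x.
  have [rx|xr] := ltP r x; first by rewrite (le_trans b2)// lerDr.
  rewrite addr0; apply: bp_le => // i _.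
  by rewrite subrr mulr_ge0 ?subr_ge0// ltW.
rewrite -Ebp /normal_tail -Rintegral_indic_probability//.
rewrite -RintegralZl//; apply: le_Rintegral => //.
  exact: (integrableZl measurableT 4^-1 (itail _)).
move=> x _; rewrite indicE/= mem_setE in_itv/= andbT.
have /andP[b0 _] := block_prob_itv gX Csym v1 predT (fun=> u1) x.
have [rx|_] := ltP; last by rewrite mulr0.
rewrite mulr1; apply: le_trans h4 _.
have q0 : 0 <= (u1 - u0) / h0 by rewrite divr_ge0 ?subr_ge0// ltW.
apply: bp_le => [i _|]; last by move: rx q0; move: (_ / _) => z; lra.
rewrite mulrC -ler_pdivrMr//; move: rx q0; move: (_ / _) => z; lra.
Qed.

End orthant_positivity.

Section positivity.
Context {R : realType} {d : measure_display} {T : measurableType d}.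
Variables (P : probability T R) (f : R -> {RV P >-> R}).
Hypothesis hf : SGP f.
Local Notation K := (covariance_kernel f).
Hypothesis Kpos : forall x, 0 < K x.

Lemma measurable_grid_gt (x : nat -> R) (u : R) :
  measurable [set w | forall l, u < f (x l) w].
Proof.
rewrite (_ : [set w | _] = \bigcap_l ((f (x l)) @^-1` `]u, +oo[)).
  apply: bigcap_measurable; first by exists 0%N.
  move=> l _; rewrite -[X in measurable X]setTI.
  by apply: (measurable_funP (f (x l))) => //; exact: measurable_itv.
apply/seteqP; split=> w h l; first by move=> _; rewrite /preimage/= in_itv/= h.
by have := h l Logic.I; rewrite /preimage/= in_itv/= andbT.
Qed.

Lemma paths_bounded_below m a b : C2_smooth f -> a <= b ->
  exists2 M, 0 <= M & 2^-1 <= fine (P [set w | forall l, - M < f (grid_points m a b l) w]).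
Proof.
move=> hC2 ab; set x := grid_points m a b.
pose F (n : nat) := [set w | forall l, - n%:R < f (x l) w].
have mF n : measurable (F n) by exact: measurable_grid_gt.
have mU : measurable (\bigcup_n F n) by exact: bigcup_measurable.
have PU : P (\bigcup_n F n) = 1%E.
  have N0 : P.-negligible (~` (\bigcup_n F n)).
    have : {ae P, forall w, (\bigcup_n F n) w}.
      move: (ae_continuous hC2); apply: filterS => w cw.
      have [c cab hc] := EVT_min ab (continuous_subspaceT cw).
      exists (Num.truncn `|f c w|).+1 => // l.
      apply: lt_le_trans (hc _ (grid_points_itv m l ab)).
      by rewrite ltrNl; apply: le_lt_trans (truncnS_gt _); rewrite -normrN ler_norm.
    by [].
  have := probability_setC P (measurableC mU); rewrite setCK => ->.
  by rewrite (measure_negligible (measurableC mU) N0) sube0.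
have /fine_probability_cvg : (P \o F) n @[n --> \oo] --> P (\bigcup_n F n).
  apply: nondecreasing_cvg_mu => //.
  move=> n n' nn'; apply/subsetPset => w h l; apply: le_lt_trans (h l).
  by rewrite lerN2 ler_nat.
move=> /(_ mU); rewrite PU => /cvgrPdist_le/(_ 2^-1 (ltac:(by rewrite invr_gt0)))[N _].
move=> /(_ N (leqnn N))/= h; exists N%:R => //.
by have := le_trans (ler_norm _) h; move: (fine (P (F N))) => z; lra.
Qed.

(** The bound of [orthant_lb], for thresholds [- M] and 1, depends on the [m] points of the
    projection but not on the grid, so it persists in the limit. The margin index 0 means the
    threshold 1. *)
Lemma block_above_gt0 (x : nat -> R) (m : nat) (delta M : R) :
  0 < delta -> (forall l, exists2 l', (l' < m)%N & delta <= K (x l - x l')) ->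
  0 <= M -> 2^-1 <= fine (P [set w | forall l, - M < f (x l) w]) ->
  0 < fine (P (block_above f (fun _ : 'I_1 => x) (fun=> 1) predT 0)).
Proof.
move=> delta0 near M0 half.
have m0 : (0 < m)%N by have [l' lm _] := near 0%N; exact: leq_trans lm.
have [r rP] := @normal_tail_small R 4^-1 (ltac:(by rewrite invr_gt0)).
pose h0 := delta / 2 / Num.sqrt ((1 * m)%:R ^+ 2 * K 0).
have h00 : 0 < h0.
  rewrite /h0 divr_gt0 ?divr_gt0// sqrtr_gt0 mulr_gt0// exprn_gt0// ltr0n.
  by rewrite mul1n.
apply: lt_le_trans (_ : 4^-1 * normal_tail (r + (1 - - M) / h0) <= _).
  by rewrite mulr_gt0 ?invr_gt0// normal_tail_gt0.
have C1 := @grid_orthant_cvg _ _ _ P f 1 (fun=> x) (fun=> 1) predT m 0.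
apply: (ler_cvg_to (cvg_cst _) C1); apply: nearW => n.
pose X' := fun (i : 'I_1) (l : 'I_(n + m)) => x l.
pose s1 := fun i : 'I_1 => 1 : R.
pose v (j : 'I_1 * 'I_(n + m)) := (Num.sqrt (grid_var f m X' s1 predT))^-1 *
  grid_weight m j : R.
have near' (i : 'I_1) (l : 'I_(n + m)) :
    exists2 l' : 'I_(n + m), (l' < m)%N & delta <= K (X' i l - X' i l').
  have [l' lm hl] := near l.
  have ll : (l' < n + m)%N by apply: leq_trans lm _; rewrite leq_addl.
  by exists (Ordinal ll).
(* With a single group there are no cross covariances, which allows [kappa = 0]. *)
have far (i i' : 'I_1) (l l' : 'I_(n + m)) : i != i' -> K (X' i l - X' i' l') <= 0.
  by rewrite !ord1 eqxx.
have small : (1 * m)%:R * 0 <= delta / 2 by rewrite mulr0 divr_ge0// ltW.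
have s12 i : s1 i ^+ 2 = 1 by rewrite /s1 expr1n.
have nm0 : (0 < n + m)%N by rewrite addn_gt0 m0 orbT.
have [v1 c1] := grid_normalized hf Kpos s12 delta0 near' (lexx 0) far small nm0
  (ex_intro _ ord0 (isT : predT ord0)) (fun j _ => erefl (v j)).
have M1 : - M <= 1 by apply: le_trans (_ : 0 <= _); rewrite ?oppr_le0.
have E : (fun _ : 'I_1 * 'I_(n + m) => 1%:R^-1) = (fun=> 1 : R).
  by apply/funext => q; rewrite invr1.
rewrite E; apply: (orthant_lb (gaussian_grid_proc hf X' s1) (grid_cov_sym hf X' s1)
  v1 h00 c1 rP M1).
apply: le_trans half _; apply: fine_probability_le.
- exact: measurable_grid_gt.
- exact: (@measurable_grid_orthant _ _ _ P f 1 (fun=> x) s1).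
by move=> w h [i l] _ /=; rewrite /grid_proc/= /s1 mul1r; exact: h.
Qed.

End positivity.

Lemma cvg_cst_prodr {R : realType} {I : Type} (c : R) (s : seq I) (F : I -> nat -> R)
    (l : I -> R) : (forall i, F i n @[n --> \oo] --> l i) ->
  c * \prod_(i <- s) F i n @[n --> \oo] --> c * \prod_(i <- s) l i.
Proof.
move=> Fl; apply: cvgM; first exact: cvg_cst.
elim: s => [|i s IH].
  by rewrite big_nil; under eq_fun do rewrite big_nil; exact: cvg_cst.
by rewrite big_cons; under eq_fun do rewrite big_cons; exact: cvgM.
Qed.

(** * Limits over grids and margins for a fixed sign pattern *)

Section sign_patterns.
Context {R : realType} {d : measure_display} {T : measurableType d}.
Variables (P : probability T R) (f : R -> {RV P >-> R}).
Hypothesis hf : SGP f.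
Local Notation K := (covariance_kernel f).
Hypothesis Kpos : forall x, 0 < K x.
Variable delta : R.
Hypothesis delta0 : 0 < delta.
Hypothesis K_near : forall x, `|x| <= 1 -> delta <= K x.

Lemma grid_points_cov m a b l : a <= b -> (Num.truncn (b - a) < m)%N ->
  exists2 l', (l' < m)%N & delta <= K (grid_points m a b l - grid_points m a b l').
Proof.
by move=> ab bam; have [l' lm /K_near h] := grid_points_near l ab bam; exists l'.
Qed.

Lemma above_sign_law (x : nat -> R) (s : bool) :
  fine (P (above f x (sign s))) = fine (P (above f x 1)).
Proof.
rewrite -(@above_law _ _ _ _ _ hf x (sign s) 1 0).
  by congr (fine (P (above f _ _))); apply/funext => l; rewrite addr0.
by rewrite /sign sqrr_sign expr1n.
Qed.

Variables (k m : nat) (a b : 'I_k -> R) (kappa ps : R).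
Hypothesis k2 : (2 <= k)%N.
Hypothesis ab : forall i, a i <= b i.
Hypothesis bam : forall i, (Num.truncn (b i - a i) < m)%N.
Local Notation x i := (grid_points m (a i) (b i)).
Hypothesis kappa0 : 0 <= kappa.
Hypothesis x_far : forall i i' l l', i != i' -> K (x i l - x i' l') <= kappa.
Hypothesis small : (k * m)%:R * kappa <= delta / 2.
Local Notation t := (4 * kappa * ((k * m)%:R ^+ 2 * K 0) / delta ^+ 2).
Hypothesis t_le : t <= 2^-1.
Local Notation e := (t * (4 + 8 * ln ((ps / 2) ^+ k)^-1)).
Hypothesis e_le : e <= 2^-1.
Hypothesis ps0 : 0 < ps.
Hypothesis ps_lt : forall i, ps < fine (P (above f (x i) 1)).

(** Both limits are taken in [grid_product], the grid first. The strictness of [ps_lt] ensures that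
    [ps] still bounds the probabilities with margin [1/(j + 1)] for large [j]. *)
Lemma sign_pattern_bounds (s : 'I_k -> bool) :
  expR (- (k%:R * e)) * \prod_i fine (P (above f (x i) 1)) <=
  fine (P [set w | forall i, predT i -> above f (x i) (sign (s i)) w]) <=
  expR (k%:R * e) * \prod_i fine (P (above f (x i) 1)).
Proof.
pose sg i : R := sign (s i); pose xx i := x i.
have C i : fine (P (block_above f xx sg (pred1 i) j)) @[j --> \oo] -->
    fine (P (above f (x i) 1)).
  rewrite -(above_sign_law (x i) (s i)).
  have := @block_above_cvg _ _ _ P f k xx sg (pred1 i).
  suff -> : [set w | forall i', pred1 i i' -> above f (xx i') (sg i') w] =
    above f (x i) (sign (s i)) by [].
  by apply/seteqP; split=> w h; [exact: (h i (eqxx i))|move=> i' /eqP ->].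
have Call := @block_above_cvg _ _ _ P f k xx sg predT.
have near_ps : \forall j \near \oo, forall i,
    ps <= fine (P (block_above f xx sg (pred1 i) j)).
  apply: filter_forall => i; exact: (cvgr_ge _ (C i) _ (ps_lt i)).
have bounds j : (forall i, ps <= fine (P (block_above f xx sg (pred1 i) j))) ->
    expR (- (k%:R * e)) * \prod_i fine (P (block_above f xx sg (pred1 i) j)) <=
    fine (P (block_above f xx sg predT j)) <=
    expR (k%:R * e) * \prod_i fine (P (block_above f xx sg (pred1 i) j)).
  move=> psj.
  have m0 : (0 < m)%N by apply: leq_ltn_trans (bam (Ordinal (ltnW k2))).
  have G n := @grid_product _ _ _ P f hf Kpos k (n + m) m
    (fun i (l : 'I_(n + m)) => xx i l) sg delta kappa.
  have sg2 i : sg i ^+ 2 = 1 by rewrite /sg /sign sqrr_sign.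
  have near' n (i : 'I_k) (l : 'I_(n + m)) :
      exists2 l' : 'I_(n + m), (l' < m)%N & delta <= K (xx i l - xx i l').
    have [l' lm hl] := grid_points_cov l (ab i) (bam i).
    have ll : (l' < n + m)%N by apply: leq_trans lm _; rewrite leq_addl.
    by exists (Ordinal ll).
  have far n (i i' : 'I_k) (l l' : 'I_(n + m)) : i != i' -> K (xx i l - xx i' l') <= kappa.
    exact: x_far.
  have nm0 n : (0 < n + m)%N by rewrite addn_gt0 m0 orbT.
  pose u n (q : 'I_k * 'I_(n + m)) : R := j.+1%:R^-1.
  have psn n i : ps <= fine (P (orthant [pred q : 'I_k * 'I_(n + m) | q.1 == i]
      (u n) (grid_proc f (fun i (l : 'I_(n + m)) => xx i l) sg))).
    apply: le_trans (psj i) _; apply: fine_probability_le.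
    - exact: measurable_block_above.
    - exact: (@measurable_grid_orthant _ _ _ P f k xx sg).
    - exact: (@block_above_le_orthant _ _ _ P f k xx sg (pred1 i) (n + m) j).
  have {}G n := G n sg2 delta0 (near' n) kappa0 (far n) small k2 (nm0 n) t_le
    (u n) ps ps0 (psn n) e_le.
  have D := @grid_orthant_cvg _ _ _ P f k xx sg predT m j.
  have Di i := @grid_orthant_cvg _ _ _ P f k xx sg (pred1 i) m j.
  have Dp c := @cvg_cst_prodr R 'I_k c (index_enum 'I_k) _ _ Di.
  apply/andP; split.
    apply: (ler_cvg_to (Dp _) D); apply: nearW => n.
    by have /andP[] := G n.
  apply: (ler_cvg_to D (Dp _)); apply: nearW => n.
  by have /andP[] := G n.
have Cp c := @cvg_cst_prodr R 'I_k c (index_enum 'I_k) _ _ C.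
apply/andP; split.
  apply: (ler_cvg_to (Cp _) Call).
  by apply: filterS near_ps => j /bounds /andP[].
apply: (ler_cvg_to Call (Cp _)).
by apply: filterS near_ps => j /bounds /andP[].
Qed.

End sign_patterns.

Section persistence.
Context {R : realType} {d : measure_display} {T : measurableType d}.
Variables (P : probability T R) (f : R -> {RV P >-> R}).
Hypothesis hf : SGP f.
Hypothesis hC2 : C2_smooth f.
Local Notation K := (covariance_kernel f).
Hypothesis Kpos : forall x, 0 < K x.
Variable delta : R.
Hypothesis delta0 : 0 < delta.
Hypothesis K_near : forall x, `|x| <= 1 -> delta <= K x.

Lemma persistence_above m a b : a <= b ->
  fine (P (above f (grid_points m a b) 1)) = persistence f (b - a) / 2.
Proof.
move=> ab; rewrite /persistence; have ba : 0 <= b - a by rewrite subr_ge0.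
rewrite (@prob_no_zero _ _ _ P f hf hC2 1 m (fun=> 0) (fun=> b - a) (fun=> ba) ord0).
have -> : grid_points m a b = (fun l => grid_points m 0 (b - a) l + a).
  by apply/funext => l; exact: grid_points_shift.
by rewrite (@above_law _ _ _ _ _ hf _ 1 1)// mulrAC mulfV ?mul1r.
Qed.

Lemma prob_no_zero_persistence a b : a <= b ->
  prob P (no_zero f `[a, b]) = persistence f (b - a).
Proof.
move=> ab; rewrite (@prob_no_zero _ _ _ P f hf hC2 1 0 (fun=> a) (fun=> b) (fun=> ab) ord0).
by rewrite persistence_above// mulrC divfK.
Qed.

Lemma persistence_anti r r' : r' <= r -> persistence f r <= persistence f r'.
Proof.
move=> rr; apply: prob_le => w h t; rewrite /= in_itv/= => /andP[t0 tr].
by apply: h; rewrite /= in_itv/= t0 (le_trans tr).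
Qed.

Lemma persistence_gt0 r : 0 <= r -> 0 < persistence f r.
Proof.
move=> r0; pose m := (Num.truncn r).+1; pose x := grid_points m 0 r.
have [M M0 hM] := paths_bounded_below m hC2 r0.
have near l : exists2 l', (l' < m)%N & delta <= K (x l - x l').
  by apply: (grid_points_cov K_near) => //; rewrite subr0.
have h := block_above_gt0 hf Kpos delta0 near M0 hM.
have := persistence_above m r0; rewrite subr0 => e.
suff : 0 < persistence f r / 2 by rewrite pmulr_lgt0 ?invr_gt0.
rewrite -e; apply: lt_le_trans h _.
apply: fine_probability_le; [exact: measurable_block_above|exact: measurable_above|].
by move=> w h; exists 0%N => l; exact: (h ord0 isT l).
Qed.

Lemma persistence_le1 r : persistence f r <= 1.
Proof.
apply: le_trans (prob_le P (@subsetT _ _)) _; rewrite prob_measurable//.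
by have -> : P [set: T] = 1%E; [rewrite probability_setT|].
Qed.

(** The sign pattern bounds are applied to the two degenerate intervals at 0 and at a distant [y].
    The event [f 0 > 0 > f y] has positive probability [eta], and it forces a zero of a continuous
    path in [[0, r]] as soon as [r >= y]. *)
Lemma persistence_lt1 : (forall c, 0 < c -> exists2 y, 0 < y & c * K y <= K 0) ->
  exists y, exists2 eta, 0 < eta & forall r, y <= r -> persistence f r <= 1 - eta.
Proof.
move=> hK.
(* Strictly below [persistence f 0 / 2], the probability of a given sign at one point. *)
pose ps := persistence f 0 / 4.
have G0 := persistence_gt0 (lexx 0).
have G1 := persistence_le1 0.
have ps0 : 0 < ps by rewrite divr_gt0.
pose D := 4 + 8 * ln ((ps / 2) ^+ 2)^-1.
have D4 : 4 <= D.
  rewrite lerDl mulr_ge0// ln_ge0// invf_ge1 ?exprn_gt0 ?divr_gt0// expr_le1//.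
    by rewrite /ps; lra.
  by rewrite divr_ge0// ltW.
(* The first summand makes [t * D <= 1/2], the second [2 * K y <= delta / 2]. *)
pose c := 32 * D * K 0 ^+ 2 / delta ^+ 2 + 4 * K 0 / delta.
have D0 : 0 < D by exact: lt_le_trans D4.
have c0 : 0 < c.
  by rewrite addr_gt0// divr_gt0 ?exprn_gt0// !mulr_gt0// exprn_gt0.
have [y y0 hy] := hK c c0.
pose a (i : 'I_2) : R := if i == ord0 then 0 else y.
pose x i := grid_points 1 (a i) (a i).
have xE i l : x i l = a i.
  by have := grid_points_itv 1 l (lexx (a i)); rewrite in_itv/= => h; apply/eqP; rewrite eq_le andbC.
have c1 : 32 * D * K 0 * K y <= delta ^+ 2.
  have : 32 * D * K 0 ^+ 2 / delta ^+ 2 * K y <= K 0.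
    apply: le_trans hy; rewrite /c [leRHS]mulrDl lerDl ltW// mulr_gt0// divr_gt0// mulr_gt0//.
  rewrite mulrAC ler_pdivrMr ?exprn_gt0// => h.
  by rewrite -(ler_pM2l (Kpos 0)); apply: le_trans h; rewrite le_eqVlt; apply/orP; left; apply/eqP; ring.
have c2 : 4 * K y <= delta.
  have : 4 * K 0 / delta * K y <= K 0.
    apply: le_trans hy; rewrite /c [leRHS]mulrDl lerDr ltW// mulr_gt0// divr_gt0 ?exprn_gt0//.
    by rewrite !mulr_gt0// exprn_gt0.
  rewrite mulrAC ler_pdivrMr// => h.
  by rewrite -(ler_pM2l (Kpos 0)); apply: le_trans h; rewrite le_eqVlt; apply/orP; left; apply/eqP; ring.
pose t := 4 * K y * ((2 * 1)%:R ^+ 2 * K 0) / delta ^+ 2.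
have e_le : t * D <= 2^-1.
  rewrite /t mulrAC ler_pdivrMr ?exprn_gt0//.
  rewrite muln1; move: c1; move: (delta ^+ 2) => z; lra.
have t0 : 0 <= t.
  by rewrite divr_ge0 ?sqr_ge0// !mulr_ge0// ?sqr_ge0// ltW.
have t_le : t <= 2^-1 by apply: le_trans e_le; rewrite ler_peMr// (le_trans _ D4)// ler1n.
have xf (i i' : 'I_2) (l l' : nat) : i != i' -> K (x i l - x i' l') <= K y.
  rewrite !xE /a; case: (i =P ord0) => [->|/eqP i0]; case: (i' =P ord0) => [->|/eqP i'0] //.
  - by rewrite sub0r covariance_kernelN.
  - by rewrite subr0.
  move: i i' i0 i'0 => [[|[|//]] ?] [[|[|//]] ?]//=.
have sm : (2 * 1)%:R * K y <= delta / 2 by rewrite muln1; lra.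
have psl (i : 'I_2) : ps < fine (P (above f (x i) 1)).
  by rewrite persistence_above// subrr /ps; move: G0 => /=; lra.
have := @sign_pattern_bounds _ _ _ P f hf Kpos delta delta0 K_near 2 1 a a (K y) ps
  isT (fun i => lexx (a i)) (fun i => ltac:(by rewrite subrr truncn0)) (ltW (Kpos y)) xf
  sm t_le e_le ps0 psl (fun i => i != ord0).
set E := [set w | _] => /andP[hE _]; exists y, (fine (P E)).
  apply: lt_le_trans hE; rewrite mulr_gt0 ?expR_gt0// prodr_gt0// => i _.
  exact: lt_trans (psl i).
move=> r yr.
have mE : measurable E by exact: (@measurable_all_above _ _ _ P f 2 x).
have -> : 1 - fine (P E) = prob P (~` E).
  rewrite prob_measurable; last exact: measurableC.
  have -> : P (~` E) = (1 - P E)%E by exact: probability_setC.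
  by rewrite fineB ?fin_num_measure.
have r0 : 0 <= r by rewrite (le_trans (ltW y0)).
rewrite /persistence (@prob_ae_eq _ _ _ P _ (no_zero f `[0, r] `&` ~` E)).
  by apply: prob_le => w [].
move: (ae_continuous hC2); apply: filterS => w cw; split=> [h|[]//]; split=> // Ew.
have /(no_zero_sign r0 cw)[s hs] : forall t, t \in `[0, r] -> f t w != 0 := h.
have s0 := hs 0 (ltac:(by rewrite in_itv/= lexx r0)).
have sy := hs y (ltac:(by rewrite in_itv/= (ltW y0) yr)).
have [j /(_ 0%N)] := Ew ord0 isT; have [j' /(_ 0%N)] := Ew ord_max isT.
have x0 : grid_points 1 (a ord0) (a ord0) 0 = 0 := xE ord0 0%N.
have x1 : grid_points 1 (a ord_max) (a ord_max) 0 = y := xE ord_max 0%N.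
rewrite x0 x1 /sign expr0 expr1 => hj hj'.
have {}hj : 0 < -1 * f y w by apply: lt_trans hj.
have {}hj' : 0 < 1 * f 0 w by apply: lt_trans hj'.
by move: s0 sy hj hj'; case: s {hs}; rewrite ?expr0 ?expr1; lra.
Qed.

End persistence.

(** * Splitting coefficients *)

Section splitting.
Context {R : realType} {d : measure_display} {T : measurableType d}.
Variables (P : probability T R) (f : R -> {RV P >-> R}).
Hypothesis hf : SGP f.
Hypothesis hC2 : C2_smooth f.
Local Notation K := (covariance_kernel f).
Hypothesis Kpos : forall x, 0 < K x.

Lemma Kbar_ge s x : s <= `|x| -> K x <= Kbar K s.
Proof.
move=> sx; have -> : K x = `|K `|x| |.
  by rewrite gtr0_norm//; have [//|_] := ger0P x; rewrite covariance_kernelN.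
apply: ub_le_sup; last by exists `|x| => //=; rewrite in_itv/= sx.
by exists (K 0) => _ [y _ <-]; rewrite gtr0_norm// covariance_kernel_le.
Qed.

Lemma Kbar_gt0 s : 0 < Kbar K s.
Proof. exact: lt_le_trans (Kpos s) (Kbar_ge (ler_norm s)). Qed.

Lemma splitting_coefficient_le k r s (e : R) : 0 <= e <= 1 ->
  (forall I : 'I_k -> set R, separated_intervals r s I ->
    ((1 - e)%:E <= splitting_ratio f I <= 1 / (1 - e)%:E)%E) ->
  splitting_coefficient f k r s <= e.
Proof. by move=> e01 h; apply: ge_inf => //; exists 0 => y [/andP[]]. Qed.

(** The value [e = 1] is always admissible, because [1 / 0 = +oo]. *)
Lemma splitting_coefficient_le1 k r s : splitting_coefficient f k r s <= 1.
Proof.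
apply: splitting_coefficient_le => [|I _]; first by rewrite ler01 lexx.
rewrite subrr inve0 mul1e leey andbT mule_ge0// ?lee_fin ?inve_ge0 ?lee_fin.
  exact: fine_ge0 (outer_measure_ge0 _ _).
by apply: prodr_ge0 => i _; exact: fine_ge0 (outer_measure_ge0 _ _).
Qed.

Variable delta : R.
Hypothesis delta0 : 0 < delta.
Hypothesis K_near : forall x, `|x| <= 1 -> delta <= K x.

(** All [2^k] sign patterns are compared with the same product of halved persistence probabilities,
    and [2^k] such products make up the denominator. *)
Lemma splitting_ratio_bounds (k m : nat) (a b : 'I_k -> R) (kappa ps : R) :
  (2 <= k)%N -> (forall i, a i <= b i) ->
  (forall i, (Num.truncn (b i - a i) < m)%N) -> 0 <= kappa ->
  (forall i i' y y', i != i' -> y \in `[a i, b i] -> y' \in `[a i', b i'] ->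
    K (y - y') <= kappa) ->
  (k * m)%:R * kappa <= delta / 2 ->
  let t := 4 * kappa * ((k * m)%:R ^+ 2 * K 0) / delta ^+ 2 in
  t <= 2^-1 ->
  let e := t * (4 + 8 * ln ((ps / 2) ^+ k)^-1) in
  e <= 2^-1 -> 0 < ps ->
  (forall i, ps < persistence f (b i - a i) / 2) ->
  ((expR (- (k%:R * e)))%:E <= splitting_ratio f (fun i => `[a i, b i]%classic)
     <= (expR (k%:R * e))%:E)%E.
Proof.
move=> k2 ab bam kappa0 far small t t_le e e_le ps0 psl.
pose p i := fine (P (above f (grid_points m (a i) (b i)) 1)).
have pE i : p i = persistence f (b i - a i) / 2 by exact: persistence_above.
have psp i : ps < p i by rewrite pE.
have far' (i i' : 'I_k) (l l' : nat) : i != i' ->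
    K (grid_points m (a i) (b i) l - grid_points m (a i') (b i') l') <= kappa.
  by move=> ii; apply: far ii _ _; exact: grid_points_itv.
have B := sign_pattern_bounds hf Kpos delta0 K_near k2 ab bam kappa0 far' small
  t_le e_le ps0 psp.
have N0 : 0 < \prod_i p i by apply: prodr_gt0 => i _; exact: lt_trans (psp i).
have NE : \prod_i prob P (no_zero f `[a i, b i]) =
    \sum_(s : {ffun 'I_k -> bool}) \prod_i p i.
  rewrite sumr_const card_ffun card_bool card_ord -mulr_natl natrX.
  under eq_bigr do rewrite (prob_no_zero hf hC2 m ab).
  by rewrite big_split/= prodr_const card_ord.
have NE0 : 0 < \prod_i prob P (no_zero f `[a i, b i]).
  by apply: prodr_gt0 => i _; rewrite (prob_no_zero_persistence hf hC2)//;
    have := lt_trans ps0 (psl i); rewrite pmulr_lgt0// invr_gt0.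
rewrite /splitting_ratio inver gt_eqF// -EFinM !lee_fin.
rewrite ler_pdivlMr// ler_pdivrMr// NE (prob_bigcap_no_zero hC2 m ab).
rewrite !mulr_sumr; apply/andP; split; apply: ler_sum => s _.
  by have /andP[] := B s.
by have /andP[] := B s.
Qed.

End splitting.

Theorem proposition3p3 (R : realType) (d : measure_display)
    (T : measurableType d) (P : probability T R) (f : R -> {RV P >-> R})
    (K : R -> R) (hK : K = covariance_kernel f)
    (hf : SGP f) (hC2 : C2_smooth f) (hsd : has_spectral_density K)
    (hpos : forall x : R, 0 < K x)
    (hder : has_ubound (range (fun x : R => `|(K^`())%classic x| / K x)))
    (hmin : forall c1 : R, 0 < c1 -> exists2 c2 : R, 0 < c2 &
       forall r : R, 1 <= r ->
         c1 * Kbar K (c2 * r) <= inf [set K x | x in [set x : R | `|x| <= r]])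
    (k : nat) (hk : (2 <= k)%N) :
  exists2 c : R, 0 < c &
    forall r s : R, c <= r -> c * r <= s ->
      splitting_coefficient f k r s <=
        c * r ^+ 2 * Kbar K s * ln (1 / persistence f r) ^+ 3.
Proof.
subst K; set K := covariance_kernel f in hpos hmin *.
have inf_le x r : `|x| <= r -> inf [set K y | y in [set y : R | `|y| <= r]] <= K x.
  move=> xr; apply: ge_inf; last by exists x.
  by exists 0 => _ [y _ <-]; exact: ltW.
(* With [c1 = 1] and [r = 1], the positive number [Kbar K c2] bounds [K] from below on [[-1, 1]]. *)
have [c2 c20 /(_ 1 (lexx 1)) h2] := hmin 1 ltr01.
rewrite mul1r mulr1 in h2.
set delta := Kbar K c2 in h2.
have delta0 : 0 < delta := Kbar_gt0 hf hpos c2.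
have K_near x : `|x| <= 1 -> delta <= K x by move=> x1; exact: le_trans (inf_le _ _ x1).
(* Decay of [K], obtained by taking [c1] large at the same [r = 1]. *)
have hK c : 0 < c -> exists2 y, 0 < y & c * K y <= K 0.
  move=> c0; have [y y0 /(_ 1 (lexx 1)) hy] := hmin c c0; exists y => //.
  rewrite mulr1 in hy; apply: le_trans (inf_le 0 1 _); last by rewrite normr0.
  apply: le_trans hy; rewrite ler_pM2l//; exact: (Kbar_ge hf hpos (ler_norm y)).
have [y [eta eta0 hy]] := persistence_lt1 hf hC2 hpos delta0 K_near hK.
have K0 : 0 < K 0 := hpos 0.
have kR : 2 <= k%:R :> R by rewrite ler_nat.
(* As [eta <= L], the constants give [t <= A kappa r^2], [4 + 8 ln (1 / p) <= D1 L]
   and [k e <= A3 kappa r^2 L^3]. *)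
pose A := 16 * k%:R ^+ 2 * K 0 / delta ^+ 2.
pose D1 := (4 + 8 * k%:R * ln 8) / eta + 8 * k%:R.
pose A3 := k%:R * A * D1 / eta ^+ 2.
have ln8 : 0 <= ln 8 :> R by rewrite ln_ge0// ler1n.
have k0 : 0 < k%:R :> R by exact: lt_le_trans kR.
have A0 : 0 < A by rewrite divr_gt0 ?exprn_gt0// !mulr_gt0.
have A0' := ltW A0; have eta0' := ltW eta0; have delta0' := ltW delta0; have K0' := ltW K0.
have D10 : 0 <= D1.
  by rewrite addr_ge0 ?divr_ge0 ?addr_ge0 ?mulr_ge0//.
have A30 : 0 <= A3.
  by rewrite /A3 divr_ge0 ?exprn_ge0// mulr_ge0// mulr_ge0.
pose c4 := 4 * k%:R / (delta * eta ^+ 3).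
have c40 : 0 <= c4 by rewrite /c4 divr_ge0 ?mulr_ge0 ?exprn_ge0//.
(* The summands ensure in turn [r >= 1], [r >= y] so that the gap [eta] is available, [k e <= X],
   and that [X < 1] implies [small]. *)
pose c := 1 + `|y| + A3 + c4.
have c1 : 1 <= c by rewrite /c; have := normr_ge0 y; lra.
exists c; first exact: lt_le_trans c1.
move=> r s cr crs.
have c0 : 0 < c by exact: lt_le_trans c1.
have r1 : 1 <= r by exact: le_trans cr.
have r0 : 0 < r by exact: lt_le_trans r1.
have yr : y <= r.
  by apply: le_trans (ler_norm y) _; apply: le_trans cr; rewrite /c; lra.
set kappa := Kbar K s; have kappa0 : 0 < kappa := Kbar_gt0 hf hpos s.
set G := persistence f r.
have G0 : 0 < G := persistence_gt0 hf hC2 hpos delta0 K_near (ltW r0).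
have G1 : G <= 1 - eta := hy r yr.
set L := ln (1 / G).
have LE : L = - ln G by rewrite /L div1r lnV ?posrE.
have etaL : eta <= L.
  rewrite LE lerNr; apply: le_trans (_ : ln (1 + - eta) <= _).
    by rewrite ler_ln ?posrE//; lra.
  by apply: le_ln1Dx; move: G1 G0; lra.
have L0 : 0 < L by exact: lt_le_trans etaL.
set X := c * r ^+ 2 * kappa * L ^+ 3.
have Q0 : 0 <= r ^+ 2 * kappa * L ^+ 3 by rewrite !mulr_ge0 ?exprn_ge0// ltW.
have XE : X = c * (r ^+ 2 * kappa * L ^+ 3) by rewrite /X; ring.
have X0 : 0 <= X by rewrite /X !mulr_ge0 ?exprn_ge0// ltW.
(* For [X >= 1] the trivial bound suffices; otherwise [X < 1] supplies the smallness conditions on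
   [e], [t] and [kappa]. *)
have [X1|X1] := leP 1 X; first exact: le_trans (splitting_coefficient_le1 _ _ _ _) X1.
apply: splitting_coefficient_le; first by rewrite X0 ltW.
move=> I [hI _ hsep].
have /choice[a /choice[b hab]] : forall i, exists a b : R,
    [/\ a <= b, b - a <= r & I i = `[a, b]%classic] by [].
have IE : I = (fun i => `[a i, b i]%classic) by apply/funext => i; have [] := hab i.
pose m := (Num.truncn r).+1.
have mr : m%:R <= 2 * r.
  have /andP[+ _] := truncn_itv (ltW r0); rewrite /m -natr1.
  by move: (_%:R) => z; lra.
(* Strictly below half of every [persistence f (b i - a i)], as these intervals are no longer than
   [r]; then [ps / 2 = G / 8], whence [ln 8] in [D1]. *)
pose ps := G / 4.
have psl i : ps < persistence f (b i - a i) / 2.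
  have [_ bar _] := hab i; have := @persistence_anti _ _ _ P f _ _ bar.
  by rewrite -/G /ps; move: (persistence f _) G0 => z; lra.
have ps0 : 0 < ps by rewrite divr_gt0.
have lnE : ln ((ps / 2) ^+ k)^-1 = k%:R * (ln 8 + L).
  rewrite lnV ?posrE ?exprn_gt0 ?divr_gt0// lnXn ?divr_gt0// LE.
  rewrite -mulNrn -[LHS]mulr_natl.
  congr (_ * _); have -> : ps / 2 = G / 8 by rewrite /ps; field.
  by rewrite ln_div ?posrE//; ring.
pose t := 4 * kappa * ((k * m)%:R ^+ 2 * K 0) / delta ^+ 2.
pose e := t * (4 + 8 * ln ((ps / 2) ^+ k)^-1).
have t0 : 0 <= t by rewrite divr_ge0 ?sqr_ge0// !mulr_ge0 ?sqr_ge0// ltW.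
have tA : t <= A * (kappa * r ^+ 2).
  have -> : A * (kappa * r ^+ 2) = 4 * kappa * ((k%:R * (2 * r)) ^+ 2 * K 0) / delta ^+ 2.
    by rewrite /A; ring.
  rewrite ler_pM2r ?invr_gt0 ?exprn_gt0// ler_pM2l ?mulr_gt0// ler_pM2r//.
  by rewrite natrM lerXn2r ?nnegrE ?mulr_ge0 ?ler_wpM2l// ltW.
have DL : 4 + 8 * ln ((ps / 2) ^+ k)^-1 <= D1 * L.
  rewrite lnE /D1 [leRHS]mulrDl.
  have : (4 + 8 * k%:R * ln 8) <= (4 + 8 * k%:R * ln 8) / eta * L.
    rewrite [leRHS]mulrAC ler_pdivlMr// ler_wpM2l// addr_ge0// mulr_ge0// mulr_ge0//.
  move: ((4 + _) / eta * L) => z h.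
  apply: le_trans (lerD h (lexx (8 * k%:R * L))); rewrite le_eqVlt; apply/orP; left.
  by apply/eqP; ring.
have D4 : 4 <= 4 + 8 * ln ((ps / 2) ^+ k)^-1.
  by rewrite lnE lerDl !mulr_ge0// addr_ge0// ltW.
have keX : k%:R * e <= X.
  apply: le_trans (_ : k%:R * (A * (kappa * r ^+ 2) * (D1 * L)) <= _).
    rewrite ler_wpM2l// ler_pM//; exact: le_trans D4.
  apply: le_trans (_ : A3 * (r ^+ 2 * kappa * L ^+ 3) <= _); last first.
    rewrite XE ler_wpM2r//.
    by rewrite /c; have := normr_ge0 y; lra.
  have -> : k%:R * (A * (kappa * r ^+ 2) * (D1 * L)) =
      A3 * (r ^+ 2 * kappa * (eta ^+ 2 * L)).
    by rewrite /A3; field; rewrite gt_eqF.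
  rewrite ler_wpM2l// ler_wpM2l//; first by rewrite mulr_ge0 ?exprn_ge0// ltW.
  by rewrite [leRHS]exprSr ler_wpM2r ?(ltW L0)// lerXn2r ?nnegrE// ltW.
have e0 : 0 <= e by rewrite /e mulr_ge0// (le_trans _ D4).
have e_le : e <= 2^-1.
  have : 2 * e <= k%:R * e by rewrite ler_wpM2r.
  by move: keX X1; lra.
have t_le : t <= 2^-1.
  by apply: le_trans e_le; rewrite /e ler_peMr// (le_trans _ D4)// ler1n.
have small : (k * m)%:R * kappa <= delta / 2.
  have : c4 * (r ^+ 2 * kappa * L ^+ 3) <= 1.
    apply: le_trans (ltW X1); rewrite XE ler_wpM2r//.
    by rewrite /c; have := normr_ge0 y; lra.
  move=> h; have {h} : c4 * (r * kappa * eta ^+ 3) <= 1.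
    apply: le_trans h; rewrite ler_wpM2l// ler_pM ?mulr_ge0 ?exprn_ge0 ?(ltW r0) ?(ltW kappa0) ?(ltW eta0)//.
      by rewrite ler_pM2r// expr2 ler_peMr// ltW.
    by rewrite lerXn2r ?nnegrE// ltW.
  have -> : c4 * (r * kappa * eta ^+ 3) = 4 * k%:R * r * kappa / delta.
    by rewrite /c4; field; rewrite !gt_eqF.
  rewrite ler_pdivrMr// mul1r => h.
  have : (k * m)%:R * kappa <= k%:R * (2 * r) * kappa.
    by rewrite ler_pM2r// natrM ler_wpM2l.
  have -> : k%:R * (2 * r) * kappa = 4 * k%:R * r * kappa / 2 by field.
  by move: h; move: (4 * k%:R * r * kappa) => z; lra.
have ab i : a i <= b i by have [] := hab i.
have bam i : (Num.truncn (b i - a i) < m)%N.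
  by rewrite ltnS; apply: le_truncn; have [] := hab i.
have far i i' z z' : i != i' -> z \in `[a i, b i] -> z' \in `[a i', b i'] ->
    K (z - z') <= kappa.
  move=> ii hz hz'; apply: (Kbar_ge hf hpos); apply: (hsep i i' ii).
    by rewrite IE.
  by rewrite IE.
have := splitting_ratio_bounds hf hC2 hpos delta0 K_near hk ab bam (ltW kappa0) far
  small t_le e_le ps0 psl.
rewrite IE => /andP[lo up]; apply/andP; split.
  apply: le_trans lo; rewrite lee_fin; apply: le_trans (expR_ge1Dx _).
  by rewrite lerD2l lerN2.
apply: le_trans up _; rewrite mul1e inver gt_eqF ?subr_gt0// lee_fin.
rewrite -[X in X <= _]invrK -expRN lef_pV2 ?posrE ?subr_gt0 ?expR_gt0//.
apply: le_trans (expR_ge1Dx _).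
by rewrite lerD2l lerN2.
Qed.
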